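(* Let $G$ be a unimodular locally compact second-countable group acting continuously on a second-countable topological space $B$ with a Borel probability measure $\nu$, the action preserving sets of $\nu$-measure zero, and let $\pi_\nu:G\to\mathcal U(L^2(B,\nu))$ be the associated quasi-regular representation. Suppose that for every relatively compact open set $U\subset G$, $\sup_{g\in U}\|\pi_\nu(g)\mathbb 1_B\|_{L^\infty(B,\nu)}<\infty$. Let $L$ be a length function on $G$ and let $d$ be a distance on $B$ inducing the topology of $B$. Let $(E_n)_{n\in\mathbb N}$ be a sequence of relatively compact Borel subsets of $G$ with $E_n=E_n^{-1}$ and $\lim_{n\to\infty}\mathrm{vol}(E_n)=\infty$, and let $e_n:E_n\to B$ be a sequence of Borel maps. Assume the following two conditions: (1) for each $r>0$ there is a non-increasing function $h_r:[0,\infty)\to[0,\infty)$ with $\lim_{s\to\infty}h_r(s)=0$ such that for all $n\in\mathbb N$ and all $g\in E_n$ $$\frac{\langle\pi_\nu(g)\mathbb 1_B,\mathbb 1_{\{b\in B:\,d(b,e_n(g))\ge r\}}\rangle}{\Xi(g)}\le h_r(L(g));$$ (2) for all Borel subsets $U,V\subset B$ with $\nu(\partial U)=\nu(\partial V)=0$ $$\limsup_{n\to\infty}\frac1{\mathrm{vol}(E_n)}\int_{E_n}\mathbb 1_U(e_n(g^{-1}))\,\mathbb 1_V(e_n(g))\,dg\le\nu(U)\nu(V).$$ Then: (a) for all Borel subsets $U,V,W\subset B$ with $\nu(\partial U)=\nu(\partial V)=\nu(\partial W)=0$ $$\lim_{n\to\infty}\langle M_{(E_n,e_n)}^{\mathbb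 1_U}\mathbb 1_V,\mathbb 1_W\rangle=\nu(U\cap W)\,\nu(V).$$ (b) Assume moreover that $\sup_n\|M_{E_n}^{\mathbb 1_B}\mathbb 1_B\|_\infty<\infty$. Let $H\subset L^\infty(B,\nu)$ be the smallest subspace containing all characteristic functions $\mathbb 1_U$ with $U\subset B$ Borel such that $\nu(\partial U)=0$, and let $\overline H\subset L^\infty(B,\nu)$ denote its closure. Then $\pi_\nu$ is ergodic relative to the family $(E_n,e_n)$ and any $f\in\overline H$.
   Context: Conventions. $dg$ is a Haar measure on $G$ and $\mathrm{vol}(E)=\int_G\mathbb 1_E(g)\,dg$. The quasi-regular representation is $(\pi_\nu(g)\varphi)(b)=\varphi(g^{-1}b)\big(\frac{dg_*\nu}{d\nu}(b)\big)^{1/2}$ on $L^2(B,\nu)$, with $\langle\varphi,\psi\rangle=\int_B\varphi\overline\psi\,d\nu$. The Harish-Chandra function is $\Xi(g)=\langle\pi_\nu(g)\mathbb 1_B,\mathbb 1_B\rangle$. $\partial U$ denotes the topological boundary of $U$, and $\|\cdot\|_\infty$ is the norm of $L^\infty(B,\nu)$. A length function $L:G\to[0,\infty)$ is a locally bounded proper Borel map with $L(gh)\le L(g)+L(h)$, $L(g^{-1})=L(g)$ for all $g,h\in G$ and $L(e)=0$ for the neutral element $e$. For a relatively compact Borel set $E\subset G$ with $\mathrm{vol}(E)\ne0$, a Borel map $e:E\to B$ and a bounded Borel function $f:B\to\mathbb C$, define the bounded operator on $L^2(B,\nu)$ $$M^f_{(E,e)}=\frac1{\mathrm{vol}(E)}\int_E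 f(e(g))\frac{\pi_\nu(g)}{\Xi(g)}\,dg .$$ When $f=\mathbb 1_B$ the map $e$ is irrelevant and one writes $M_E^{\mathbb 1_B}$. (These operators are considered for $n$ with $\mathrm{vol}(E_n)\neq0$, which holds for all large $n$.) Definition: $\pi_\nu$ is ergodic relative to the family $(E_n,e_n)$ and $f$ if $\lim_{n\to\infty}M^f_{(E_n,e_n)}=m(f)P_{\mathbb 1_B}$ in the weak operator topology, i.e. for all $\varphi,\psi\in L^2(B,\nu)$, $$\lim_{n\to\infty}\frac1{\mathrm{vol}(E_n)}\int_{E_n}f(e_n(g))\frac{\langle\pi_\nu(g)\varphi,\psi\rangle}{\Xi(g)}\,dg=\langle\varphi,\mathbb 1_B\rangle\langle f,\psi\rangle,$$ where $m(f)$ is multiplication by $f$ and $P_{\mathbb 1_B}$ is the orthogonal projection onto the constants.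
   Formalization: In (b), since M^f depends on f pointwise and not only on its ν-class (it fails for f=1_N, N the countable null range of the e_n), ergodicity is claimed for those representatives of a class in the closure of H that are uniform limits of elements of H; each class is shown to have one. *)

(* Defs.v *)
From HB Require Import structures.
From mathcomp Require Import all_boot all_order all_algebra.
From mathcomp Require Import all_classical all_reals all_analysis.
From mathcomp Require Import complex.

Set Implicit Arguments.
Unset Strict Implicit.
Unset Printing Implicit Defensive.
Import Order.TTheory GRing.Theory Num.Theory.
Import numFieldNormedType.Exports.

Local Open Scope classical_set_scope.
Local Open Scope ring_scope.
Local Open Scope complex_scope.

HB.mixin Record isTopologicalGroup G & PointedTopological G & Group G := {
  mulg_continuous : continuous (fun p : (G * G)%type => (p.1 * p.2)%g);
  invg_continuous : continuous (fun g : G => (g^-1)%g)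
}.

#[short(type="topologicalGroupType")]
HB.structure Definition TopologicalGroup :=
  {G of isTopologicalGroup G & PointedTopological G & Group G}.

(* The carrier of T, equipped with its Borel sigma-algebra. *)
Notation borel T := (g_sigma_algebraType (@open T)).

Definition boundary {T : topologicalType} (U : set T) : set T :=
  closure U `\` interior U.

Definition metric_inducing_topology {R : realType} {T : topologicalType}
    (d : T -> T -> R) : Prop :=
  [/\ forall x y, 0 <= d x y,
      forall x y, d x y = 0 <-> x = y,
      forall x y, d x y = d y x,
      forall x y z, d x z <= d x y + d y z
    & forall (x : T) (A : set T),
        nbhs x A <-> exists2 r : R, 0 < r & [set y | d x y < r] `<=` A].

Section haar.
Context {R : realType} {G : topologicalGroupType}.
Implicit Types (mu : {measure set (borel G) -> \bar R}).

(* On a second-countable locally compact Hausdorff group, a Borel measure that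
   is finite on compact sets is automatically regular. *)
Definition left_haar mu : Prop :=
  [/\ mu [set: borel G] != 0%E,
      forall K : set G, compact K -> (mu K < +oo)%E
    & forall (g : G) (A : set G), measurable (A : set (borel G)) ->
        mu [set (g * x)%g | x in A] = mu A].

Definition right_invariant mu : Prop :=
  forall (g : G) (A : set G), measurable (A : set (borel G)) ->
    mu [set (x * g)%g | x in A] = mu A.

Definition vol mu (E : set G) : R := fine (mu E).

(* L is not assumed continuous, hence properness is stated with relatively
   compact sublevel sets. *)
Definition length_function (L : G -> R) : Prop :=
  measurable_fun [set: borel G] (L : borel G -> R) /\
  [/\ forall g, 0 <= L g,
      forall g : G, exists M : R, \forall h \near g, L h <= M,
      forall r : R, precompact [set g | L g <= r],
      forall g h, L (g * h)%g <= L g + L h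
    & (forall g, L (g^-1)%g = L g) /\ L 1%g = 0].

End haar.

Definition unimodular (R : realType) (G : topologicalGroupType) : Prop :=
  forall mu : {measure set (borel G) -> \bar R},
    left_haar mu -> right_invariant mu.

Record continuous_action (G : topologicalGroupType) (B : ptopologicalType) := {
  act :> G -> B -> B;
  act1 : forall b, act 1%g b = b;
  actM : forall g h b, act (g * h)%g b = act g (act h b);
  act_continuous : continuous (fun p : (G * B)%type => act p.1 p.2)
}.

Definition cindic {R : realType} {T : Type} (A : set T) : T -> R[i] :=
  fun x => (\1_A x : R)%:C.

Section complex_functions.
Context {R : realType} d {T : measurableType d}.
Implicit Types (mu : {measure set T -> \bar R}) (f h : T -> R[i]).

Definition cmeasurable f : Prop :=
  measurable_fun [set: T] (fun x => complex.Re (f x)) /\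
  measurable_fun [set: T] (fun x => complex.Im (f x)).

Definition cintegral mu (D : set T) f : R[i] :=
  (\int[mu]_(x in D) complex.Re (f x))%R +i*
  (\int[mu]_(x in D) complex.Im (f x))%R.

Definition cnorm mu (p : \bar R) f : \bar R :=
  Lnorm mu p (fun x => (Normc.normc (f x))%:E).

Definition L2 mu f : Prop := cmeasurable f /\ (cnorm mu 2%:E f < +oo)%E.

Definition inner mu f h : R[i] := cintegral mu setT (fun x => f x * (h x)^*).

End complex_functions.

Section translate.
Context {R : realType} {G : topologicalGroupType} {B : ptopologicalType}.
Variables (a : continuous_action G B) (nu : probability (borel B) R).

Definition quasi_invariant : Prop :=
  forall (g : G) (A : set B), measurable (A : set (borel B)) ->
    nu A = 0%E -> nu [set a g b | b in A] = 0%E.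

Lemma act_measurable (g : G) :
  measurable_fun [set: borel B] (a g : borel B -> borel B).
Proof.
apply: (@measurability _ _ (borel B) (borel B) _ _ (@open B)) => // _ [U oU <-]; rewrite setTI.
apply: sub_sigma_algebra.
have cg : continuous (a g).
  move=> b; apply: (@continuous_comp _ _ _ (fun b => (g, b))
    (fun p : (G * B)%type => a p.1 p.2)); last exact: act_continuous.
  by apply: cvg_pair => //; exact: cvg_cst.
by move/continuousP : cg; apply.
Qed.

Definition translate (g : G) : set (borel B) -> \bar R :=
  pushforward nu (a g : borel B -> borel B).

Let translate0 g : translate g set0 = 0%E.
Proof. by rewrite /translate /pushforward preimage_set0 measure0. Qed.

Let translate_ge0 g A : (0 <= translate g A)%E.
Proof. by rewrite /translate /pushforward. Qed.

Let translate_sigma_additive g : semi_sigma_additive (translate g).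
Proof.
by apply: measure_semi_sigma_additive; exact: act_measurable.
Qed.

HB.instance Definition _ g := isMeasure.Build _ _ _ (translate g)
  (translate0 g) (translate_ge0 g) (@translate_sigma_additive g).

Let translate_finite g : fin_num_fun (translate g).
Proof.
move=> A mA; apply: fin_num_measure.
by rewrite -[X in measurable X]setTI; exact: act_measurable.
Qed.

HB.instance Definition _ g :=
  Measure_isFinite.Build _ _ _ (translate g) (@translate_finite g).

End translate.

Section quasi_regular.
Context {R : realType} {G : topologicalGroupType} {B : ptopologicalType}.
Variables (a : continuous_action G B) (nu : probability (borel B) R).
Implicit Types (phi psi f : borel B -> R[i]) (g : G).

Definition qrep g phi : borel B -> R[i] := fun b =>
  phi (a (g^-1)%g b) * (Num.sqrt (fine (Radon_Nikodym (translate a nu g) nu b)))%:C.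

Definition constant1 : borel B -> R[i] := cst 1.

Definition harish_chandra g : R[i] := inner nu (qrep g constant1) constant1.

Variable mu : {measure set (borel G) -> \bar R}.
Implicit Types (E : set G) (e : G -> B).

(* The matrix coefficient <M phi, psi> of the operator M attached to (E, e)
   and f. *)
Definition avg_coef E e f phi psi : R[i] :=
  ((vol mu E)^-1)%:C *
  cintegral mu E
    (fun g => f (e g) * (inner nu (qrep g phi) psi / harish_chandra g)).

(* The operator-valued integral is a weak integral: [avg_op E e f phi] is the
   element of L^2 (unique up to null sets) whose inner products with all psi
   in L^2 are the coefficients above. *)
Definition avg_op E e f phi : borel B -> R[i] :=
  xget (cst 0) [set h | L2 nu h /\
    forall psi, L2 nu psi -> inner nu h psi = avg_coef E e f phi psi].

Definition ergodic_relative (E : nat -> set G) (e : nat -> G -> B) f : Prop :=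
  forall phi psi, L2 nu phi -> L2 nu psi ->
    (avg_coef (E n) (e n) f phi psi : (R[i])^o) @[n --> \oo] -->
    (inner nu phi constant1 * inner nu f psi : (R[i])^o).

End quasi_regular.

Section continuity_span.
Context {R : realType} {B : ptopologicalType}.
Variable nu : probability (borel B) R.
Implicit Types (U : set B) (f h : borel B -> R[i]) (H : set (borel B -> R[i])).

Definition continuity_set U : Prop :=
  measurable (U : set (borel B)) /\ nu (boundary U) = 0%E.

Definition linear_subspace H : Prop :=
  H (cst 0) /\ forall (c : R[i]) f h, H f -> H h -> H (fun b => c * f b + h b).

Definition continuity_span : set (borel B -> R[i]) :=
  smallest linear_subspace [set f | exists2 U, continuity_set U & f = cindic U].

Definition Linfty_closure H : set (borel B -> R[i]) :=
  [set f | [/\ cmeasurable f, (cnorm nu +oo f < +oo)%E &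
    forall eps : R, 0 < eps ->
      exists2 h, H h & (cnorm nu +oo (fun b => (f b - h b)%R) < eps%:E)%E]].

Definition uniform_closure H : set (borel B -> R[i]) :=
  [set f | forall eps : R, 0 < eps ->
    exists2 h, H h & forall b, Normc.normc (f b - h b) < eps].

(* The averaging operators evaluate f at the points e g, so they are not defined
   on classes modulo null sets: if the e_n take values in a null set, modifying
   f there may change every operator.  The representatives used for a class in
   the L^oo-closure of H are those that are uniform limits of elements of H. *)
Definition representatives H f : set (borel B -> R[i]) :=
  [set f0 | uniform_closure H f0 /\ {ae nu, forall b, f0 b = f b}].

End continuity_span.

(* Main.v *)
(* Write sigma_g for the square root of the Radon-Nikodym derivative of g_* nu
   and Xi(g) for its integral.  Condition (1) says that the probability density
   sigma_g / Xi(g) concentrates near e_n(g); applied to g^-1 and combined with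
   the unitarity of pi_nu, it says that the mass comes from points g b with b
   near e_n(g^-1).  Hence <pi_nu(g) 1_V, 1_W> / Xi(g) is asymptotically at most
   1_{V_r}(e_n(g^-1)) 1_{W_r}(e_n(g)) with thickened sets V_r, W_r, and condition
   (2) bounds the limsup of <M^{1_U} 1_V, 1_W> by nu(U cap W) nu(V).  The averages
   of (U^c, B, B), (U, V^c, B), (U, V, W^c), (U, V, W) sum to 1, and so do their
   bounds; therefore all four bounds are limits, which is (a).

   For (b), the uniform bound on M 1, the inversion invariance of Haar measure
   and |F(g^-1 b) H(b)| <= t F(g^-1 b)^2 + H(b)^2 / t bound the averages, as
   trilinear forms in f (sup norm) and F, H (L^2 norm), uniformly in n.
   Convergence then extends from indicators of continuity sets, which span a
   dense subspace of L^2, to all F and H and to uniform limits f.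

   Measurability in g is obtained from a jointly measurable version of
   sigma_g(b) / Xi(g).  The averages are studied for real functions first. *)

Require Import Defs.
From HB Require Import structures.
From mathcomp Require Import all_boot all_order all_algebra.
From mathcomp Require Import finmap.
From mathcomp Require Import all_classical all_reals all_analysis.
From mathcomp Require Import measurable_realfun ess_sup_inf complex ring lra.

Set Implicit Arguments.
Unset Strict Implicit.
Unset Printing Implicit Defensive.
Import Order.TTheory GRing.Theory Num.Theory.
Import numFieldNormedType.Exports.

Local Open Scope classical_set_scope.
Local Open Scope ring_scope.
Local Open Scope complex_scope.


(** The derivative of [g_* nu] is chosen separately for each [g], so nothing makes
    [<pi_nu(g) phi, psi>] measurable in [g] as it stands. Two facts repair this: the integral is a
    difference of lower integrals, which ignores changes on null sets, and the density of one
    measure on [G * B] gives the right function of [b] for almost every [g] in [E n]. This density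
    is then cut off at a constant, which changes nothing for those [g], because [sigma_g <= C] on
    the relatively compact [E n] and [1 = int sigma_g^2 <= C Xi(g)]. With the bounded weight [w]
    every average is one absolutely convergent integral over [G * B], and Fubini gives linearity in
    each argument as well as the operator as an explicit function of [b].

    The hypothesis of (b) controls only [M 1], not an operator norm. It serves as a Schur test: the
    integral of [w] over [g] is at most [K vol(E n)] for almost every [b], and inversion invariance
    lets this single bound serve both squares. The free [t] does the work of Cauchy-Schwarz: it is
    fixed first, to make the term of the fixed function small, and the approximation error is chosen
    afterwards. *)

Section measure_theory.
Local Open Scope ereal_scope.
Context d (T : measurableType d) (R : realType).
Implicit Types mu : {measure set T -> \bar R}.

Import HBNNSimple.

(* The integral of a non-measurable function is a lower integral; it does not
   see null sets either. *)
Lemma integral_eq_off_null mu (D N : set T) (f g : T -> \bar R) :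
  measurable N -> mu N = 0 -> (forall x, D x -> ~ N x -> f x = g x) ->
  \int[mu]_(x in D) f x = \int[mu]_(x in D) g x.
Proof.
move=> mN N0 fg.
have key (F G : T -> \bar R) : (forall x, 0 <= G x) ->
    (forall x, ~ N x -> F x = G x) ->
    ereal_sup [set sintegral mu h |
      h in [set h : {nnsfun T >-> R} | forall x, (h x)%:E <= F x]] <=
    ereal_sup [set sintegral mu h |
      h in [set h : {nnsfun T >-> R} | forall x, (h x)%:E <= G x]].
  move=> G0 FG; apply: ge_ereal_sup => _ [h hF <-].
  (* Cutting [h] to the complement of [N] keeps its integral. On [N] the cut function is zero, hence
     below the nonnegative [G], whatever [F] was there. *)
  have mCN := measurableC mN.
  apply: ereal_sup_ubound; exists (proj_nnsfun h mCN).
    move=> x; rewrite -mrestrict patchE; case: ifPn => // /set_mem Nx.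
    by rewrite -FG.
  rewrite -!integralT_nnsfun; apply: ge0_ae_eq_integral => //.
  - exact/measurable_EFinP.
  - exact/measurable_EFinP.
  - by move=> x _; rewrite lee_fin.
  - by move=> x _; rewrite lee_fin.
  - exists N; split => // x /= /not_implyP[_] H; apply: contrapT => Nx; apply: H.
    by rewrite mindicE mem_set ?mulr1.
have keyE (F G : T -> \bar R) : (forall x, 0 <= F x) -> (forall x, 0 <= G x) ->
    (forall x, ~ N x -> F x = G x) ->
    ereal_sup [set sintegral mu h |
      h in [set h : {nnsfun T >-> R} | forall x, (h x)%:E <= F x]] =
    ereal_sup [set sintegral mu h |
      h in [set h : {nnsfun T >-> R} | forall x, (h x)%:E <= G x]].
  move=> F0 G0 FG; apply/eqP; rewrite eq_le !key//.
  by move=> x Nx; rewrite FG.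
have fgD x : ~ N x -> (f \_ D) x = (g \_ D) x.
  by move=> Nx; rewrite !patchE; case: ifPn => // /set_mem Dx; rewrite fg.
rewrite /integral; congr (_ - _); apply: keyE => x.
- exact: funepos_ge0.
- exact: funepos_ge0.
- by move=> Nx; rewrite !funeposE fgD.
- exact: funeneg_ge0.
- exact: funeneg_ge0.
- by move=> Nx; rewrite !funenegE fgD.
Qed.

(** Lower integrals are monotone without measurability. This allows bounding the matrix coefficients
    directly as functions of [g]. *)
Lemma ge0_le_integral_nomeas mu (D : set T) (f g : T -> \bar R) :
  (forall x, D x -> 0 <= f x) -> (forall x, D x -> f x <= g x) ->
  \int[mu]_(x in D) f x <= \int[mu]_(x in D) g x.
Proof.
move=> f0 fg.
have g0 x : D x -> 0 <= g x by move=> Dx; exact: le_trans (f0 _ Dx) (fg _ Dx).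
rewrite !ge0_integralE//.
apply: ge_ereal_sup => _ [h hf <-]; apply: ereal_sup_ubound; exists h => // x.
  rewrite (le_trans (hf x))// !patchE; case: ifPn => // /set_mem; exact: fg.
Qed.

(** [mfrestr] turns [mu] on [E] into a finite measure on the whole space, the form in which products
    and Fubini are used below. The complement of [E] is null for it. *)
Lemma ge0_integral_mfrestr mu (E : set T) (mE : measurable E)
    (Eoo : mu E < +oo) (f : T -> \bar R) :
  measurable_fun setT f -> (forall x, 0 <= f x) ->
  \int[mfrestr mE Eoo]_x f x = \int[mu]_(x in E) f x.
Proof.
move=> mf f0.
have -> : \int[mu]_(x in E) f x = \int[mfrestr mE Eoo]_(x in E) f x.
  apply: eq_measure_integral => A mA AE.
  by rewrite /= /mfrestr /mrestr setIidl.
rewrite (@ge0_negligible_integral _ _ _ _ setT (~` E))//; last 2 first.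
- exact: measurableC.
- by rewrite /= /mfrestr /mrestr setICl measure0.
- by rewrite setTD setCK.
Qed.

Lemma integral_mfrestr mu (E : set T) (mE : measurable E)
    (Eoo : mu E < +oo) (f : T -> \bar R) :
  measurable_fun setT f ->
  \int[mfrestr mE Eoo]_x f x = \int[mu]_(x in E) f x.
Proof.
move=> mf; rewrite [LHS]integralE [RHS]integralE !ge0_integral_mfrestr//.
- exact: measurable_funeneg.
- exact: measurable_funepos.
Qed.

(** Change of variables is available for the Radon-Nikodym derivative; [rho] has the same integrals
    over all measurable sets, so the two agree almost everywhere. *)
Lemma ge0_integral_density (nu1 : {finite_measure set T -> \bar R})
    (nu2 : {sigma_finite_measure set T -> \bar R}) (rho F : T -> \bar R) :
  nu2.-integrable setT rho ->
  (forall A, measurable A -> nu1 A = \int[nu2]_(x in A) rho x) ->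
  measurable_fun setT F -> (forall x, 0 <= F x) ->
  \int[nu1]_x F x = \int[nu2]_x (F x * rho x).
Proof.
move=> irho rhoE mF F0.
have dom : nu1 `<< nu2.
  apply/null_content_dominatesP => A mA A0; rewrite rhoE//; apply: null_set_integral => //.
  by apply: measurable_funTS; exact: measurable_int irho.
rewrite -(Radon_Nikodym_SigmaFinite.change_of_variables dom)//.
have mf : measurable_fun setT (Radon_Nikodym_SigmaFinite.f nu1 nu2).
  by apply: measurable_int (Radon_Nikodym_SigmaFinite.f_integrable dom).
apply: ae_eq_integral => //.
- exact: emeasurable_funM.
- by apply: emeasurable_funM => //; exact: measurable_int irho.
apply: ae_eqe_mul2l; apply: integral_ae_eq => //.
- exact: (Radon_Nikodym_SigmaFinite.f_integrable dom).
- exact: measurable_int irho.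
- move=> A _ mA; rewrite -rhoE//.
  by rewrite (Radon_Nikodym_SigmaFinite.f_integral dom).
Qed.

End measure_theory.

(** * Second countable spaces and their Borel sets *)

Section second_countable.
Context {X : ptopologicalType}.

Lemma second_countable_seq : @second_countable X ->
  exists2 b : nat -> set X, (forall n, open (b n)) &
    forall (U : set X) x, open U -> U x -> exists2 n, b n x & b n `<=` U.
Proof.
move=> [D cD [Dop Dnb]].
have D0 : D !=set0.
  have [U [DU _] _] := Dnb point setT filterT.
  by exists U.
have [b bD] : exists b : nat -> set X, range b = D.
  have /pfcard_geP[D00|[b]] := cD; first by move: D0; rewrite D00 => -[].
  exists b; exact: image_eq.
exists b => [n|U x oU Ux].
  by apply: Dop; rewrite -bD; exists n.
have [V [DV Vx] VU] := Dnb x U (open_nbhs_nbhs (conj oU Ux)).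
by move: DV; rewrite -bD => -[n _ bn]; exists n; rewrite bn.
Qed.

(** Finite intersections of base sets form a generating pi-system; the empty intersection is the
    whole space. Since there are only countably many of them, equality of two families of measures
    can be tested almost everywhere in a parameter. *)
Lemma borel_measure_unique (R : realType) (b : nat -> set X)
    (m1 m2 : {finite_measure set (borel X) -> \bar R}) :
  (forall n, open (b n)) ->
  (forall (U : set X) x, open U -> U x -> exists2 n, b n x & b n `<=` U) ->
  (forall s : seq nat, m1 (\big[setI/setT]_(i <- s) b i) =
                       m2 (\big[setI/setT]_(i <- s) b i)) ->
  forall A, measurable (A : set (borel X)) -> m1 A = m2 A.
Proof.
move=> bo bU m12.
pose G := range (fun s : seq nat => \big[setI/setT]_(i <- s) b i).
have oG : G `<=` @open X.
  by move=> _ [s _ <-]; elim/big_ind : _ => //; [exact: openT|exact: openI].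
apply: (@measure_unique _ _ (borel X) G (fun=> setT)).
- rewrite eqEsubset; split.
    apply: smallest_sub; first exact: smallest_sigma_algebra.
    move=> U oU.
    have -> : U = \bigcup_(n in [set n | b n `<=` U]) b n.
      rewrite eqEsubset; split => [x Ux|x [n bnU /bnU]//].
      by have [n bnx bnU] := bU _ _ oU Ux; exists n.
    rewrite bigcup_mkcond.
    have : sigma_algebra setT <<s G >> by exact: smallest_sigma_algebra.
    move=> [G0 GC Gcup]; apply: Gcup => n; case: ifPn => // _.
    apply: sub_sigma_algebra; exists [:: n] => //.
    by rewrite big_seq1.
  by apply: smallest_sub; [exact: smallest_sigma_algebra|move=> A /oG; exact: sub_sigma_algebra].
- move=> _ _ [s _ <-] [t _ <-]; exists (s ++ t) => //.
  by rewrite big_cat.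
- by move=> _; exists [::] => //; rewrite big_nil.
- by rewrite bigcup_const.
- by move=> _ [s _ <-]; exact: m12.
- by move=> _; rewrite -ge0_fin_numE// fin_num_measure.
Qed.

End second_countable.

(** The countable bases make every open set of the product a countable union of open rectangles, so
    it belongs to the product of the Borel sigma-algebras. *)
Lemma continuous2_measurable (X Y Z : ptopologicalType) (f : X * Y -> Z) :
  @second_countable X -> @second_countable Y -> continuous f ->
  measurable_fun [set: borel X * borel Y] (f : borel X * borel Y -> borel Z).
Proof.
move=> /second_countable_seq[b bo bU] /second_countable_seq[c co cU] cf.
apply: (@measurability _ _ _ (borel Z) _ _ (@open Z)) => // _ [U oU <-]; rewrite setTI.
have /continuousP/(_ _ oU) oV := cf.
have -> : f @^-1` U = \bigcup_(n in [set: nat])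
    \bigcup_(m in [set: nat]) if `[< b n `*` c m `<=` f @^-1` U >]
                       then b n `*` c m else set0.
  rewrite eqEsubset; split => [[x y] Uxy|xy [n _ [m _]]]; last first.
    by case: asboolP => // sub; exact: sub.
  have [[P Q] /= [Px Qy] PQ] : nbhs (x, y) (f @^-1` U) by exact: open_nbhs_nbhs.
  rewrite nbhsE in Px; rewrite nbhsE in Qy.
  have [P' [oP' P'x] P'P] := Px; have [Q' [oQ' Q'y] Q'Q] := Qy.
  have [n bn bP] := bU _ _ oP' P'x; have [m cm cQ] := cU _ _ oQ' Q'y.
  exists n => //; exists m => //; case: asboolP => //; case.
  by move=> [u v] [/= /bP/P'P ? /cQ/Q'Q ?]; exact: PQ.
apply: bigcupT_measurable => n; apply: bigcupT_measurable => m.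
case: asboolP => // _; apply: measurableX; exact: sub_sigma_algebra.
Qed.

(** * Haar measure *)

Section sigma_finite_copy.
Context d (T : measurableType d) (R : realType).
Variables (mu : {measure set T -> \bar R}) (muT : sigma_finite setT mu).

(** The proof is an argument of the copy so that the structure declared on it can be inferred from
    the term. [image_measure] and [density_measure] below follow the same pattern. *)
Definition sigma_finite_copy & sigma_finite setT mu : set T -> \bar R := mu.

HB.instance Definition _ := Measure.on (sigma_finite_copy muT).
HB.instance Definition _ :=
  Measure_isSigmaFinite.Build _ _ _ (sigma_finite_copy muT) muT.

End sigma_finite_copy.

Section haar_measure.
Context {R : realType} {G : topologicalGroupType}.
Hypothesis scG : @second_countable G.

Lemma locally_compact_nbhs (x : G) : locally_compact [set: G] ->
  exists2 U : set G, nbhs x U & compact U /\ closed U.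
Proof. by move=> /(_ x I); rewrite withinET => -[U xU cU]; exists U. Qed.

Lemma measurable_mulg :
  measurable_fun [set: borel G * borel G]
    ((fun p : borel G * borel G => (p.1 * p.2)%g) : _ -> borel G).
Proof.
by apply: (@continuous2_measurable G G G (fun p => (p.1 * p.2)%g)) => //; exact: mulg_continuous.
Qed.

Lemma measurable_funMg d (T : measurableType d) (f g : T -> borel G) :
  measurable_fun setT f -> measurable_fun setT g ->
  measurable_fun setT (fun t => (f t * g t)%g : borel G).
Proof.
move=> mf mg.
exact: (measurableT_comp measurable_mulg (measurable_fun_pair mf mg)).
Qed.

Lemma measurable_invg :
  measurable_fun [set: borel G] ((fun x : borel G => (x^-1)%g) : _ -> borel G).
Proof.
apply: (@measurability _ _ _ (borel G) _ _ (@open G)) => // _ [U oU <-]; rewrite setTI.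
apply: sub_sigma_algebra; have /continuousP := @invg_continuous G.
exact.
Qed.

Lemma precompact_base : locally_compact [set: G] ->
  exists2 b : nat -> set G, (forall n, open (b n) /\ precompact (b n)) &
    \bigcup_n b n = setT.
Proof.
move=> lcG; have [b bo bU] := second_countable_seq scG.
(* Base sets without compact closure are replaced by the empty set, which keeps the numbering; local
   compactness ensures that the others still cover. *)
exists (fun n => if `[< precompact (b n) >] then b n else set0).
  move=> n; case: asboolP => // _; split; first exact: open0.
  by rewrite precompactE closure0; exact: compact0.
rewrite -subTset => x _.
have [U xU [cU clU]] := locally_compact_nbhs x lcG.
rewrite nbhsE in xU; have [V [oV Vx] VU] := xU.
have [n bx bV] := bU _ _ oV Vx.
exists n => //; case: asboolP => // -[].
by exists U => // y /bV /VU.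
Qed.

Lemma precompact_open_cover (E : set G) : locally_compact [set: G] ->
  precompact E -> exists U : set G, [/\ open U, precompact U & E `<=` U].
Proof.
move=> /precompact_base[b bP bT].
rewrite precompactE compact_cover => /(_ _ setT b)[].
- by move=> n _; have [] := bP n.
- by move=> x _; rewrite /cover bT.
move=> D _ ED; exists (cover [set` D] b); split.
- by apply: bigcup_open => n _; have [] := bP n.
- rewrite /cover bigcup_fset precompactE; elim/big_ind : _ => [|A B|i _].
  + by rewrite closure0; exact: compact0.
  + by rewrite closureU; exact: compactU.
  + by rewrite -precompactE; have [] := bP i.
- by move=> x Ex; apply: ED; exact: subset_closure.
Qed.

Implicit Types (mu : {measure set (borel G) -> \bar R}).

Lemma closed_borel (T : ptopologicalType) (A : set T) :
  closed A -> measurable (A : set (borel T)).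
Proof.
move=> cA; rewrite -(setCK A); apply: (@measurableC _ (borel T)).
by apply: sub_sigma_algebra; exact/closed_openC.
Qed.

Lemma open_borel (T : ptopologicalType) (A : set T) :
  open A -> measurable (A : set (borel T)).
Proof. by move=> cA; exact: sub_sigma_algebra. Qed.

Lemma haar_precompact mu (E : set G) : left_haar mu ->
  measurable (E : set (borel G)) -> precompact E -> (mu E < +oo)%E.
Proof.
move=> [_ muK _] mE; rewrite precompactE => /muK; apply: le_lt_trans.
apply: le_measure; rewrite ?inE//; last exact: subset_closure.
by apply: closed_borel; exact: closed_closure.
Qed.

Lemma haar_sigma_finite mu : locally_compact [set: G] -> left_haar mu ->
  sigma_finite setT mu.
Proof.
move=> /precompact_base[b bP bT] hmu; exists b => // n.
have [bo pb] := bP n; have mb := open_borel bo.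
by split => //; exact: haar_precompact.
Qed.

(* Both sides of [mu A * mu K = mu A^-1 * mu K] are obtained by Tonelli from
   [{(x, y) | x y^-1 \in A, y \in K}], whose x-sections are right translates of
   those of [{(x, y) | y^-1 \in A, y x \in K}]. *)
Lemma invg_invariant_sigma_finite
    (mu : {sigma_finite_measure set (borel G) -> \bar R}) (A K : set G) :
  (forall (g : G) (A : set G), measurable (A : set (borel G)) ->
     mu [set (g * x)%g | x in A] = mu A) ->
  right_invariant mu ->
  measurable (A : set (borel G)) -> measurable (K : set (borel G)) ->
  (mu A * mu K = mu [set (x^-1)%g | x in A] * mu K)%E.
Proof.
move=> linv rinv mA mK.
have rtr (y : G) (D : set G) : measurable (D : set (borel G)) ->
    mu [set x | D (x * y)%g] = mu D.
  move=> mD; rewrite -[RHS](rinv (y^-1)%g)//; congr (mu _).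
  rewrite eqEsubset; split => [x Dx|_ [x Dx <-]]/=.
    by exists (x * y)%g => //; rewrite -mulgA mulgV mulg1.
  by rewrite -mulgA mulVg mulg1.
have ltr (y : G) (D : set G) : measurable (D : set (borel G)) ->
    mu [set x | D (y * x)%g] = mu D.
  move=> mD; rewrite -[RHS](linv (y^-1)%g)//; congr (mu _).
  rewrite eqEsubset; split => [x Dx|_ [x Dx <-]]/=.
    by exists (y * x)%g => //; rewrite mulgA mulVg mul1g.
  by rewrite mulgA mulgV mul1g.
have invE (D : set G) : [set (x^-1)%g | x in D] = [set x | D (x^-1)%g].
  rewrite eqEsubset; split => [_ [x Dx <-]|x Dx]/=; first by rewrite invgK.
  by exists (x^-1)%g => //; rewrite invgK.
have mV : measurable ([set x | A (x^-1)%g] : set (borel G)).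
  by rewrite -[X in measurable X]setTI; exact: measurable_invg.
pose S1 : set (borel G * borel G) := [set p | A (p.1 * p.2^-1)%g /\ K p.2].
pose S2 : set (borel G * borel G) := [set p | A (p.2^-1)%g /\ K (p.2 * p.1)%g].
have msnd : measurable_fun setT (fun p : borel G * borel G => (p.2)^-1%g : borel G).
  by apply: (measurableT_comp measurable_invg); exact: measurable_snd.
have mS1 : measurable S1.
  apply: measurableI.
    rewrite -[X in measurable X]setTI.
    have : measurable_fun setT (fun p : borel G * borel G => (p.1 * p.2^-1)%g : borel G).
      by apply: measurable_funMg => //; exact: measurable_fst.
    exact.
  rewrite -[X in measurable X]setTI.
  by apply: (@measurable_snd _ _ (borel G) (borel G)).
have mS2 : measurable S2.
  apply: measurableI.
    by rewrite -[X in measurable X]setTI; exact: msnd.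
  rewrite -[X in measurable X]setTI.
  have : measurable_fun setT (fun p : borel G * borel G => (p.2 * p.1)%g : borel G).
    by apply: measurable_funMg; [exact: measurable_snd|exact: measurable_fst].
  exact.
have F1 := indic_fubini_tonelli mu mu mS1.
have F2 := indic_fubini_tonelli mu mu mS2.
rewrite (indic_fubini_tonelli_FE mu mS1) (indic_fubini_tonelli_GE mu mS1) in F1.
rewrite (indic_fubini_tonelli_FE mu mS2) (indic_fubini_tonelli_GE mu mS2) in F2.
have sect x : mu (xsection S1 x) = mu (xsection S2 x).
  transitivity (mu [set y | xsection S1 x (y * x)%g]).
    by rewrite rtr//; exact: measurable_xsection.
  congr (mu _); rewrite !xsectionE; apply/seteqP; split => y/=.
    by rewrite /S1/= invgM mulgA mulgV mul1g.
  by rewrite /S1/= invgM mulgA mulgV mul1g.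
(* For [y] in [K] the y-section of [S1] is a right translate of [A]; for [y^-1] in [A] that of [S2]
   is a left translate of [K]. Both invariances enter here. *)
have E1 : (\int[mu]_y (mu \o ysection S1) y = mu A * mu K)%E.
  transitivity (\int[mu]_y (mu A * (\1_K y)%:E))%E.
    apply: eq_integral => y _ /=; rewrite indicE.
    have [yK|yK] := boolP (y \in K).
      rewrite mule1 -[RHS](rtr (y^-1)%g)//; congr (mu _).
      rewrite ysectionE/=; apply/seteqP; split => x/=; first by case.
      by move=> Axy; split => //; exact: set_mem.
    rewrite mule0 ysectionE -[RHS](measure0 mu); congr (mu _).
    by rewrite -subset0 => x /= [_]; rewrite -[K _]in_setE (negbTE yK).
  rewrite ge0_integralZl//; last exact/measurable_EFinP.
  by rewrite integral_indic// setIT.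
have E2 : (\int[mu]_y (mu \o ysection S2) y = mu [set (x^-1)%g | x in A] * mu K)%E.
  transitivity (\int[mu]_y (mu K * (\1_[set x | A (x^-1)%g] y)%:E))%E.
    apply: eq_integral => y _ /=; rewrite indicE.
    have [/set_mem yK|yK] := boolP (y \in _).
      rewrite mule1 -[RHS](ltr y)//; congr (mu _).
      by rewrite ysectionE/=; apply/seteqP; split => x/=; [case|].
    rewrite mule0 ysectionE -[RHS](measure0 mu); congr (mu _).
    by rewrite -subset0 => x /= [] Ay; move: yK; rewrite notin_setE.
  rewrite ge0_integralZl//; last exact/measurable_EFinP.
  by rewrite integral_indic// setIT muleC invE.
rewrite -E1 -E2 -F1 -F2; apply: eq_integral => x _.
exact: sect.
Qed.

(** The set [K] is there to be cancelled from the product identity, hence its positive finite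
    measure. In the main proof it is some [E n]. *)
Lemma unimodular_invg mu (A K : set G) :
  locally_compact [set: G] -> unimodular R G -> left_haar mu ->
  measurable (K : set (borel G)) -> (0 < mu K < +oo)%E ->
  measurable (A : set (borel G)) -> mu [set (x^-1)%g | x in A] = mu A.
Proof.
move=> lcG /(_ mu) um hmu mK /andP[K0 Koo] mA.
pose m : {sigma_finite_measure set (borel G) -> \bar R} :=
  sigma_finite_copy (haar_sigma_finite lcG hmu).
have [_ _ linv] := hmu.
have := @invg_invariant_sigma_finite m A K linv (um hmu) mA mK.
have Kf : mu K \is a fin_num by rewrite ge0_fin_numE.
move=> /(congr1 (fun z => z * (fine (mu K))^-1%:E)%E).
rewrite -!muleA -[X in (X * _^-1%:E)%E](fineK Kf) -EFinM divff ?mule1//.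
by rewrite fine_eq0// gt_eqF.
Qed.

End haar_measure.

(** * Jointly measurable Radon-Nikodym derivatives *)

Section image_measure.
Local Open Scope ereal_scope.
Context d1 d2 (X : measurableType d1) (Y : measurableType d2) (R : realType).
Variables (m : {finite_measure set X -> \bar R}) (f : X -> Y).
Hypothesis mf : measurable_fun setT f.

Definition image_measure & measurable_fun setT f : set Y -> \bar R :=
  pushforward m f.

Let image0 : image_measure mf set0 = 0.
Proof. by rewrite /image_measure /pushforward preimage_set0 measure0. Qed.

Let image_ge0 A : 0 <= image_measure mf A.
Proof. exact: measure_ge0. Qed.

Let image_sigma_additive : semi_sigma_additive (image_measure mf).
Proof. by apply: measure_semi_sigma_additive; exact: mf. Qed.

HB.instance Definition _ := isMeasure.Build _ _ _ (image_measure mf)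
  image0 image_ge0 image_sigma_additive.

Let image_finite : fin_num_fun (image_measure mf).
Proof.
move=> A mA; apply: fin_num_measure.
by rewrite -[X in measurable X]setTI; exact: mf.
Qed.

HB.instance Definition _ := Measure_isFinite.Build _ _ _
  (image_measure mf) image_finite.

End image_measure.

Section density_measure.
Local Open Scope ereal_scope.
Context d (T : measurableType d) (R : realType).
Variables (m : {measure set T -> \bar R}) (f : T -> \bar R).
Hypotheses (fi : m.-integrable setT f) (f0 : forall x, 0 <= f x).

Definition density_measure & m.-integrable setT f & (forall x, 0 <= f x) :
  set T -> \bar R := fun A => \int[m]_(x in A) f x.

Let density_fin A : measurable A -> density_measure fi f0 A \is a fin_num.
Proof. by move=> mA; apply: integrable_fin_num => //; exact: integrableS fi. Qed.

Let density0 : density_measure fi f0 set0 = 0.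
Proof. exact: integral_set0. Qed.

Let density_ge0 A : 0 <= density_measure fi f0 A.
Proof. exact: integral_ge0. Qed.

Let density_sigma_additive : semi_sigma_additive (density_measure fi f0).
Proof.
move=> F mF tF mUF; rewrite /density_measure ge0_integral_bigcup//; last first.
  by apply: measurable_funTS; exact: measurable_int fi.
by apply: is_cvg_ereal_nneg_natsum_cond => n _ _; exact: integral_ge0.
Qed.

HB.instance Definition _ := isMeasure.Build _ _ _ (density_measure fi f0)
  density0 density_ge0 density_sigma_additive.

HB.instance Definition _ := Measure_isFinite.Build _ _ _
  (density_measure fi f0) density_fin.

End density_measure.

Section joint_density.
Local Open Scope ereal_scope.
Context d (X : measurableType d) (Y : ptopologicalType) (R : realType).
Variables (kappa : {finite_measure set X -> \bar R}).
Variables (nu : {finite_measure set (borel Y) -> \bar R}).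
Variables (phi : X * borel Y -> borel Y) (mphi : measurable_fun setT phi).

Lemma measurable_fun_pair1 d1 d2 d3 (T1 : measurableType d1)
  (T2 : measurableType d2) (T3 : measurableType d3) (f : T1 * T2 -> T3) x :
  measurable_fun setT f -> measurable_fun setT (fun y => f (x, y)).
Proof.
move=> mf; apply: (measurableT_comp mf); exact: pair1_measurable.
Qed.

Lemma measurable_fun_pair2 d1 d2 d3 (T1 : measurableType d1)
  (T2 : measurableType d2) (T3 : measurableType d3) (f : T1 * T2 -> T3) y :
  measurable_fun setT f -> measurable_fun setT (fun x => f (x, y)).
Proof.
move=> mf; apply: (measurableT_comp mf); exact: pair2_measurable.
Qed.

Lemma product_lty : (kappa \x nu) setT < +oo.
Proof.
rewrite -setXTT product_measure1E// lte_mul_pinfty//; first exact: fin_num_measure.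
by rewrite -ge0_fin_numE// fin_num_measure.
Qed.

(* The Radon-Nikodym derivatives of the measures [phi(x, _)_* nu] admit a
   version that is jointly measurable: differentiate the image of
   [kappa x nu] under [(x, y) |-> (x, phi (x, y))]. *)
Lemma joint_density : @second_countable Y ->
  (forall x (A : set (borel Y)), measurable A -> nu A = 0 ->
     nu ((fun y => phi (x, y)) @^-1` A) = 0) ->
  exists r : X * borel Y -> R,
    [/\ measurable_fun setT r, forall z, (0 <= r z)%R &
      {ae kappa, forall x,
         nu.-integrable setT (fun y => (r (x, y))%:E) /\
         forall A : set (borel Y), measurable A ->
         nu ((fun y => phi (x, y)) @^-1` A) = \int[nu]_(y in A) (r (x, y))%:E}].
Proof.
move=> /second_countable_seq[b bo bU] dom.
pose Phi (z : X * borel Y) : X * borel Y := (z.1, phi z).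
have mPhi : measurable_fun setT Phi.
  by apply: measurable_fun_pair => //; exact: measurable_fst.
pose P : {finite_measure set (X * borel Y)%type -> \bar R} :=
  mfrestr measurableT product_lty.
pose Q : {finite_measure set (X * borel Y)%type -> \bar R} := image_measure P mPhi.
have PE A : P A = (kappa \x nu) A by rewrite /P/= /mfrestr /mrestr setIT.
have intPE (f : X * borel Y -> \bar R) A :
    \int[P]_(z in A) f z = \int[kappa \x nu]_(z in A) f z.
  by apply: eq_measure_integral => B mB _; exact: PE.
have QE (A : set (X * borel Y)) : measurable A ->
    Q A = \int[kappa]_x nu ((fun y => phi (x, y)) @^-1` xsection A x).
  move=> mA; rewrite /Q/= /image_measure /pushforward PE /product_measure1.
  by apply: eq_integral => x _ /=; congr (nu _); rewrite !xsectionE.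
have QP : Q `<< P.
  apply/null_content_dominatesP => A mA PA0.
  have A0 : (kappa \x nu) A = 0 by rewrite -PE.
  suff: Q A = 0 by [].
  rewrite QE//.
  (* Almost every section of a [P]-null set is [nu]-null, and [dom] says that its preimage under
     [phi (x, _)] is null as well. *)
  have /ae_eq_integral_abs : \int[kappa]_x `|nu (xsection A x)| = 0.
    by rewrite -[RHS]A0; apply: eq_integral => x _; rewrite gee0_abs.
  move=> /(_ measurableT (measurable_fun_xsection nu mA)) aeA.
  have mPA : measurable (Phi @^-1` A).
    by rewrite -[X in measurable X]setTI; exact: (mPhi measurableT).
  rewrite (_ : (fun x => _) = (nu \o xsection (Phi @^-1` A))); last first.
    by apply/funext => x /=; congr (nu _); rewrite !xsectionE.
  rewrite (ae_eq_integral (cst 0))//; first exact: integral0.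
  - exact: measurable_fun_xsection.
  - apply: filterS aeA => x /= /(_ I) A0x _.
    rewrite -[RHS](dom x (xsection A x) (measurable_xsection x mA) A0x).
    by congr (nu _); rewrite !xsectionE.
pose r := Radon_Nikodym_SigmaFinite.f Q P.
have r0 := Radon_Nikodym_SigmaFinite.f_ge0 QP.
have rfin := Radon_Nikodym_SigmaFinite.f_fin_num QP.
have ri := Radon_Nikodym_SigmaFinite.f_integrable QP.
have rE := Radon_Nikodym_SigmaFinite.f_integral QP.
rewrite -/r in r0 rfin ri rE.
have mr : measurable_fun setT r by exact: measurable_int ri.
have ri' : (kappa \x nu).-integrable setT r.
  apply/integrableP; split => //; rewrite -intPE.
  by have /integrableP[] := ri.
have aei := ae_integrable1 ri'.
have gen (s : seq nat) : {ae kappa, forall x,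
    nu ((fun y => phi (x, y)) @^-1` (\big[setI/setT]_(i <- s) b i)) =
    \int[nu]_(y in \big[setI/setT]_(i <- s) b i) r (x, y)}.
  set D := \big[setI/setT]_(i <- s) b i.
  have mD : measurable (D : set (borel Y)).
    apply: open_borel; rewrite /D.
    by elim/big_ind : _ => //; [exact: openT|exact: openI].
  have mpD : measurable (phi @^-1` D).
    by rewrite -[X in measurable X]setTI; exact: mphi.
  suff : ae_eq kappa setT (nu \o xsection (phi @^-1` D))
      (fun x => \int[nu]_(y in D) r (x, y)).
    by apply: filterS => x /= /(_ I); rewrite xsectionE.
  pose rD : X * borel Y -> \bar R := r \_ ([set: X] `*` (D : set (borel Y))).
  have rDE x : \int[nu]_(y in D) r (x, y) =
      \int[nu]_y rD (x, y).
    rewrite integral_mkcond; apply: eq_integral => y _.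
    by rewrite /rD !patchE in_setX in_setT.
  have mrD : measurable_fun setT rD.
    apply/(measurable_restrictT _ _).1 => //; first exact: measurableX.
    exact: measurable_funTS.
  have rD0 z : 0 <= rD z by rewrite /rD patchE; case: ifP.
  apply: integral_ae_eq => //.
  - apply/integrableP; split; first exact: measurable_fun_xsection.
    have -> : \int[kappa]_x `|(nu \o xsection (phi @^-1` D)) x| =
              (kappa \x nu) (phi @^-1` D).
      by apply: eq_integral => x _; rewrite gee0_abs.
    apply: (le_lt_trans _ product_lty).
    by apply: le_measure; rewrite ?inE.
  - rewrite (funext rDE).
    exact: (measurable_fun_fubini_tonelli_F rD).
  - move=> C _ mC.
    have -> : \int[kappa]_(x in C) (nu \o xsection (phi @^-1` D)) x =
              Q (C `*` D).
      rewrite QE; last exact: measurableX.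
      rewrite integral_mkcond; apply: eq_integral => x _.
      rewrite patchE; case: ifPn => xC.
        by rewrite in_xsectionX//= xsectionE.
      by rewrite notin_xsectionX// preimage_set0 measure0.
    rewrite rE; last exact: measurableX.
    pose rCD : X * borel Y -> \bar R := r \_ (C `*` (D : set (borel Y))).
    have mrCD : measurable_fun setT rCD.
      apply/(measurable_restrictT _ _).1; first exact: measurableX.
      exact: measurable_funTS.
    have rCD0 z : 0 <= rCD z by rewrite /rCD patchE; case: ifP.
    transitivity (\int[kappa \x nu]_z rCD z).
      by rewrite intPE integral_mkcond.
    rewrite (fubini_tonelli1 rCD mrCD rCD0).
    rewrite [RHS]integral_mkcond; apply: eq_integral => x _.
    rewrite /fubini_F patchE; case: ifPn => xC.
      rewrite [RHS]integral_mkcond; apply: eq_integral => y _.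
      by rewrite /rCD !patchE in_setX xC.
    by apply: integral0_eq => y _; rewrite /rCD patchE in_setX (negbTE xC).
exists (fine \o r); split.
- exact: measurableT_comp.
- by move=> z; rewrite fine_ge0.
(* Finite sequences are coded by natural numbers, so the countably many exceptional sets of [x]
   merge into one. A number that codes no sequence stands for the empty one. *)
have {}gen : {ae kappa, forall x, forall n : nat,
    nu ((fun y => phi (x, y)) @^-1` (\big[setI/setT]_(i <- odflt [::] (choice.unpickle n : option (seq nat))) b i)) =
    \int[nu]_(y in \big[setI/setT]_(i <- odflt [::] (choice.unpickle n : option (seq nat))) b i) r (x, y)}.
  by apply: ae_foralln => n; exact: gen.
apply: filterS2 aei gen => x ix gx.
have mx : measurable_fun setT (fun y => phi (x, y)).
  exact: measurable_fun_pair1.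
have rE' : (fun y => ((fine \o r) (x, y))%:E) = (fun y => r (x, y)).
  by apply/funext => y /=; rewrite fineK.
rewrite rE'; split => // A mA.
apply: (@borel_measure_unique _ _ b (image_measure nu mx)
   (density_measure ix (fun y => r0 (x, y)))) => // s.
by have := gx (choice.pickle s); rewrite choice.pickleK.
Qed.

End joint_density.

(** * The quasi-regular representation *)

(** On nonnegative reals inversion is the power with exponent [-1], also at 0, where both take the
    value 0. *)
Lemma measurable_fun_ge0V d (T : measurableType d) (R : realType) (D : set T)
    (f : T -> R) : measurable_fun D f -> (forall x, 0 <= f x) ->
  measurable_fun D (fun x => (f x)^-1).
Proof.
move=> mf f0; rewrite (_ : (fun x => _) = (fun x => f x `^ (-1))).
  exact: (measurableT_comp (@measurable_powR R (-1)) mf).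
by apply/funext => x; rewrite powR_inv1.
Qed.

Section quasi_regular_density.
Context {R : realType} {G : topologicalGroupType} {B : ptopologicalType}.
Variables (a : continuous_action G B) (nu : probability (borel B) R).
Hypothesis qi : quasi_invariant a nu.
Implicit Types (g : G) (A : set (borel B)) (F H : borel B -> \bar R).

Local Notation am g := (a g : borel B -> borel B).

Lemma actK g b : a (g^-1)%g (a g b) = b.
Proof. by rewrite -actM mulVg act1. Qed.

Lemma actVK g b : a g (a (g^-1)%g b) = b.
Proof. by rewrite -actM mulgV act1. Qed.

Lemma act_imageE g (A : set B) : [set a g b | b in A] = a (g^-1)%g @^-1` A.
Proof.
rewrite eqEsubset; split => [_ [b Ab <-]|b Ab]/=; first by rewrite actK.
by exists (a (g^-1)%g b) => //; rewrite actVK.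
Qed.

Lemma measurable_act_preimage g A : measurable A -> measurable (am g @^-1` A).
Proof. by move=> mA; rewrite -[X in measurable X]setTI; exact: act_measurable. Qed.

Lemma quasi_invariant_preimage g A : measurable A -> nu A = 0%E ->
  nu (am g @^-1` A) = 0%E.
Proof.
move=> mA A0; have := qi (g^-1)%g mA A0.
by rewrite act_imageE invgK.
Qed.

Lemma translate_dominates g : translate a nu g `<< nu.
Proof.
apply/null_content_dominatesP => A mA A0.
exact: quasi_invariant_preimage.
Qed.

Lemma RN_translate_integrable g :
  nu.-integrable setT (Radon_Nikodym (translate a nu g) nu).
Proof. by apply: Radon_Nikodym_integrable; exact: translate_dominates. Qed.

Definition rnd g (b : borel B) : R :=
  fine (Radon_Nikodym (translate a nu g) nu b).

Lemma EFin_rnd g b : (rnd g b)%:E = Radon_Nikodym (translate a nu g) nu b.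
Proof. by rewrite fineK//; apply: Radon_Nikodym_fin_num; exact: translate_dominates. Qed.

Lemma rnd_integrable g : nu.-integrable setT (EFin \o rnd g).
Proof.
have -> : EFin \o rnd g = Radon_Nikodym (translate a nu g) nu.
  by apply/funext => b /=; rewrite EFin_rnd.
exact: RN_translate_integrable.
Qed.

Lemma rnd_integral g A : measurable A ->
  nu (am g @^-1` A) = (\int[nu]_(b in A) (rnd g b)%:E)%E.
Proof.
move=> mA; transitivity (translate a nu g A) => //.
rewrite (Radon_Nikodym_integral (translate_dominates g) mA).
by apply: eq_integral => b _; rewrite EFin_rnd.
Qed.

Lemma measurable_rnd g : measurable_fun setT (rnd g).
Proof. by apply/measurable_EFinP; exact: measurable_int (rnd_integrable g). Qed.

Lemma ge0_integral_act g F : measurable_fun setT F -> (forall b, 0 <= F b)%E ->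
  (\int[nu]_b F (a g b) = \int[nu]_b (F b * (rnd g b)%:E))%E.
Proof.
move=> mF F0; transitivity (\int[translate a nu g]_b F b)%E.
  by rewrite ge0_integral_pushforward//; exact: act_measurable.
apply: ge0_integral_density => //; first exact: rnd_integrable.
by move=> A mA; exact: rnd_integral.
Qed.

(** The preimage under [g] of the set where the density is at most 0 is null. Pulling it back once
    more, by [g^-1], returns the set itself, and quasi-invariance applies again. *)
Lemma rnd_gt0 g : {ae nu, forall b, 0 < rnd g b}.
Proof.
pose A : set (borel B) := [set b | rnd g b <= 0].
have mA : measurable A.
  have -> : A = setT `&` rnd g @^-1` `]-oo, 0].
    by rewrite setTI; apply/seteqP; split => b /=; rewrite in_itv.
  exact: measurable_rnd.
exists A; split => //; last by move=> b /= /negP; rewrite -leNgt.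
have pA : nu (am g @^-1` A) = 0%E.
  apply/eqP; rewrite eq_le measure_ge0 andbT rnd_integral//.
  rewrite -(integral0 nu A); apply: le_integral => //.
  - exact: integrableS (rnd_integrable g).
  - exact: integrable0.
  - by move=> b; rewrite inE => Ab; rewrite lee_fin.
have := @quasi_invariant_preimage (g^-1)%g _ (measurable_act_preimage g mA) pA.
have -> // : am (g^-1)%g @^-1` (am g @^-1` A) = A.
by apply/seteqP; split => b /=; rewrite actVK.
Qed.

Definition sdens g (b : borel B) : R := Num.sqrt (rnd g b).

Lemma sdens_ge0 g b : 0 <= sdens g b. Proof. exact: sqrtr_ge0. Qed.

Lemma measurable_sdens g : measurable_fun setT (sdens g).
Proof.
have ms : measurable_fun setT (@Num.sqrt R).
  by apply: continuous_measurable_fun; exact: sqrt_continuous.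
exact: (measurableT_comp ms (measurable_rnd g)).
Qed.

Lemma sdens_integrable g : nu.-integrable setT (EFin \o sdens g).
Proof.
have i1 : nu.-integrable setT (EFin \o (fun b => 1 + `|rnd g b|)).
  apply: (@eq_integrable _ _ _ _ _ measurableT ((fun=> 1%:E) \+ (fun b => `|(rnd g b)%:E|))%E) => //.
  apply: integrableD => //; first exact: finite_measure_integrable_cst.
  exact: integrable_abse (rnd_integrable g).
apply: le_integrable i1 => //.
  by apply/measurable_EFinP; exact: measurable_sdens.
move=> b _ /=; rewrite lee_fin ger0_norm ?sdens_ge0// ger0_norm; last first.
  by rewrite addr_ge0.
rewrite /sdens; have [r0|r0] := leP 0 (rnd g b); last first.
  by rewrite ler0_sqrtr ?addr_ge0// ltW.
rewrite ger0_norm//; have s0 := sqrtr_ge0 (rnd g b).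
rewrite -{2}(sqr_sqrtr r0); nra.
Qed.

Lemma ae_act g (P : borel B -> Prop) :
  {ae nu, forall b, P b} -> {ae nu, forall b, P (a g b)}.
Proof.
move=> [N [mN N0 NP]]; exists (am g @^-1` N); split.
- exact: measurable_act_preimage.
- exact: quasi_invariant_preimage.
- by move=> b /= nP; exact: NP.
Qed.

Lemma sdens_gt0 g : {ae nu, forall b, 0 < sdens g b}.
Proof. by apply: filterS (rnd_gt0 g) => b b0; rewrite sqrtr_gt0. Qed.

(** The cocycle identity of the Radon-Nikodym derivatives for [g^-1 g = 1]. The absolute value makes
    the right-hand side nonnegative at every point, whereas [rnd] itself is known to be positive
    only almost everywhere. *)
Lemma rnd_inv g : {ae nu, forall b, rnd (g^-1)%g b = `|rnd g (a g b)|^-1}.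
Proof.
have mr : measurable_fun setT (fun b : borel B => `|rnd g b|^-1).
  by apply: measurable_fun_ge0V => //; apply: measurableT_comp => //; exact: measurable_rnd.
have mra : measurable_fun setT (fun b : borel B => `|rnd g (a g b)|^-1).
  exact: (measurableT_comp mr (act_measurable a g)).
suff ae1 : ae_eq nu setT (EFin \o rnd (g^-1)%g) (fun b => (`|rnd g (a g b)|^-1)%:E).
  by apply: filterS ae1 => b /= /(_ I)[].
apply: integral_ae_eq => //.
- exact: rnd_integrable.
- exact/measurable_EFinP.
move=> A _ mA; rewrite -rnd_integral//.
rewrite [RHS]integral_mkcond.
(* [F] is chosen so that [F (a g b)] is the inverse density cut to [A]. The substitution multiplies
   [F] by [rnd g], which cancels the inverse and leaves the indicator of [g A]. *)
pose F b := ((`|rnd g b|^-1)%:E * (\1_A (a (g^-1)%g b))%:E)%E.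
have m1 : measurable_fun setT (fun b : borel B => (\1_A (a (g^-1)%g b) : R)).
  exact: (measurableT_comp (measurable_indic mA) (act_measurable a (g^-1)%g)).
transitivity (\int[nu]_b F (a g b))%E; last first.
  apply: eq_integral => b _; rewrite /F actK patchE indicE.
  by case: ifP => _; rewrite ?mule1 ?mule0.
have mF : measurable_fun setT F.
  by apply: emeasurable_funM; exact/measurable_EFinP.
rewrite ge0_integral_act//; last first.
  by move=> b; rewrite mule_ge0 ?lee_fin.
have mpA : measurable (am (g^-1)%g @^-1` A) by exact: measurable_act_preimage.
transitivity (\int[nu]_b (\1_(am (g^-1)%g @^-1` A) b)%:E)%E.
  by rewrite integral_indic// setIT.
apply: ae_eq_integral => //.
- by apply/measurable_EFinP; exact: measurable_indic.
- by apply: emeasurable_funM => //; apply/measurable_EFinP; exact: measurable_rnd.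
- apply: filterS (rnd_gt0 g) => b b0 _.
  rewrite /F -!EFinM gtr0_norm// mulrAC mulVf ?gt_eqF// mul1r.
  by rewrite !indicE.
Qed.

Lemma sdens_inv g :
  {ae nu, forall b, sdens (g^-1)%g b = (sdens g (a g b))^-1}.
Proof.
apply: filterS2 (rnd_inv g) (ae_act g (rnd_gt0 g)) => b bE b0.
by rewrite /sdens bE gtr0_norm// sqrtrV// ltW.
Qed.

(* Unitarity of the quasi-regular representation on nonnegative functions. *)
Lemma ge0_sdens_sym g (F H : borel B -> R) :
  measurable_fun setT F -> measurable_fun setT H ->
  (forall b, 0 <= F b) -> (forall b, 0 <= H b) ->
  (\int[nu]_b (F (a (g^-1)%g b) * H b * sdens g b)%:E =
   \int[nu]_b (F b * H (a g b) * sdens (g^-1)%g b)%:E)%E.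
Proof.
move=> mF mH F0 H0.
have mFi : measurable_fun setT (fun b : borel B => F (a (g^-1)%g b)).
  exact: (measurableT_comp mF (act_measurable a (g^-1)%g)).
have mHa : measurable_fun setT (fun b : borel B => H (a g b)).
  exact: (measurableT_comp mH (act_measurable a g)).
have ms := measurable_sdens g.
have msV : measurable_fun setT (fun b : borel B => (sdens g b)^-1).
  by apply: measurable_fun_ge0V => // b; exact: sdens_ge0.
have msVa : measurable_fun setT (fun b : borel B => (sdens g (a g b))^-1).
  exact: (measurableT_comp msV (act_measurable a g)).
(* Almost everywhere [sdens g] equals [rnd g / sdens g]. The factor [rnd g] is absorbed by the
   substitution of [g b] for [b], and the remaining [1 / sdens g] becomes [sdens g^-1] by
   [sdens_inv]. *)
pose K (b : borel B) := (F (a (g^-1)%g b) * H b * (sdens g b)^-1)%:E.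
have mK : measurable_fun setT K.
  by apply/measurable_EFinP; do 2 apply: measurable_funM => //.
have K0 b : (0 <= K b)%E.
  by rewrite lee_fin !mulr_ge0// invr_ge0 sdens_ge0.
transitivity (\int[nu]_b (K b * (rnd g b)%:E))%E.
  apply: ae_eq_integral => //.
  - by apply/measurable_EFinP; do 2 apply: measurable_funM => //.
  - by apply: emeasurable_funM => //; apply/measurable_EFinP; exact: measurable_rnd.
  - apply: filterS (rnd_gt0 g) => b b0 _; rewrite /K -EFinM; congr EFin.
    rewrite -[X in _ = _ * X]sqr_sqrtr; last exact: ltW.
    rewrite -/(sdens g b) expr2 mulrA divfK//.
    by rewrite gt_eqF// sqrtr_gt0.
rewrite -ge0_integral_act//; apply: ae_eq_integral => //.
- apply/measurable_EFinP; rewrite /K.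
  have -> : (fun x => F (a g^-1%g (a g x)) * H (a g x) / sdens g (a g x)) =
            (fun x => F x * H (a g x) / sdens g (a g x)).
    by apply/funext => x; rewrite actK.
  by do 2 apply: measurable_funM => //.
- apply/measurable_EFinP; apply: measurable_funM; last exact: measurable_sdens.
  exact: measurable_funM.
- by apply: filterS (sdens_inv g) => b bE _; rewrite /K actK bE.
Qed.

End quasi_regular_density.

Section complex_parts.
Variable R : rcfType.
Implicit Types (x y : R[i]).

Lemma Re_mulc x y :
  complex.Re (x * y) = complex.Re x * complex.Re y - complex.Im x * complex.Im y.
Proof. by case: x y => [? ?] [? ?]. Qed.

Lemma Im_mulc x y :
  complex.Im (x * y) = complex.Re x * complex.Im y + complex.Im x * complex.Re y.
Proof. by case: x y => [? ?] [? ?]. Qed.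

Lemma Re_conjc x : complex.Re x^* = complex.Re x.
Proof. by case: x. Qed.

Lemma Im_conjc x : complex.Im x^* = - complex.Im x.
Proof. by case: x. Qed.

Lemma Re_addc x y : complex.Re (x + y) = complex.Re x + complex.Re y.
Proof. by case: x y => [? ?] [? ?]. Qed.

Lemma Im_addc x y : complex.Im (x + y) = complex.Im x + complex.Im y.
Proof. by case: x y => [? ?] [? ?]. Qed.

Lemma Re_oppc x : complex.Re (- x) = - complex.Re x.
Proof. by case: x. Qed.

Lemma Im_oppc x : complex.Im (- x) = - complex.Im x.
Proof. by case: x. Qed.

Definition partsE := (Re_mulc, Im_mulc, Re_conjc, Im_conjc, Re_addc, Im_addc,
  Re_oppc, Im_oppc).

End complex_parts.

Lemma ae_le_cnorm_oo d (T : measurableType d) (R : realType)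
    (P : probability T R) (f : T -> R[i]) (M : R) :
  (cnorm P +oo f <= M%:E)%E -> {ae P, forall x, Normc.normc (f x) <= M}.
Proof.
rewrite /cnorm unlock ifT; last first.
  by have := @probability_setT _ _ _ P => /= ->; exact: lte01.
move=> /ess_supP; apply: filterS => x /=; rewrite lee_fin; apply: le_trans.
exact: ler_norm.
Qed.

Section harish_chandra_function.
Context {R : realType} {G : topologicalGroupType} {B : ptopologicalType}.
Variables (a : continuous_action G B) (nu : probability (borel B) R).
Hypothesis qi : quasi_invariant a nu.
Implicit Types (g : G).

Local Notation sdens := (sdens a nu).

(** The matrix coefficient of [pi_nu(g)] between the real functions [F] and [H]. *)
Definition coefJ (F H : borel B -> R) g : R :=
  \int[nu]_b (F (a (g^-1)%g b) * H b * sdens g b).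

Definition Xi g : R := \int[nu]_b (sdens g b).

Lemma EFin_Xi g : (Xi g)%:E = (\int[nu]_b (sdens g b)%:E)%E.
Proof. by rewrite fineK//; apply: integrable_fin_num => //; exact: sdens_integrable. Qed.

Lemma harish_chandraE g : harish_chandra a nu g = (Xi g)%:C.
Proof.
rewrite /harish_chandra /inner /cintegral; congr (_ +i* _).
  by apply: eq_Rintegral => b _; rewrite /qrep /constant1 -/(rnd a nu g b) -/(sdens g b) !partsE/=; ring.
rewrite (_ : (fun x => _) = cst 0); first by rewrite Rintegral_cst// mul0r.
by apply/funext => b; rewrite /qrep /constant1 -/(rnd a nu g b) -/(sdens g b) !partsE/=; ring.
Qed.

Lemma Xi_gt0 g : 0 < Xi g.
Proof.
rewrite lt_neqAle Rintegral_ge0 ?andbT => [|b _]; last exact: sdens_ge0.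
rewrite eq_sym; apply/eqP => X0.
have : (\int[nu]_b `|(sdens g b)%:E| = 0)%E.
  rewrite -[RHS]/(0%:E) -X0 EFin_Xi; apply: eq_integral => b _.
  by rewrite gee0_abs// lee_fin sdens_ge0.
move=> /(ae_eq_integral_abs _ measurableT).
have ms : measurable_fun setT (EFin \o sdens g).
  by apply/measurable_EFinP; exact: measurable_sdens.
move=> /(_ ms) [N [mN N0 NP]]; have [N' [mN' N'0 N'P]] := sdens_gt0 qi g.
have : nu setT = 0%E.
  apply/eqP; rewrite eq_le measure_ge0 andbT.
  have NN0 : nu (N `|` N') = 0%E by rewrite measureU0.
  rewrite -NN0; apply: le_measure; rewrite ?inE//; first exact: measurableU.
  move=> b _; have [Nb|Nb] := pselect (N b); [by left|right].
  apply: N'P => /= s0; apply: Nb; apply: NP => /= /(_ I)[] s0'.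
  by move: s0; rewrite s0' ltxx.
by rewrite probability_setT => /eqP; rewrite onee_eq0.
Qed.

Lemma Xi_inv g : Xi (g^-1)%g = Xi g.
Proof.
apply/EFin_inj; rewrite !EFin_Xi.
have := @ge0_sdens_sym _ _ _ _ _ qi g (cst 1) (cst 1) (measurable_cst _) (measurable_cst _)
  (fun=> ler01) (fun=> ler01).
under eq_integral do rewrite /= !mul1r.
by under [in X in _ = X -> _]eq_integral do rewrite /= !mul1r.
Qed.

(** [sdens g] is the square root of a probability density, so 1 is the integral of its square, and
    one of the two factors is at most [C]. *)
Lemma Xi_lower (C : R) g : {ae nu, forall b, sdens g b <= C} -> 1 <= C * Xi g.
Proof.
move=> sC.
have ms : measurable_fun setT (fun b => (sdens g b)%:E).
  by apply/measurable_EFinP; exact: measurable_sdens.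
rewrite -lee_fin -(@probability_setT _ _ _ nu).
have := @rnd_integral _ _ _ _ _ qi g setT measurableT.
rewrite preimage_setT => ->.
have C0 : 0 <= C.
  rewrite leNgt; apply/negP => C0.
  have [N [mN N0 NP]] := sC.
  have : nu setT = 0%E.
    apply/eqP; rewrite eq_le measure_ge0 andbT -N0.
    apply: le_measure; rewrite ?inE// => b _; apply: NP => /= sb.
    by have := sdens_ge0 a nu g b; rewrite leNgt (le_lt_trans sb C0).
  by rewrite probability_setT => /eqP; rewrite onee_eq0.
rewrite EFinM EFin_Xi -ge0_integralZl//; last by move=> b _; rewrite lee_fin sdens_ge0.
rewrite (ae_eq_integral (fun b => (sdens g b * sdens g b)%:E))//.
- apply: ae_ge0_le_integral => //.
  + by move=> b _; rewrite lee_fin mulr_ge0// sdens_ge0.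
  + by apply/measurable_EFinP; apply: measurable_funM; exact: measurable_sdens.
  + by move=> b _; rewrite mule_ge0// lee_fin// sdens_ge0.
  + exact: measurable_funeM.
  + apply: filterS sC => b sb _; rewrite -EFinM lee_fin ler_wpM2r//.
    exact: sdens_ge0.
- by apply/measurable_EFinP; exact: measurable_rnd.
- by apply/measurable_EFinP; apply: measurable_funM; exact: measurable_sdens.
- apply: filterS (rnd_gt0 qi g) => b b0 _; congr EFin.
  by rewrite -expr2 sqr_sqrtr// ltW.
Qed.

Lemma sdens_bounded (E : set G) : @second_countable G -> locally_compact [set: G] ->
  (forall U : set G, open U -> precompact U ->
    (ereal_sup [set cnorm nu +oo (qrep a nu g constant1) | g in U] < +oo)%E) ->
  precompact E -> exists2 C : R, 0 < C &
    forall g, E g -> {ae nu, forall b, sdens g b <= C}.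
Proof.
move=> scG lcG hb /(precompact_open_cover scG lcG)[U [oU pU EU]].
have := hb _ oU pU; rewrite ltey_eq.
set S := ereal_sup _ => hS.
(* The supremum is [-oo] when [U] is empty. Adding 1 to its absolute value in the other case makes
   the bound strictly positive. *)
have [C0 [C0S C0p]] : exists C : R, (S <= C%:E)%E /\ 0 < C.
  move: hS => /orP[|/eqP ->]; last by exists 1; rewrite leNye ltr01.
  case: S => // r _; exists (`|r| + 1); rewrite lee_fin; split.
    by rewrite (le_trans (ler_norm _))// lerDl.
  by rewrite ltr_wpDl.
exists C0 => // g /EU Ug.
have : (cnorm nu +oo (qrep a nu g constant1) <= C0%:E)%E.
  by apply: (le_trans _ C0S); apply: ereal_sup_ubound; exists g.
move=> /ae_le_cnorm_oo; apply: filterS => b /=; apply: le_trans.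
rewrite /qrep /constant1 -/(rnd a nu g b) -/(sdens g b) mul1r/=.
by rewrite !mul0r mulr0 subr0 addr0 expr0n/= addr0 sqrtr_sqr ler_norm.
Qed.

End harish_chandra_function.

Section action_measurability.
Context {G : topologicalGroupType} {B : ptopologicalType}.
Variable a : continuous_action G B.
Hypotheses (scG : @second_countable G) (scB : @second_countable B).

Lemma measurable_act :
  measurable_fun [set: borel G * borel B]
    ((fun z : borel G * borel B => a z.1 z.2) : _ -> borel B).
Proof.
by apply: (@continuous2_measurable G B B (fun z => a z.1 z.2)) => //; exact: act_continuous.
Qed.

Lemma measurable_actV :
  measurable_fun [set: borel G * borel B]
    ((fun z : borel G * borel B => a (z.1^-1)%g z.2) : _ -> borel B).
Proof.
have mV : measurable_fun [set: borel G * borel B] (fun z : borel G * borel B => (z.1^-1)%g : borel G).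
  by apply: (measurableT_comp measurable_invg); exact: measurable_fst.
have m2 : measurable_fun [set: borel G * borel B] (fun z : borel G * borel B => z.2 : borel B).
  exact: measurable_snd.
exact: (measurableT_comp measurable_act (measurable_fun_pair mV m2)).
Qed.

End action_measurability.

(** * A bounded jointly measurable weight *)

Section weight.
Context {R : realType} {G : topologicalGroupType} {B : ptopologicalType}.
Variables (a : continuous_action G B) (nu : probability (borel B) R).
Hypotheses (scG : @second_countable G) (scB : @second_countable B).
Hypothesis qi : quasi_invariant a nu.
Variables (mu : {measure set (borel G) -> \bar R}) (E : set (borel G)).
Hypotheses (mE : measurable E) (Eoo : (mu E < +oo)%E).
Variable C : R.
Hypotheses (C0 : 0 < C)
  (sC : forall g, E g -> {ae nu, forall b, sdens a nu g b <= C}).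

Local Notation sdens := (sdens a nu).
Local Notation Xi := (Xi a nu).

Lemma ae_mfrestr (P : borel G -> Prop) :
  {ae mfrestr mE Eoo, forall g, P g} -> {ae mu, forall g, E g -> P g}.
Proof.
move=> [N [mN N0 NP]]; exists (N `&` E); split => //.
- exact: measurableI.
- by move=> g /= /not_implyP[Eg Pg]; split => //; exact: NP.
Qed.

(** The bound holds at every point, so that bounded functions can be averaged over [g] for each
    single [b], and products with square-integrable functions stay integrable over [G * B]. *)
Lemma weight_exists : exists w : borel G * borel B -> R,
  [/\ measurable_fun setT w, forall z, 0 <= w z <= C * C &
   {ae mu, forall g, E g ->
     {ae nu, forall b, w (g, b) = sdens g b / Xi g}}].
Proof.
have [r [mr r0 rP]] := @joint_density _ (borel G) B R (mfrestr mE Eoo) nu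
  (fun z => a z.1 z.2) (measurable_act a scG scB) scB
  (fun g A mA A0 => quasi_invariant_preimage qi g mA A0).
pose t z := Num.sqrt (r z).
have mt : measurable_fun setT t.
  have ms : measurable_fun setT (@Num.sqrt R).
    by apply: continuous_measurable_fun; exact: sqrt_continuous.
  exact: (measurableT_comp ms mr).
have t0 z : 0 <= t z by exact: sqrtr_ge0.
pose X (g : borel G) : R := fine (\int[nu]_b (t (g, b))%:E)%E.
have X0 g : 0 <= X g.
  by rewrite fine_ge0// integral_ge0// => b _; rewrite lee_fin.
have mX : measurable_fun setT X.
  apply: (@measurableT_comp _ _ _ _ _ _ (@fine R)) => //.
  apply: (@measurable_fun_fubini_tonelli_F _ _ _ _ _ nu (EFin \o t)) => //.
  exact/measurable_EFinP.
(* The cut at [C * C] is invisible for almost every [g] in [E]: there [sdens] is at most [C], and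
   [Xi_lower] bounds the inverse of [Xi] by [C]. *)
exists (fun z => Num.min (C * C) (t z / X z.1)); split.
- apply: measurable_minr => //; apply: measurable_funM => //.
  apply: measurable_fun_ge0V => //.
  exact: (measurableT_comp mX measurable_fst).
- move=> z; rewrite le_min ge_min lexx mulr_ge0 ?(ltW C0)//=.
  by rewrite mulr_ge0// invr_ge0.
apply: filterS (ae_mfrestr rP) => g + Eg => /(_ Eg)[ir rE].
have ts : {ae nu, forall b, t (g, b) = sdens g b}.
  have /= : ae_eq nu setT (fun b => (r (g, b))%:E) (EFin \o rnd a nu g).
    apply: integral_ae_eq => //.
    - by apply/measurable_EFinP; exact: measurable_rnd.
    - by move=> A _ mA; rewrite -rE// -rnd_integral.
  by apply: filterS => b /(_ I)[] /= rb; rewrite /t rb.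
have XE : X g = Xi g.
  congr fine; apply: ae_eq_integral => //.
  - by apply/measurable_EFinP; exact: measurable_fun_pair1.
  - by apply/measurable_EFinP; exact: measurable_sdens.
  - by apply: filterS ts => b ->.
apply: filterS2 ts (sC Eg) => b tb sb /=.
rewrite XE tb; apply/min_idPr.
have Xp := Xi_gt0 qi g.
rewrite ler_pdivrMr// -mulrA (le_trans sb)// -[leLHS]mulr1 ler_wpM2l// ?(ltW C0)//.
exact: Xi_lower (sC Eg).
Qed.

End weight.

(** * The averages as trilinear forms *)

(** Stands in for Cauchy-Schwarz: it involves no square roots and passes through integrals by
    linearity, and [t] decides which of the two squares is made small. *)
Lemma weighted_amgm (R : realFieldType) (t x y : R) : 0 < t ->
  `|x * y| <= t * x ^+ 2 + t^-1 * y ^+ 2.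
Proof.
move=> t0; rewrite -(real_normK (num_real x)) -(real_normK (num_real y)) normrM.
move: `|x| `|y| (normr_ge0 x) (normr_ge0 y) => {}x {}y x0 y0.
have -> : t * x ^+ 2 + t^-1 * y ^+ 2 = t^-1 * (t * x - y) ^+ 2 + 2 * (x * y).
  by field; rewrite gt_eqF.
have : 0 <= t^-1 * (t * x - y) ^+ 2 by rewrite mulr_ge0 ?sqr_ge0// invr_ge0 ltW.
have : 0 <= x * y by rewrite mulr_ge0.
lra.
Qed.

Section real_integrable.
Context d (T : measurableType d) (R : realType) (m : {measure set T -> \bar R}).
Implicit Types f g : T -> R.

Lemma integrable_EFinZ (c : R) f :
  m.-integrable setT (fun x => (f x)%:E) ->
  m.-integrable setT (fun x => (c * f x)%:E).
Proof.
move=> fi; have := integrableZl measurableT c fi.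
by apply: eq_integrable.
Qed.

Lemma integrable_EFinD f g :
  m.-integrable setT (fun x => (f x)%:E) ->
  m.-integrable setT (fun x => (g x)%:E) ->
  m.-integrable setT (fun x => (f x + g x)%:E).
Proof.
move=> fi gi; have := integrableD measurableT fi gi.
by apply: eq_integrable.
Qed.

Lemma RintegralZD (c : R) f g :
  m.-integrable setT (fun x => (f x)%:E) ->
  m.-integrable setT (fun x => (g x)%:E) ->
  \int[m]_x (c * f x + g x) = c * \int[m]_x f x + \int[m]_x g x.
Proof.
move=> fi gi; rewrite RintegralD ?RintegralZl//.
exact: integrable_EFinZ.
Qed.

End real_integrable.

Section square_integrable.
Context d (T : measurableType d) (R : realType) (m : {measure set T -> \bar R}).
Implicit Types (f g : T -> R).

Definition L2r f := measurable_fun setT f /\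
  m.-integrable setT (fun x => (f x ^+ 2)%:E).

Definition sqnorm f : R := \int[m]_x (f x ^+ 2).

Lemma EFin_sqnorm f : L2r f -> (sqnorm f)%:E = (\int[m]_x (f x ^+ 2)%:E)%E.
Proof. by move=> [_ fi]; rewrite fineK//; exact: integrable_fin_num. Qed.

Lemma sqnorm_ge0 f : 0 <= sqnorm f.
Proof. by apply: Rintegral_ge0 => x _; rewrite sqr_ge0. Qed.

Lemma L2rZD (c : R) f g : L2r f -> L2r g -> L2r (fun x => c * f x + g x).
Proof.
move=> [mf fi] [mg gi]; have mfg : measurable_fun setT (fun x => c * f x + g x).
  by apply: measurable_funD => //; apply: measurable_funM.
split => //.
have i1 : m.-integrable setT ((fun x => (2 * c ^+ 2)%:E * (f x ^+ 2)%:E) \+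
    (fun x => 2%:E * (g x ^+ 2)%:E))%E.
  by apply: integrableD => //; apply: integrableZl.
apply: le_integrable i1 => //.
  by apply/measurable_EFinP; exact: measurable_funX.
move=> x _ /=; rewrite lee_fin !ger0_norm ?sqr_ge0//.
  rewrite -subr_ge0 (_ : _ - _ = (c * f x - g x) ^+ 2) ?sqr_ge0//; ring.
by rewrite addr_ge0// mulr_ge0// ?sqr_ge0// mulr_ge0// sqr_ge0.
Qed.

End square_integrable.

Section average.
Context {R : realType} {G : topologicalGroupType} {B : ptopologicalType}.
Variables (a : continuous_action G B) (nu : probability (borel B) R).
Hypotheses (scG : @second_countable G) (scB : @second_countable B).
Hypothesis qi : quasi_invariant a nu.
Variables (mu : {measure set (borel G) -> \bar R}) (E : set (borel G)).
Hypotheses (mE : measurable E) (Eoo : (mu E < +oo)%E).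
Hypothesis EV : E = [set (g^-1)%g | g in E].
Hypothesis muV : forall A : set (borel G), measurable A ->
  mu [set (g^-1)%g | g in A] = mu A.
Variable e : borel G -> borel B.
Hypothesis me : measurable_fun E e.
Variables (w : borel G * borel B -> R) (M : R).
Hypotheses (mw : measurable_fun setT w) (w0 : forall z, 0 <= w z)
  (wM : forall z, w z <= M)
  (wE : {ae mu, forall g, E g ->
    {ae nu, forall b, w (g, b) = sdens a nu g b / Xi a nu g}}).

Local Notation kappa := (mfrestr mE Eoo).
Local Notation P := (kappa \x nu)%E.
Local Notation sdens := (sdens a nu).
Local Notation Xi := (Xi a nu).
Local Notation actV z := (a (z.1^-1)%g z.2).

(** The number [<M^f F, H>] for real [f], [F] and [H]. *)
Definition tavg (f F H : borel B -> R) : R :=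
  (vol mu E)^-1 * \int[mu]_(g in E) (f (e g) * (coefJ a nu F H g / Xi g)).

(** [e] is measurable only on [E]. Giving it a constant value elsewhere makes it measurable on [G],
    and the restricted measure [kappa] does not see the change. *)
Let e' (g : borel G) : borel B := if g \in E then e g else point.

Let me' : measurable_fun setT e'.
Proof.
move=> _ A mA; rewrite setTI.
have -> : e' @^-1` A = (E `&` e @^-1` A) `|`
    (if `[< A point >] then ~` E else set0).
  apply/seteqP; split => g; rewrite /e' /=.
  - case: ifPn => [/set_mem Eg Ae|gE Ap]; first by left.
    by right; rewrite asboolT// => /mem_set; exact/negP.
  - move=> [[Eg]|]; first by rewrite mem_set.
    by case: asboolP => // Ap nE; rewrite memNset.
apply: measurableU; first exact: me.
by case: asboolP => // _; exact: measurableC.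
Qed.

Let mfst_e' : measurable_fun [set: borel G * borel B] (fun z => e' z.1).
Proof. exact: (measurableT_comp me' measurable_fst). Qed.

Let msnd : measurable_fun [set: borel G * borel B] (fun z : borel G * borel B => z.2 : borel B).
Proof. exact: measurable_snd. Qed.

Let mactV := measurable_actV a scG scB.

(** For fixed [g], unitarity moves [g^-1] from [F] to the density: the integral of [F (g^-1 b)]
    against [sigma_g] is that of [F] against the density of [g^-1], while [Xi] is unchanged. The
    substitution of [g^-1] for [g] then preserves [E] and the Haar measure. *)
Lemma ge0_integral_weight_inv (F : borel B -> R) :
  measurable_fun setT F -> (forall b, 0 <= F b) ->
  (\int[P]_z (F (actV z) * w z)%:E = \int[P]_z (F z.2 * w z)%:E)%E.
Proof.
move=> mF F0.
pose H1 (z : borel G * borel B) := (F (actV z) * w z)%:E.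
pose H2 (z : borel G * borel B) := (F z.2 * w z)%:E.
have mH1 : measurable_fun setT H1.
  apply/measurable_EFinP; apply: measurable_funM => //.
  exact: (measurableT_comp mF mactV).
have mH2 : measurable_fun setT H2.
  apply/measurable_EFinP; apply: measurable_funM => //.
  exact: (measurableT_comp mF msnd).
have H10 z : (0 <= H1 z)%E by rewrite lee_fin mulr_ge0.
have H20 z : (0 <= H2 z)%E by rewrite lee_fin mulr_ge0.
rewrite (fubini_tonelli1 H1 mH1 H10) (fubini_tonelli1 H2 mH2 H20).
pose q : borel G -> \bar R := fubini_F nu H2.
have mq : measurable_fun setT q by exact: measurable_fun_fubini_tonelli_F.
have q0 g : (0 <= q g)%E by exact: integral_ge0.
have minv := @measurable_invg G.
transitivity (\int[kappa]_g q (g^-1)%g)%E; last first.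
  transitivity (\int[pushforward kappa (fun g : borel G => (g^-1)%g : borel G)]_g q g)%E.
    by rewrite ge0_integral_pushforward.
  apply: eq_measure_integral => A mA _.
  rewrite /pushforward /= /mfrestr /mrestr.
  rewrite -(muV (measurableI _ _ mA mE)); congr (mu _).
  apply/seteqP; split => g /=.
    move=> [Ag Eg]; exists (g^-1)%g; rewrite ?invgK//; split => //.
    by rewrite EV; exists g.
  move=> [h [Ah Eh] <-]; rewrite invgK; split => //.
  by rewrite EV; exists h.
have mqV : measurable_fun setT (fun g : borel G => q (g^-1)%g).
  exact: (measurableT_comp mq minv).
have mp : measurable_fun setT (fubini_F nu H1).
  exact: (measurable_fun_fubini_tonelli_F H1 mH1 H10).
have p0 g : (0 <= fubini_F nu H1 g)%E by exact: integral_ge0.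
rewrite (ge0_integral_mfrestr mE Eoo mp p0).
rewrite (ge0_integral_mfrestr mE Eoo mqV (fun g => q0 _)).
have [N [mN N0 NP]] := wE.
(* The formula for [w] is needed at [g] and at [g^-1], so the exceptional set is completed by its
   inverse, which is null by [muV]. *)
pose NV : set (borel G) := [set (g^-1)%g | g in N].
have mNV : measurable NV.
  rewrite (_ : NV = (fun g : borel G => (g^-1)%g : borel G) @^-1` N).
    by rewrite -[X in measurable X]setTI; exact: minv.
  apply/seteqP; split => [_ [g Ng <-]|g Ng] /=; first by rewrite invgK.
  by exists (g^-1)%g => //; rewrite invgK.
apply: (@integral_eq_off_null _ _ _ mu E (N `|` NV)).
- exact: measurableU.
- by rewrite measureU0// /NV muV.
move=> g Eg nNg.
have EgV : E (g^-1)%g by rewrite EV; exists g.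
have w1 : {ae nu, forall b, w (g, b) = sdens g b / Xi g}.
  by apply: contrapT => h; apply: nNg; left; apply: NP => /= /(_ Eg).
have w2 : {ae nu, forall b, w ((g^-1)%g, b) = sdens (g^-1)%g b / Xi g}.
  rewrite -(Xi_inv qi); apply: contrapT => h; apply: nNg; right.
  exists (g^-1)%g; last exact: invgK.
  by apply: NP => /= /(_ EgV).
have X0 : 0 <= (Xi g)^-1 by rewrite invr_ge0 ltW// Xi_gt0.
have mFV : measurable_fun setT (fun b : borel B => F (a (g^-1)%g b)).
  exact: (measurableT_comp mF (act_measurable a (g^-1)%g)).
have mwg h : measurable_fun setT (fun b => w (h, b)) by exact: measurable_fun_pair1.
transitivity ((Xi g)^-1%:E * \int[nu]_b (F (a (g^-1)%g b) * 1 * sdens g b)%:E)%E.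
  rewrite -ge0_integralZl//; last 2 first.
  - apply/measurable_EFinP; apply: measurable_funM; last exact: measurable_sdens.
    exact: measurable_funM.
  - by move=> b _; rewrite lee_fin mulr1 mulr_ge0// sdens_ge0.
  apply: ae_eq_integral => //.
  - by apply/measurable_EFinP; exact: measurable_funM.
  - apply: measurable_funeM; apply/measurable_EFinP; apply: measurable_funM; last exact: measurable_sdens.
    exact: measurable_funM.
  - apply: filterS w1 => b wb _; rewrite /H1/= wb -EFinM; congr EFin; ring.
have /= -> := ge0_sdens_sym qi g (H := cst 1) mF (measurable_cst _) F0 (fun=> ler01).
rewrite -ge0_integralZl//; last 2 first.
- apply/measurable_EFinP; apply: measurable_funM; last exact: measurable_sdens.
  exact: measurable_funM.
- by move=> b _; rewrite lee_fin mulr1 mulr_ge0// sdens_ge0.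
apply: ae_eq_integral => //.
- apply: measurable_funeM; apply/measurable_EFinP; apply: measurable_funM; last exact: measurable_sdens.
  exact: measurable_funM.
- by apply/measurable_EFinP; exact: measurable_funM.
- apply: filterS w2 => b wb _; rewrite /H2/= wb -EFinM; congr EFin; ring.
Qed.

Lemma integrable_snd_weight (H : borel B -> R) : L2r nu H ->
  P.-integrable setT (fun z => (H z.2 ^+ 2 * w z)%:E).
Proof.
move=> [mH Hi].
have mH2 : measurable_fun setT (fun z : borel G * borel B => (H z.2 ^+ 2)%:E).
  apply/measurable_EFinP; apply: measurable_funX.
  exact: (measurableT_comp mH msnd).
have M0 : 0 <= M := le_trans (w0 (point, point)) (wM _).
have i1 : P.-integrable setT (fun z => (H z.2 ^+ 2)%:E).
  apply/integrableP; split => //.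
  have -> : (\int[P]_z `|(H z.2 ^+ 2)%:E| = \int[P]_z (H z.2 ^+ 2)%:E)%E.
    by apply: eq_integral => z _; rewrite gee0_abs// lee_fin sqr_ge0.
  rewrite (fubini_tonelli1 (fun z : borel G * borel B => (H z.2 ^+ 2)%:E) mH2); last first.
    by move=> z; rewrite lee_fin sqr_ge0.
  rewrite /fubini_F/= integral_cst//=.
  rewrite lte_mul_pinfty//; first by apply: integral_ge0 => b _; rewrite lee_fin sqr_ge0.
    exact: integrable_fin_num.
  by rewrite /mfrestr /mrestr setTI.
apply: (@le_integrable _ _ _ _ _ measurableT _ (fun z => M%:E * (H z.2 ^+ 2)%:E)%E) => //.
- apply/measurable_EFinP; apply: measurable_funM => //.
  by apply: measurable_funX; exact: (measurableT_comp mH msnd).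
- move=> z _ /=; rewrite lee_fin !normrM (ger0_norm (w0 z)) (ger0_norm M0).
  by rewrite mulrC ler_wpM2r.
- exact: integrableZl.
Qed.

Lemma integrable_actV_weight (F : borel B -> R) : L2r nu F ->
  P.-integrable setT (fun z => (F (actV z) ^+ 2 * w z)%:E).
Proof.
move=> LF; have [mF _] := LF; have /integrableP[_ ioo] := integrable_snd_weight LF.
apply/integrableP; split.
  apply/measurable_EFinP; apply: measurable_funM => //.
  by apply: measurable_funX; exact: (measurableT_comp mF mactV).
apply: le_lt_trans ioo.
rewrite le_eqVlt; apply/orP; left; apply/eqP.
transitivity (\int[P]_z (F (actV z) ^+ 2 * w z)%:E)%E.
  by apply: eq_integral => z _; rewrite gee0_abs// lee_fin mulr_ge0// sqr_ge0.
rewrite (@ge0_integral_weight_inv (fun b => F b ^+ 2)).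
- by apply: eq_integral => z _; rewrite gee0_abs// lee_fin mulr_ge0// sqr_ge0.
- exact: measurable_funX.
- by move=> b; rewrite sqr_ge0.
Qed.

Definition bmeas (f : borel B -> R) := measurable_fun setT f /\
  exists S, forall b, `|f b| <= S.

Lemma integrable_weight (f F H : borel B -> R) : bmeas f -> L2r nu F -> L2r nu H ->
  P.-integrable setT
    (fun z => (f (e' z.1) * (F (actV z) * H z.2 * w z))%:E).
Proof.
move=> [mf [S fS]] LF LH; have [mF _] := LF; have [mH _] := LH.
have S0 : 0 <= S := le_trans (normr_ge0 _) (fS point).
have i1 : P.-integrable setT (fun z => S%:E * ((F (actV z) ^+ 2 * w z)%:E + (H z.2 ^+ 2 * w z)%:E))%E.
  apply: integrableZl => //; apply: integrableD => //.
    exact: integrable_actV_weight.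
  exact: integrable_snd_weight.
apply: le_integrable i1 => //.
  apply/measurable_EFinP; apply: measurable_funM; first exact: (measurableT_comp mf mfst_e').
  apply: measurable_funM => //; apply: measurable_funM; first exact: (measurableT_comp mF mactV).
  exact: (measurableT_comp mH msnd).
move=> z _; rewrite -EFinD -EFinM /= lee_fin !normrM (ger0_norm (w0 z)) (ger0_norm S0).
apply: ler_pM => //; first by rewrite !mulr_ge0.
rewrite -mulrDl normrM (ger0_norm (w0 z)) ler_wpM2r//.
rewrite [leRHS]ger0_norm ?addr_ge0 ?sqr_ge0// -normrM.
rewrite ler_norml; apply/andP; split; nra.
Qed.

Let integrand (f F H : borel B -> R) (z : borel G * borel B) : \bar R :=
  (f (e' z.1) * (F (actV z) * H z.2 * w z))%:E.

Let coefJ_weight (f F H : borel B -> R) : bmeas f -> L2r nu F -> L2r nu H ->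
  exists N : set (borel G), [/\ measurable N, mu N = 0%E &
    forall g, E g -> ~ N g ->
      (f (e g) * (coefJ a nu F H g / Xi g))%:E = fubini_F nu (integrand f F H) g].
Proof.
move=> bf LF LH.
(* Integrability of the section at [g] is taken with [f = 1]: the factor [f (e g)] is constant in
   [b] and may vanish, so the general case would not give it. *)
have b1 : bmeas (cst 1) by split => //; exists 1 => b; rewrite normr1.
have [N [mN N0 NP]] := wE.
have [N' [mN' N'0 N'P]] := ae_mfrestr (ae_integrable1 (integrable_weight b1 LF LH)).
exists (N `|` N'); split; [exact: measurableU|by rewrite measureU0|].
move=> g Eg nNg.
have w1 : {ae nu, forall b, w (g, b) = sdens g b / Xi g}.
  by apply: contrapT => h; apply: nNg; left; apply: NP => /= /(_ Eg).
have {}ig : nu.-integrable setT (fun b => (F (a (g^-1)%g b) * H b * w (g, b))%:E).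
  have /(_ Eg) : E g -> nu.-integrable setT
      (fun b => (1 * (F (a (g^-1)%g b) * H b * w (g, b)))%:E).
    by apply: contrapT => h; apply: nNg; right; apply: N'P.
  by under eq_fun do rewrite mul1r.
have Xp := Xi_gt0 qi g.
have [mF _] := LF; have [mH _] := LH.
have mFV : measurable_fun setT (fun b : borel B => F (a (g^-1)%g b)).
  exact: (measurableT_comp mF (act_measurable a (g^-1)%g)).
have mwg : measurable_fun setT (fun b => w (g, b)) by exact: measurable_fun_pair1.
have JE : (coefJ a nu F H g / Xi g)%:E = (\int[nu]_b (F (a (g^-1)%g b) * H b * w (g, b))%:E)%E.
  rewrite -[RHS]fineK; last exact: integrable_fin_num.
  congr EFin; apply: (mulIf (lt0r_neq0 Xp)); rewrite divfK ?gt_eqF//.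
  rewrite -RintegralZr//; congr fine; apply: ae_eq_integral => //.
  - apply/measurable_EFinP; apply: measurable_funM; last exact: measurable_sdens.
    exact: measurable_funM.
  - by apply/measurable_EFinP; do 2 apply: measurable_funM => //; exact: measurable_funM.
  - by apply: filterS w1 => b wb _; rewrite wb -!mulrA mulVf ?gt_eqF// mulr1.
rewrite EFinM JE -integralZl//; apply: eq_integral => b _.
by rewrite /integrand/= /e' mem_set.
Qed.

(** Replaces an iterated integral, whose outer integrand is known to be measurable only off a null
    set, by an absolutely convergent integral over the product. Linearity in each argument then
    becomes linearity of one integral. *)
Lemma tavgE (f F H : borel B -> R) : bmeas f -> L2r nu F -> L2r nu H ->
  tavg f F H = (vol mu E)^-1 *
    \int[P]_z (f (e' z.1) * (F (actV z) * H z.2 * w z)).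
Proof.
move=> bf LF LH; rewrite /tavg; congr (_ * fine _).
have iH := integrable_weight bf LF LH.
rewrite -[RHS](integral12_prod_meas1 iH).
rewrite integral_mfrestr; last exact: (measurable_fubini_F iH).
have [N [mN N0 NP]] := coefJ_weight bf LF LH.
exact: (integral_eq_off_null mN N0 NP).
Qed.

(* The matrix coefficients are only measurable in [g] up to null sets. *)
Definition almost_integrable (k : borel G -> R) :=
  exists (k' : borel G -> \bar R) (N : set (borel G)),
    [/\ kappa.-integrable setT k', measurable N, mu N = 0%E &
      forall g, E g -> ~ N g -> (k g)%:E = k' g].

Lemma almost_integrable_coefJ (f F H : borel B -> R) :
  bmeas f -> L2r nu F -> L2r nu H ->
  almost_integrable (fun g => f (e g) * (coefJ a nu F H g / Xi g)).
Proof.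
move=> bf LF LH; have [N [mN N0 NP]] := coefJ_weight bf LF LH.
exists (fubini_F nu (integrand f F H)), N; split => //.
by apply: integrable_fubini_F; exact: integrable_weight.
Qed.

Let Rintegral_almost (k : borel G -> R) k' N :
  kappa.-integrable setT k' -> measurable N -> mu N = 0%E ->
  (forall g, E g -> ~ N g -> (k g)%:E = k' g) ->
  \int[mu]_(g in E) k g = fine (\int[kappa]_g k' g)%E.
Proof.
move=> ik mN N0 NP; rewrite integral_mfrestr; last by have /integrableP[] := ik.
by congr fine; exact: (integral_eq_off_null mN N0 NP).
Qed.

Lemma almost_integrableZD (c : R) (k1 k2 : borel G -> R) :
  almost_integrable k1 -> almost_integrable k2 ->
  almost_integrable (fun g => c * k1 g + k2 g) /\
  \int[mu]_(g in E) (c * k1 g + k2 g) =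
    c * (\int[mu]_(g in E) k1 g) + \int[mu]_(g in E) k2 g.
Proof.
move=> [k1' [N1 [i1 mN1 N10 N1P]]] [k2' [N2 [i2 mN2 N20 N2P]]].
have i3 : kappa.-integrable setT (fun g => c%:E * k1' g + k2' g)%E.
  by apply: integrableD => //; exact: integrableZl.
have mN : measurable (N1 `|` N2) by exact: measurableU.
have N0 : mu (N1 `|` N2) = 0%E by rewrite measureU0.
have NP g : E g -> ~ (N1 `|` N2) g -> (c * k1 g + k2 g)%:E = (c%:E * k1' g + k2' g)%E.
  by move=> Eg /not_orP[n1 n2]; rewrite EFinD EFinM N1P// N2P.
split; first by exists (fun g => c%:E * k1' g + k2' g)%E, (N1 `|` N2).
rewrite (Rintegral_almost i3 mN N0 NP) (Rintegral_almost i1 mN1 N10 N1P).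
rewrite (Rintegral_almost i2 mN2 N20 N2P).
rewrite integralD//; last exact: integrableZl.
rewrite integralZl// fineD ?fineM//; last 2 first.
- by rewrite fin_numM// integrable_fin_num.
- by rewrite integrable_fin_num.
by rewrite integrable_fin_num.
Qed.

Lemma tavgZD_1 (c : R) (f f' F H : borel B -> R) :
  bmeas f -> bmeas f' -> L2r nu F -> L2r nu H ->
  tavg (fun b => c * f b + f' b) F H = c * tavg f F H + tavg f' F H.
Proof.
move=> bf bf' LF LH.
have bff : bmeas (fun b => c * f b + f' b).
  have [mf [S fS]] := bf; have [mf' [S' fS']] := bf'; split.
    by apply: measurable_funD => //; exact: measurable_funM.
  exists (`|c| * S + S') => b; rewrite (le_trans (ler_normD _ _))// lerD// normrM.
  by rewrite ler_wpM2l.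
rewrite !tavgE// mulrCA -mulrDr; congr (_ * _).
rewrite -RintegralZD; [|exact: integrable_weight..].
by apply: eq_Rintegral => z _; ring.
Qed.

Lemma tavgZD_2 (c : R) (f F F' H : borel B -> R) :
  bmeas f -> L2r nu F -> L2r nu F' -> L2r nu H ->
  tavg f (fun b => c * F b + F' b) H = c * tavg f F H + tavg f F' H.
Proof.
move=> bf LF LF' LH.
rewrite !tavgE//; last exact: L2rZD.
rewrite mulrCA -mulrDr; congr (_ * _).
rewrite -RintegralZD; [|exact: integrable_weight..].
by apply: eq_Rintegral => z _; ring.
Qed.

Lemma tavgZD_3 (c : R) (f F H H' : borel B -> R) :
  bmeas f -> L2r nu F -> L2r nu H -> L2r nu H' ->
  tavg f F (fun b => c * H b + H' b) = c * tavg f F H + tavg f F H'.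
Proof.
move=> bf LF LH LH'.
rewrite !tavgE//; last exact: L2rZD.
rewrite mulrCA -mulrDr; congr (_ * _).
rewrite -RintegralZD; [|exact: integrable_weight..].
by apply: eq_Rintegral => z _; ring.
Qed.

Lemma vol_ge0 : 0 <= vol mu E.
Proof. by rewrite fine_ge0. Qed.

Lemma Rintegral_actV_weight (F : borel B -> R) : L2r nu F ->
  \int[P]_z (F (actV z) ^+ 2 * w z) = \int[P]_z (F z.2 ^+ 2 * w z).
Proof.
move=> [mF _]; congr fine.
apply: (ge0_integral_weight_inv (F := fun b => F b ^+ 2)).
- exact: measurable_funX.
- by move=> b; rewrite sqr_ge0.
Qed.

(* AM-GM: [|F (g^-1 b) H b| <= t F (g^-1 b)^2 + H b^2 / t]; by symmetry of the
   average both squares are integrated against the same function of [b]. *)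
Lemma tavg_bound (K S t : R) (f F H : borel B -> R) :
  (forall F : borel B -> R, measurable_fun setT F -> (forall b, 0 <= F b) ->
    (\int[P]_z (F z.2 * w z)%:E <= (K * vol mu E)%:E * \int[nu]_b (F b)%:E)%E) ->
  0 <= K -> 0 < t -> measurable_fun setT f -> (forall b, `|f b| <= S) ->
  L2r nu F -> L2r nu H ->
  `|tavg f F H| <= S * K * (t * sqnorm nu F + sqnorm nu H / t).
Proof.
move=> hK K0 t0 mf fS LF LH.
have bf : bmeas f by split => //; exists S.
have S0 : 0 <= S := le_trans (normr_ge0 _) (fS point).
have iP := integrable_weight bf LF LH.
have iF := integrable_actV_weight LF.
have iH := integrable_snd_weight LH.
have iH2 := integrable_snd_weight LF.
have sqK (D : borel B -> R) : L2r nu D ->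
    \int[P]_z (D z.2 ^+ 2 * w z) <= K * vol mu E * sqnorm nu D.
  move=> LD; have [mD _] := LD.
  rewrite -lee_fin fineK; last by apply: integrable_fin_num => //; exact: integrable_snd_weight.
  rewrite EFinM EFin_sqnorm//; apply: (hK (fun b => D b ^+ 2)).
  - exact: measurable_funX.
  - by move=> b; rewrite sqr_ge0.
rewrite tavgE// normrM ger0_norm ?invr_ge0 ?vol_ge0//.
have i2 : P.-integrable setT (fun z => (t * (F (actV z) ^+ 2 * w z) + t^-1 * (H z.2 ^+ 2 * w z))%:E).
  by apply: integrable_EFinD; exact: integrable_EFinZ.
have i3 : P.-integrable setT (fun z => (S * (t * (F (actV z) ^+ 2 * w z) + t^-1 * (H z.2 ^+ 2 * w z)))%:E).
  exact: integrable_EFinZ.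
have le1 : `|\int[P]_z (f (e' z.1) * (F (actV z) * H z.2 * w z))| <=
    S * (t * (K * vol mu E * sqnorm nu F) + t^-1 * (K * vol mu E * sqnorm nu H)).
  apply: (le_trans (le_normr_Rintegral _ iP)) => //.
  apply: (@le_trans _ _ (\int[P]_z (S * (t * (F (actV z) ^+ 2 * w z) + t^-1 * (H z.2 ^+ 2 * w z))))).
    apply: le_Rintegral => //.
      exact: (@integrable_norm _ _ _ _ _ _ iP).
    move=> z _; rewrite !normrM (ger0_norm (w0 z)) ler_pM//; first by rewrite !mulr_ge0.
    have -> : t * (F (actV z) ^+ 2 * w z) + t^-1 * (H z.2 ^+ 2 * w z) =
       (t * F (actV z) ^+ 2 + t^-1 * H z.2 ^+ 2) * w z by ring.
    rewrite ler_wpM2r//.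
    by rewrite -normrM; exact: weighted_amgm.
  rewrite RintegralZl// ler_wpM2l//.
  have -> : \int[P]_z (t * (F (actV z) ^+ 2 * w z) + t^-1 * (H z.2 ^+ 2 * w z)) =
    t * \int[P]_z (F (actV z) ^+ 2 * w z) + t^-1 * \int[P]_z (H z.2 ^+ 2 * w z).
    rewrite RintegralZD//; first by rewrite RintegralZl.
    exact: integrable_EFinZ.
  rewrite Rintegral_actV_weight//; apply: lerD; rewrite ler_wpM2l ?sqK ?invr_ge0 ?(ltW t0)//.
apply: (le_trans (ler_wpM2l _ le1)); first by rewrite invr_ge0 vol_ge0.
have -> : (vol mu E)^-1 * (S * (t * (K * vol mu E * sqnorm nu F) + t^-1 * (K * vol mu E * sqnorm nu H)))
  = ((vol mu E)^-1 * vol mu E) * (S * K * (t * sqnorm nu F + sqnorm nu H / t)) by ring.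
(* If the volume is 0 the left-hand side is 0 and only the sign of the right-hand side matters. *)
have [->|v0] := eqVneq (vol mu E) 0; last by rewrite mulVf// mul1r.
rewrite mulr0 mul0r !mulr_ge0// addr_ge0 ?mulr_ge0 ?invr_ge0 ?sqnorm_ge0 ?(ltW t0)//.
Qed.

(** Up to the factor [1 / vol], this is [M^f F] as an actual function, obtained by averaging over
    [g] at each point [b]. [avgfun] restores the factor. *)
Definition avgint (f F : borel B -> R) (b : borel B) : R :=
  \int[kappa]_g (f (e' g) * (F (a (g^-1)%g b) * w (g, b))).

Definition avgfun (f F : borel B -> R) (b : borel B) : R :=
  (vol mu E)^-1 * avgint f F b.

Lemma bmeas_L2r f : bmeas f -> L2r nu f.
Proof.
move=> [mf [S fS]]; split => //.
apply: (@le_integrable _ _ _ _ _ measurableT _ (cst (S ^+ 2)%:E)) => //.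
- by apply/measurable_EFinP; exact: measurable_funX.
- move=> b _ /=; rewrite lee_fin !ger0_norm ?sqr_ge0//.
  rewrite -(real_normK (num_real (f b))) ler_pXn2r// nnegrE//.
  exact: le_trans (fS b).
- exact: finite_measure_integrable_cst.
Qed.

Lemma L2r_integrable f H : bmeas f -> L2r nu H ->
  nu.-integrable setT (fun b => (f b * H b)%:E).
Proof.
move=> [mf [S fS]] [mH Hi].
have i1 : nu.-integrable setT (fun b => (S * (1 + H b ^+ 2))%:E).
  apply: integrable_EFinZ; apply: integrable_EFinD => //.
  exact: finite_measure_integrable_cst.
apply: le_integrable i1 => //.
  by apply/measurable_EFinP; exact: measurable_funM.
move=> b _ /=; rewrite lee_fin normrM (le_trans _ (ler_norm _))//.
apply: ler_pM => //.
rewrite -(real_normK (num_real (H b))); have := normr_ge0 (H b); nra.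
Qed.

Section avgfun.
Variables f F : borel B -> R.
Hypotheses (bf : bmeas f) (bF : bmeas F).

Let b1 : bmeas (cst 1). Proof. by split => //; exists 1 => b; rewrite normr1. Qed.

Let iP : P.-integrable setT
    (fun z => (f (e' z.1) * (F (actV z) * cst 1 z.2 * w z))%:E).
Proof. by apply: integrable_weight => //; exact: bmeas_L2r. Qed.

Let avgintE b : avgint f F b = fine (fubini_G kappa
    (fun z : borel G * borel B => (f (e' z.1) * (F (actV z) * cst 1 z.2 * w z))%:E) b).
Proof.
congr fine; apply: eq_integral => g _ /=.
by rewrite mulr1.
Qed.

Lemma measurable_avgint : measurable_fun setT (avgint f F).
Proof.
rewrite (funext avgintE); apply: (@measurableT_comp _ _ _ _ _ _ (@fine R)) => //.
exact: (measurable_fubini_G iP).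
Qed.

Let bounded_integrand (H : borel B -> R) : measurable_fun setT H -> forall b : borel B,
  kappa.-integrable setT (fun g => (f (e' g) * (F (a (g^-1)%g b) * H b * w (g, b)))%:E).
Proof.
move=> mH b; have [mf [S fS]] := bf; have [mF [S' FS']] := bF.
apply: (@le_integrable _ _ _ _ _ measurableT _ (cst (S * (S' * `|H b| * M))%:E)) => //.
- apply/measurable_EFinP; apply: measurable_funM; first exact: (measurableT_comp mf me').
  have mwb : measurable_fun [set: borel G] (fun g => w (g, b)).
    exact: measurable_fun_pair2.
  have mab := measurable_fun_pair2 b mactV.
  have mFb : measurable_fun [set: borel G] (fun g => F (a (g^-1)%g b)).
    exact: (measurableT_comp mF mab).
  apply: measurable_funM => //; exact: measurable_funM.
- move=> g _ /=; rewrite lee_fin !normrM (ger0_norm (w0 _)).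
  rewrite normr_id ler_pM//; first by rewrite !mulr_ge0.
    exact: le_trans (fS _) (ler_norm _).
  rewrite ler_pM//.
    by rewrite ler_wpM2r//; exact: le_trans (FS' _) (ler_norm _).
  exact: le_trans (wM _) (ler_norm _).
- exact: finite_measure_integrable_cst.
Qed.

Lemma avgint_bounded : exists S, forall b, `|avgint f F b| <= S.
Proof.
have [mf [S fS]] := bf; have [mF [S' FS']] := bF.
have S0 : 0 <= S := le_trans (normr_ge0 _) (fS point).
have S'0 : 0 <= S' := le_trans (normr_ge0 _) (FS' point).
exists (S * (S' * M) * fine (kappa setT)) => b.
have i0 : kappa.-integrable setT (fun g => (f (e' g) * (F (a (g^-1)%g b) * w (g, b)))%:E).
  have := bounded_integrand (H := cst 1) (measurable_cst _) b.
  by under eq_fun do rewrite /= mulr1.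
apply: (le_trans (le_normr_Rintegral _ i0)) => //.
rewrite -Rintegral_cst//; apply: le_Rintegral => //.
- exact: (@integrable_norm _ _ _ _ _ _ i0).
- exact: finite_measure_integrable_cst.
- move=> g _; rewrite !normrM (ger0_norm (w0 _)).
  by rewrite ler_pM ?mulr_ge0// ler_pM.
Qed.

Lemma avgfun_bmeas : bmeas (avgfun f F).
Proof.
split; first by apply: measurable_funM => //; exact: measurable_avgint.
have [S bS] := avgint_bounded; exists ((vol mu E)^-1 * S) => b.
by rewrite normrM ger0_norm ?invr_ge0 ?vol_ge0// ler_wpM2l ?invr_ge0 ?vol_ge0.
Qed.

Lemma avgfun_inner (H : borel B -> R) : L2r nu H ->
  \int[nu]_b (avgfun f F b * H b) = tavg f F H.
Proof.
move=> LH; have [mH _] := LH.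
have LF := bmeas_L2r bF.
have iH := integrable_weight bf LF LH.
rewrite tavgE// -[X in _ = _ * fine X](integral21_prod_meas1 iH).
have GE b : fubini_G kappa (fun z : borel G * borel B => (f (e' z.1) * (F (actV z) * H z.2 * w z))%:E) b
    = ((\int[kappa]_g (f (e' g) * (F (a (g^-1)%g b) * w (g, b)))) * H b)%:E.
  rewrite -RintegralZr//; last first.
    have := bounded_integrand (H := cst 1) (measurable_cst _) b.
    by under eq_fun do rewrite /= mulr1.
  rewrite /Rintegral fineK; last first.
    apply: integrable_fin_num => //.
    by apply: eq_integrable (bounded_integrand mH b) => // g _ /=; congr EFin; ring.
  by apply: eq_integral => g _; congr EFin => /=; ring.
rewrite (funext GE) -[RHS]/(_ * \int[nu]_b (avgint f F b * H b)) -RintegralZl//.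
  by apply: eq_Rintegral => b _; rewrite /avgfun mulrA.
apply: L2r_integrable => //.
by split; [exact: measurable_avgint|exact: avgint_bounded].
Qed.

End avgfun.

(** The Schur test: in the product integral, [g] is integrated first. For almost every [b] this
    gives [vol(E)] times the value of [M 1] at [b], hence at most [K vol(E)]. *)
Lemma avgfun_weight_bound (K : R) :
  {ae nu, forall b, avgfun (cst 1) (cst 1) b <= K} -> 0 < vol mu E ->
  forall F : borel B -> R, measurable_fun setT F -> (forall b, 0 <= F b) ->
    (\int[P]_z (F z.2 * w z)%:E <= (K * vol mu E)%:E * \int[nu]_b (F b)%:E)%E.
Proof.
move=> hK v0 F mF F0.
pose H2 (z : borel G * borel B) := (F z.2 * w z)%:E.
have mH2 : measurable_fun setT H2.
  apply/measurable_EFinP; apply: measurable_funM => //.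
  exact: (measurableT_comp mF msnd).
have H20 z : (0 <= H2 z)%E by rewrite lee_fin mulr_ge0.
rewrite (fubini_tonelli2 H2 mH2 H20).
(* A negative [K] would bound the nonnegative function [avgfun] only on a null set, yet the whole
   space has measure 1. *)
have K0 : 0 <= K.
  rewrite leNgt; apply/negP => K0.
  have [N [mN N0 NP]] := hK.
  have : nu setT = 0%E.
    apply/eqP; rewrite eq_le measure_ge0 andbT -N0.
    apply: le_measure; rewrite ?inE// => b _; apply: NP => /= Hb.
    have : 0 <= avgfun (cst 1) (cst 1) b.
      rewrite /avgfun mulr_ge0 ?invr_ge0 ?vol_ge0// Rintegral_ge0// => g _.
      by rewrite !mulr_ge0.
    by rewrite leNgt (le_lt_trans Hb K0).
  by rewrite probability_setT => /eqP; rewrite onee_eq0.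
rewrite -ge0_integralZl//; last 3 first.
- exact/measurable_EFinP.
- by move=> b _; rewrite lee_fin.
- by rewrite lee_fin mulr_ge0// vol_ge0.
apply: ae_ge0_le_integral => //.
- by move=> b _; exact: integral_ge0.
- exact: (measurable_fun_fubini_tonelli_G H2 mH2 H20).
- by move=> b _; rewrite mule_ge0// lee_fin// mulr_ge0// vol_ge0.
- by apply: measurable_funeM; exact/measurable_EFinP.
apply: filterS hK => b hb _.
have mwb : measurable_fun setT (fun g => w (g, b)).
  exact: (measurable_fun_pair2 b mw).
have iw : kappa.-integrable setT (fun g => (w (g, b))%:E).
  apply: (@le_integrable _ _ _ _ _ measurableT _ (cst M%:E)) => //.
  - exact/measurable_EFinP.
  - by move=> g _ /=; rewrite lee_fin (ger0_norm (w0 _)) (le_trans (wM _))// ler_norm.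
  - exact: finite_measure_integrable_cst.
rewrite /fubini_G /H2/=.
under eq_integral do rewrite EFinM.
rewrite ge0_integralZl//; last 3 first.
- exact/measurable_EFinP.
- by move=> g _; rewrite lee_fin.
- by rewrite lee_fin.
rewrite muleC lee_wpmul2r ?lee_fin//.
rewrite -[leLHS]fineK; last exact: integrable_fin_num.
rewrite lee_fin mulrC -ler_pdivrMl//.
apply: le_trans hb; rewrite /avgfun ler_wpM2l ?invr_ge0 ?vol_ge0//.
by rewrite le_eqVlt; apply/orP; left; apply/eqP; apply: eq_Rintegral => g _; rewrite !mul1r.
Qed.

End average.

Lemma bmeas_cst {R : realType} {B : ptopologicalType} (c : R) :
  bmeas (cst c : borel B -> R).
Proof. by split => //; exists `|c| => b. Qed.

Lemma indic_norm_le1 (R : realType) (T : Type) (A : set T) x : `|\1_A x : R| <= 1.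
Proof. by rewrite indicE; case: (_ \in _); rewrite ?normr1 ?normr0. Qed.

Lemma bmeas_indic {R : realType} {B : ptopologicalType} (A : set (borel B)) :
  measurable A -> bmeas (\1_A : borel B -> R).
Proof.
move=> mA; split; first exact: measurable_indic.
by exists 1 => b; exact: indic_norm_le1.
Qed.

(** * Continuity sets *)

Section continuity_sets.
Context {R : realType} {B : ptopologicalType}.
Variable nu : probability (borel B) R.
Implicit Types U V : set B.

Lemma measurable_closure U : measurable (closure U : set (borel B)).
Proof. by apply: closed_borel; exact: closed_closure. Qed.

Lemma measurable_interior U : measurable (interior U : set (borel B)).
Proof. by apply: open_borel; exact: open_interior. Qed.

Lemma measurable_boundary U : measurable (boundary U : set (borel B)).
Proof.
by apply: (@measurableD _ (borel B)); [exact: measurable_closure|exact: measurable_interior].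
Qed.

Lemma boundaryC U : boundary (~` U) = boundary U.
Proof.
rewrite /boundary closure_setC interiorC setDE setCK.
by rewrite setDE setIC.
Qed.

Lemma boundaryI U V : boundary (U `&` V) `<=` boundary U `|` boundary V.
Proof.
move=> x [] /closureI[clU clV]; rewrite interiorI => /not_andP[nU|nV].
- by left.
- by right.
Qed.

Lemma continuity_setC U : continuity_set nu U -> continuity_set nu (~` U).
Proof.
move=> [mU U0]; split; first exact: (@measurableC _ (borel B)).
by rewrite boundaryC.
Qed.

Lemma continuity_setI U V : continuity_set nu U -> continuity_set nu V ->
  continuity_set nu (U `&` V).
Proof.
move=> [mU U0] [mV V0]; split; first exact: (@measurableI _ (borel B)).
have mUV : measurable (boundary U `|` boundary V : set (borel B)).
  by apply: (@measurableU _ (borel B)); exact: measurable_boundary.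
apply: (@subset_measure0 _ (borel B) _ nu _ _ (measurable_boundary _) mUV).
  exact: boundaryI.
exact: etrans (@measureU0 _ (borel B) R nu _ _ (measurable_boundary U) (measurable_boundary V) V0) U0.
Qed.

Lemma continuity_setU U V : continuity_set nu U -> continuity_set nu V ->
  continuity_set nu (U `|` V).
Proof.
move=> cU cV; rewrite -[U `|` V]setCK setCU.
by apply: continuity_setC; apply: continuity_setI; exact: continuity_setC.
Qed.

Lemma continuity_setT : continuity_set nu setT.
Proof.
split => //; rewrite /boundary interiorT.
by rewrite setDE setCT setI0 measure0.
Qed.

Lemma continuity_set0 : continuity_set nu set0.
Proof. by rewrite -setCT; exact: continuity_setC continuity_setT. Qed.

Lemma continuity_set_closure U : continuity_set nu U -> nu (closure U) = nu U.
Proof.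
move=> [mU U0]; apply/eqP; rewrite eq_le; apply/andP; split; last first.
  apply: le_measure; rewrite ?inE//; last exact: subset_closure.
  exact: measurable_closure.
have mb := measurable_boundary U.
have <- := @measureU0 _ (borel B) R nu _ _ mU mb U0.
  apply: le_measure; rewrite ?inE//.
- exact: measurable_closure.
- exact: (@measurableU _ (borel B)).
- move=> x clx; have [Ux|nUx] := pselect (U x); [by left|right].
  by split => // /interior_subset.
Qed.

Variable d : B -> B -> R.
Hypothesis dB : metric_inducing_topology d.

Definition thick V (r : R) : set B := [set b | exists2 v, V v & d b v < r].

Lemma open_thick V r : open (thick V r).
Proof.
have [d0 d00 dC dtri dN] := dB.
rewrite openE => b [v Vv bv]; apply/dN; exists (r - d b v); first by rewrite subr_gt0.
move=> y /= dy; exists v => //.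
rewrite (le_lt_trans (dtri y b v))// dC -ltrBrDr//.
Qed.

Lemma closure_thick V (r s : R) : r < s -> closure (thick V r) `<=` thick V s.
Proof.
have [d0 d00 dC dtri dN] := dB.
move=> rs b clb.
have : nbhs b [set y | d b y < s - r].
  by apply/dN; exists (s - r) => //; rewrite subr_gt0.
move=> /clb[y [[v Vv yv] /= by_]]; exists v => //.
rewrite (le_lt_trans (dtri b y v))//; lra.
Qed.

Lemma thickS V (r s : R) : r <= s -> thick V r `<=` thick V s.
Proof. by move=> rs b [v Vv bv]; exists v => //; exact: lt_le_trans rs. Qed.

Lemma boundary_thick_disjoint V (r s : R) : r < s ->
  boundary (thick V r) `&` boundary (thick V s) = set0.
Proof.
move=> rs; rewrite -subset0 => b [[clr _] [_ ints]]; apply: ints.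
by move: (open_thick V s); rewrite openE; apply; exact: closure_thick clr.
Qed.

Lemma thick_bigcap V : \bigcap_n thick V (n.+1%:R^-1) = closure V.
Proof.
have [d0 d00 dC dtri dN] := dB.
apply/seteqP; split => b.
  move=> bV A /dN[r r0 rA].
  have [n nr] : exists n, n.+1%:R^-1 < r.
    by exists (Num.truncn r^-1); rewrite invf_plt ?posrE// truncnS_gt.
  have [v Vv bv] := bV n I; exists v; split => //; apply: rA => /=.
  exact: lt_trans nr.
move=> clb n _.
have : nbhs b [set y | d b y < n.+1%:R^-1] by apply/dN; exists n.+1%:R^-1.
by move=> /clb[v [Vv bv]]; exists v.
Qed.

(** Boundaries for different radii are disjoint, so in a probability space only finitely many can
    have mass above [1 / (k + 1)]. *)
Lemma thick_boundary_countable V :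
  countable [set r | nu (boundary (thick V r)) != 0%E].
Proof.
pose D (k : nat) := [set r | (k.+1%:R^-1%:E < nu (boundary (thick V r)))%E].
have -> : [set r | nu (boundary (thick V r)) != 0%E] = \bigcup_k D k.
  apply/seteqP; split => r /=; last first.
    move=> [k _ Dk]; rewrite gt_eqF//; apply: le_lt_trans Dk.
    by rewrite lee_fin.
  move=> r0; pose x := fine (nu (boundary (thick V r))).
  have xE : nu (boundary (thick V r)) = x%:E.
    by rewrite fineK// fin_num_measure//; exact: measurable_boundary.
  have x0 : 0 < x.
    rewrite -lte_fin -xE lt_neqAle eq_sym r0/= measure_ge0//.
  exists (Num.truncn x^-1) => //; rewrite /D /= xE lte_fin.
  by rewrite invf_plt ?posrE// truncnS_gt.
apply: bigcup_countable => // k _; apply: finite_set_countable.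
apply: contrapT => /infiniteP/pcard_leP/unsquash f.
pose F n : set (borel B) := boundary (thick V (f n)).
have mF n : measurable (F n) by exact: measurable_boundary.
have tF : trivIset setT F.
  apply/trivIsetP => i j _ _ ij.
  have fij : f i != f j.
    by apply: contra ij => /eqP fij; apply/eqP; apply: (@inj _ _ _ f) => //; rewrite inE.
  have [lt|gt|/eqP] := ltgtP (f i) (f j); last by rewrite (negbTE fij).
  - exact: boundary_thick_disjoint.
  - by rewrite setIC; exact: boundary_thick_disjoint.
have Fk n : (k.+1%:R^-1%:E <= nu (F n))%E by apply: ltW; have := @funS _ _ _ _ f n I.
(* Of sets with mass at least [1 / (k + 1)], as many as [k + 2] are needed to exceed 1 strictly. *)
have : (\sum_(i < k.+2) nu (F i) <= 1)%E.
  rewrite -(measure_bigsetU nu mF tF).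
  by rewrite probability_le1//; apply: bigsetU_measurable.
apply/negP; rewrite -ltNge.
apply: (@lt_le_trans _ _ (\sum_(i < k.+2) k.+1%:R^-1%:E)%E); last first.
  by apply: lee_sum => i _.
rewrite sumEFin lte_fin sumr_const card_ord.
have -> : (k.+1%:R^-1 *+ k.+2 : R) = k.+2%:R / k.+1%:R by rewrite mulr_natl.
by rewrite ltr_pdivlMr// mul1r ltr_nat.
Qed.

(** The bad radii of both sets together are countable, hence of Lebesgue measure 0, while the
    interval has length [delta]. A common radius is needed because condition (1) is used with one
    [r] at both ends. *)
Lemma thick_choice V1 V2 (delta : R) : 0 < delta ->
  exists r : R, [/\ 0 < r < delta,
    continuity_set nu (thick V1 r) & continuity_set nu (thick V2 r)].
Proof.
move=> delta0.
pose D := [set r | nu (boundary (thick V1 r)) != 0%E] `|`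
          [set r | nu (boundary (thick V2 r)) != 0%E].
have cD : countable D.
  rewrite /D -bigcup2E; apply: bigcup_countable => // -[|[|i]] _ //=; exact: thick_boundary_countable.
have : ~ (`]0, delta[%classic `<=` D).
  move=> /subset_card_le /sub_countable /(_ cD) /countable_lebesgue_measure0.
  rewrite lebesgue_measure_itv/= lte_fin delta0 oppr0 adde0 => -[] /eqP.
  by rewrite gt_eqF.
move=> /existsNP[r /not_implyP[rI nD]]; exists r; split.
- by move: rI; rewrite /= in_itv.
- split; first by apply: open_borel; exact: open_thick.
  by apply: contrapT => /eqP h; apply: nD; left.
- split; first by apply: open_borel; exact: open_thick.
  by apply: contrapT => /eqP h; apply: nD; right.
Qed.

(** The thickenings decrease to the closure, not to [V]; for a continuity set the two have the same
    measure. *)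
Lemma thick_measure_cvg V (eps : R) : 0 < eps -> exists2 delta : R, 0 < delta &
  forall r, r < delta -> (nu (thick V r `\` closure V) <= eps%:E)%E.
Proof.
move=> eps0.
pose F n : set (borel B) := thick V (n.+1%:R^-1) `\` closure V.
have mF n : measurable (F n).
  apply: measurableD; first by apply: open_borel; exact: open_thick.
  exact: measurable_closure.
have F0 : \bigcap_n F n = set0.
  rewrite -subset0 => b bF; have [_ ncl] := bF 0%N I; apply: ncl.
  by rewrite -thick_bigcap => n _; have [] := bF n I.
have : nu \o F @ \oo --> nu (\bigcap_n F n).
  apply: nonincreasing_cvg_mu => //.
  - by rewrite -ge0_fin_numE// fin_num_measure.
  - by rewrite F0.
  - move=> m n mn; apply/subsetPset; apply: setSD; apply: thickS.
    by rewrite lef_pV2 ?posrE// ler_nat.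
rewrite F0 measure0 => /fine_cvgP[_ /cvgrPdist_le /(_ _ eps0)[n _ /(_ n (leqnn _)) nF]].
exists n.+1%:R^-1 => // r rn.
apply: (@le_trans _ _ (nu (F n))).
  apply: le_measure; rewrite ?inE//.
    apply: (@measurableD _ (borel B)); first by apply: open_borel; exact: open_thick.
    exact: measurable_closure.
  by apply: setSD; apply: thickS; exact: ltW.
rewrite -[leLHS]fineK ?fin_num_measure// lee_fin.
by move: nF; rewrite /= sub0r normrN ger0_norm ?fine_ge0.
Qed.

End continuity_sets.

(** * Convergence on indicators *)

(** Here [u], [v], [z] stand for the measures of [U], [V] and [U cap W]. The four limiting bounds
    [z v], [1 - u], [u (1 - v)] and [(u - z) v] add up to 1, so the errors [eps / 3] of the other
    three averages bound [t] from below within [eps]. *)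
Lemma partition_squeeze (R : realFieldType) (t t1 t2 t3 s1 s2 u v z eps : R) :
  0 < eps -> t <= z * v + eps / 3 -> t1 <= 1 - u + eps / 3 ->
  t2 <= u * (1 - v) + eps / 3 -> t3 <= (u - z) * v + eps / 3 ->
  t = s1 - t3 -> s1 = s2 - t2 -> s2 = 1 - t1 -> `|z * v - t| <= eps.
Proof. by move=> *; rewrite ler_norml; apply/andP; split; nra. Qed.

Lemma indic_setC_linear (T : Type) (R : pzRingType) (A : set T) :
  (fun x => -1 * \1_(~` A) x + \1_setT x) = \1_A :> (T -> R).
Proof.
apply/funext => x; rewrite !indicE in_setT in_setC.
by case: (x \in A) => /=; rewrite ?mulr0 ?mulr1 ?add0r ?addNr.
Qed.

Lemma ler_pM_perturb (R : realFieldType) (x1 x2 y1 y2 eta : R) :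
  0 < eta -> eta <= 1 -> 0 <= x1 <= 1 -> 0 <= x2 <= 1 -> 0 <= y1 -> 0 <= y2 ->
  y1 <= x1 + eta -> y2 <= x2 + eta -> y1 * y2 <= x2 * x1 + 3 * eta.
Proof.
move=> e0 e1 /andP[x10 x11] /andP[x20 x21] y10 y20 le1 le2.
have : y1 * y2 <= (x1 + eta) * (x2 + eta) by apply: ler_pM.
nra.
Qed.

Lemma limn_esup_near_lt (R : realType) (u : nat -> \bar R) (x eps : R) :
  (limn_esup u <= x%:E)%E -> 0 < eps -> \forall n \near \oo, (u n < (x + eps)%:E)%E.
Proof.
move=> ux eps0.
have ul : limn_esup u = ereal_inf (range (esups u)).
  rewrite limn_esup_lim; apply/cvg_lim; first exact: ereal_hausdorff.
  exact: cvg_esups_inf.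
have : (ereal_inf (range (esups u)) < (x + eps)%:E)%E.
  by rewrite -ul (le_lt_trans ux)// lte_fin ltrDl.
move=> /ereal_inf_lt[_ [N _ <-]] uN.
exists N => // n Nn; apply: le_lt_trans uN.
by apply: ereal_sup_ubound; exists n.
Qed.

Section coefJ_bounds.
Context {R : realType} {G : topologicalGroupType} {B : ptopologicalType}.
Variables (a : continuous_action G B) (nu : probability (borel B) R).
Hypothesis qi : quasi_invariant a nu.
Implicit Types (g : G) (U V W : set (borel B)).

Local Notation sdens := (sdens a nu).
Local Notation Xi := (Xi a nu).
Local Notation coefJ := (coefJ a nu).

Lemma measurable_indic_act g V : measurable V ->
  measurable_fun setT (fun b : borel B => \1_V (a g b) : R).
Proof.
by move=> mV; exact: (measurableT_comp (measurable_indic mV) (act_measurable a g)).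
Qed.

Lemma coefJ_indic_integrable g V W : measurable V -> measurable W ->
  nu.-integrable setT
    (fun b => (\1_V (a (g^-1)%g b) * \1_W b * sdens g b)%:E).
Proof.
move=> mV mW; apply: (le_integrable _ _ _ (sdens_integrable qi g)) => //.
- apply/measurable_EFinP; apply: measurable_funM; last exact: measurable_sdens.
  by apply: measurable_funM => //; exact: measurable_indic_act.
- move=> b _ /=; rewrite lee_fin normrM ger0_norm ?mulr_ge0//.
  by rewrite ler_piMl// !indicE; do 2 case: (_ \in _); rewrite ?mulr1 ?mulr0.
Qed.

Lemma coefJ_indic_ge0 g V W : 0 <= coefJ (\1_V) (\1_W) g.
Proof.
by apply: Rintegral_ge0 => b _; rewrite !mulr_ge0// sdens_ge0.
Qed.

Lemma coefJ_indic_le g V V' W W' : measurable V -> measurable W ->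
  measurable V' -> measurable W' -> V `<=` V' -> W `<=` W' ->
  coefJ (\1_V) (\1_W) g <= coefJ (\1_V') (\1_W') g.
Proof.
move=> mV mW mV' mW' VV WW; apply: le_Rintegral => //.
- exact: coefJ_indic_integrable.
- exact: coefJ_indic_integrable.
move=> b _; rewrite ler_wpM2r ?sdens_ge0// ler_pM// !indicE ler_nat.
- by have [/set_mem/VV Vb|//] := boolP (_ \in V); rewrite mem_set.
- by have [/set_mem/WW Vb|//] := boolP (_ \in W); rewrite mem_set.
Qed.

Lemma coefJ_indicTT g : coefJ (\1_setT) (\1_setT) g = Xi g.
Proof. by apply: eq_Rintegral => b _; rewrite !indicT !mul1r. Qed.

Lemma coefJ_indic_sym g V W : measurable V -> measurable W ->
  coefJ (\1_V) (\1_W) g = coefJ (\1_W) (\1_V) (g^-1)%g.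
Proof.
move=> mV mW; congr fine.
rewrite (@ge0_sdens_sym _ _ _ _ _ qi g (\1_V) (\1_W))//.
by apply: eq_integral => b _; rewrite invgK [\1_W _ * _]mulrC.
Qed.

Lemma harish_chandra_coef g V :
  inner nu (qrep a nu g constant1) (cindic V) / harish_chandra a nu g =
  (coefJ (\1_setT) (\1_V) g / Xi g)%:C.
Proof.
rewrite harish_chandraE [RHS]rmorphM/= fmorphV; congr (_ / _).
rewrite /inner /cintegral; congr (_ +i* _).
  apply: eq_Rintegral => b _.
  by rewrite /qrep /constant1 /cindic -/(rnd a nu g b) -/(sdens g b) !partsE/= indicT /=; ring.
rewrite (_ : (fun x => _) = cst 0); first by rewrite Rintegral_cst// mul0r.
by apply/funext => b; rewrite /qrep /constant1 /cindic -/(rnd a nu g b) -/(sdens g b) !partsE/=; ring.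
Qed.

End coefJ_bounds.

Section asymptotic_independence.
Context {R : realType} {G : topologicalGroupType} {B : ptopologicalType}.
Variables (mu : {measure set (borel G) -> \bar R}) (nu : probability (borel B) R)
  (a : continuous_action G B) (L : G -> R) (d : B -> B -> R)
  (E : nat -> set G) (e : nat -> G -> B).
Hypotheses (scG : @second_countable G) (scB : @second_countable B).
Hypothesis lh : left_haar mu.
Hypothesis qi : quasi_invariant a nu.
Hypothesis lenL : length_function L.
Hypothesis dB : metric_inducing_topology d.
Hypothesis Eoo : forall n, (mu (E n) < +oo)%E.
Hypothesis mE : forall n, measurable (E n : set (borel G)).
Hypothesis EV : forall n, E n = [set (g^-1)%g | g in E n].
Hypothesis muV : forall A : set (borel G), measurable A ->
  mu [set (g^-1)%g | g in A] = mu A.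
Hypothesis volE_oo : mu (E n) @[n --> \oo] --> +oo%E.
Hypothesis me : forall n, measurable_fun (E n : set (borel G)) (e n : borel G -> borel B).
Hypothesis concentration : forall r : R, 0 < r ->
    exists h : R -> R,
      [/\ forall s, 0 <= s -> 0 <= h s,
          forall s t, 0 <= s -> s <= t -> h t <= h s,
          h s @[s --> +oo] --> (0 : R)
        & forall n g, E n g ->
            inner nu (qrep a nu g constant1) (cindic [set b | r <= d b (e n g)])
              / harish_chandra a nu g <= (h (L g))%:C].
Hypothesis independence : forall U V : set B,
    continuity_set nu U -> continuity_set nu V ->
    (limn_esup (fun n => ((vol mu (E n))^-1)%:E *
       \int[mu]_(g in E n) (\1_U (e n (g^-1)%g) * \1_V (e n g))%:E)
     <= nu U * nu V)%E.
Hypothesis weight : forall n, exists (w : borel G * borel B -> R) (M : R),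
  [/\ measurable_fun setT w, forall z, 0 <= w z, forall z, w z <= M &
   {ae mu, forall g, E n g ->
     {ae nu, forall b, w (g, b) = sdens a nu g b / Xi a nu g}}].

Local Notation Xi := (Xi a nu).
Local Notation coefJ := (coefJ a nu).
Local Notation tav n U V W := (tavg a nu mu (E n) (e n) (\1_U) (\1_V) (\1_W)).

Let far r (x : B) : set (borel B) := [set b | r <= d b x].

Let measurable_far r x : measurable (far r x).
Proof.
apply: closed_borel; rewrite -[far r x]setCK; apply: open_closedC.
have -> : ~` far r x = thick d [set x] r.
  apply/seteqP; split => b /=; rewrite /far /=.
    by move=> /negP; rewrite -ltNge => bx; exists x.
  by move=> [_ -> bx] /=; rewrite leNgt bx.
exact: open_thick.
Qed.

(** When [e n g] is not within [r] of [V], all of [V] lies in the set of points at distance at least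
    [r] from [e n g], whose share condition (1) controls. *)
Let coef_far n g r (h : R -> R) V : E n g -> measurable (V : set (borel B)) ->
  (forall n g, E n g ->
            inner nu (qrep a nu g constant1) (cindic [set b | r <= d b (e n g)])
              / harish_chandra a nu g <= (h (L g))%:C) ->
  ~ thick d V r (e n g) -> coefJ (\1_setT) (\1_V) g / Xi g <= h (L g).
Proof.
move=> Eg mV hh nV; have [d0 d00 dC _ _] := dB.
have := hh _ _ Eg; rewrite harish_chandra_coef// lecR; apply: le_trans.
rewrite ler_wpM2r ?invr_ge0 ?(ltW (Xi_gt0 qi g))//.
apply: coefJ_indic_le => //; first exact: measurable_far.
move=> b Vb; rewrite /= leNgt; apply/negP => bx; apply: nV; exists b => //.
by rewrite dC.
Qed.

Let tav_upper_pointwise n g r (h : R -> R) V W : E n g ->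
  measurable (V : set (borel B)) -> measurable (W : set (borel B)) ->
  (forall s, 0 <= s -> 0 <= h s) ->
  (forall n g, E n g ->
            inner nu (qrep a nu g constant1) (cindic [set b | r <= d b (e n g)])
              / harish_chandra a nu g <= (h (L g))%:C) ->
  coefJ (\1_V) (\1_W) g / Xi g <=
    \1_(thick d V r) (e n (g^-1)%g) * \1_(thick d W r) (e n g) + h (L g).
Proof.
move=> Eg mV mW h0 hh.
have X0 := Xi_gt0 qi g.
have [_ [L0 _ _ _ [LV _]]] := lenL.
have hL : 0 <= h (L g) by rewrite h0.
have J1 : coefJ (\1_V) (\1_W) g / Xi g <= 1.
  by rewrite ler_pdivrMr// mul1r -coefJ_indicTT; exact: coefJ_indic_le.
have EgV : E n (g^-1)%g by rewrite EV; exists g.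
(* For the first argument the coefficient is flipped to [g^-1], which lies in [E n], has the same
   length and the same [Xi]; then [coef_far] applies at [g^-1]. *)
have [eV|neV] := pselect (thick d V r (e n (g^-1)%g)); last first.
  rewrite -[leLHS]add0r lerD// ?mulr_ge0//.
  have := coef_far EgV mV hh neV; rewrite LV Xi_inv//; apply: le_trans.
  rewrite ler_wpM2r ?invr_ge0 ?(ltW X0)// -coefJ_indic_sym//.
  exact: coefJ_indic_le.
have [eW|neW] := pselect (thick d W r (e n g)); last first.
  rewrite -[leLHS]add0r lerD// ?mulr_ge0//.
  have := coef_far Eg mW hh neW; apply: le_trans.
  rewrite ler_wpM2r ?invr_ge0 ?(ltW X0)//.
  exact: coefJ_indic_le.
by rewrite !indicE !mem_set// mul1r (le_trans J1)// lerDl.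
Qed.

(** The error [h (L g)] is split at [L g = s]. Below it is at most [h 0], on a relatively compact
    set of finite volume, which is negligible once divided by the volume of [E n]; above it is at
    most [h s]. *)
Let tav_upper n r (h : R -> R) s U V W : 0 <= s ->
  measurable (U : set (borel B)) ->
  measurable (V : set (borel B)) -> measurable (W : set (borel B)) ->
  (forall s, 0 <= s -> 0 <= h s) ->
  (forall s t, 0 <= s -> s <= t -> h t <= h s) ->
  (forall n g, E n g ->
            inner nu (qrep a nu g constant1) (cindic [set b | r <= d b (e n g)])
              / harish_chandra a nu g <= (h (L g))%:C) ->
  ((tav n U V W)%:E <= ((vol mu (E n))^-1)%:E *
       \int[mu]_(g in E n) (\1_(thick d V r) (e n (g^-1)%g) * \1_(U `&` thick d W r) (e n g))%:E
     + ((vol mu (E n))^-1 * (h 0 * fine (mu [set g | (L g <= s)%R])) + h s)%:E)%E.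
Proof.
move=> s0 mU mV mW h0 hni hh.
have [mL [L0 _ Lpre _ [LV _]]] := lenL.
have mVr : measurable (thick d V r : set (borel B)) by apply: open_borel; exact: open_thick.
have mWr : measurable (U `&` thick d W r : set (borel B)).
  by apply: (@measurableI _ (borel B)) => //; apply: open_borel; exact: open_thick.
pose S : set (borel G) := [set g | L g <= s].
have mS : measurable S.
  have -> : S = setT `&` L @^-1` `]-oo, s].
    by rewrite setTI; apply/seteqP; split => g /=; rewrite in_itv.
  exact: mL.
have Soo : (mu S < +oo)%E := haar_precompact lh mS (Lpre s).
have menV : measurable_fun (E n : set (borel G)) (fun g : borel G => e n (g^-1)%g : borel B).
  apply: (@measurable_comp _ _ _ (borel G) (borel G) (borel B) (E n)) => //.
  - by move=> _ [g Eg <-]; rewrite EV; exists g.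
  - by apply: measurable_funTS; exact: measurable_invg.
have men : measurable_fun (E n : set (borel G)) (fun g : borel G => e n g : borel B) := @me n.
pose X1 (g : borel G) := (\1_(thick d V r) (e n (g^-1)%g) * \1_(U `&` thick d W r) (e n g) : R).
have mX1 : measurable_fun (E n : set (borel G)) (X1 : borel G -> R).
  apply: measurable_funM.
  - exact: (measurableT_comp (measurable_indic mVr) menV).
  - exact: (measurableT_comp (measurable_indic mWr) men).
have v0 : 0 <= (vol mu (E n))^-1 by rewrite invr_ge0 fine_ge0.
have le1 : (\int[mu]_(g in E n) (\1_U (e n g) * (coefJ (\1_V) (\1_W) g / Xi g))%:E <=
  \int[mu]_(g in E n) (X1 g)%:E + ((h 0)%:E * mu S + (h s)%:E * mu (E n)))%E.
  apply: (@le_trans _ _ (\int[mu]_(g in E n) ((X1 g)%:E + ((h 0)%:E * (\1_S g)%:E + (h s)%:E)))%E).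
    apply: ge0_le_integral_nomeas => g Eg.
      rewrite lee_fin !mulr_ge0// ?coefJ_indic_ge0// invr_ge0 ltW//.
      exact: Xi_gt0.
    rewrite -EFinM -!EFinD lee_fin.
    have hL : h (L g) <= h 0 * \1_S g + h s.
      rewrite indicE; have [gS|gS] := boolP (g \in S).
        by rewrite mulr1 (le_trans (hni 0 (L g) _ (L0 g)))// lerDl h0.
      rewrite mulr0 add0r hni//; apply: ltW; rewrite ltNge; apply/negP => gs.
      by move/negP: gS; apply; rewrite inE.
    have := tav_upper_pointwise Eg mV mW h0 hh => J.
    rewrite /X1 [\1_(U `&` _) _]indicE in_setI.
    rewrite [\1_U _]indicE; case: (_ \in U) => /=; last first.
      by rewrite mul0r mulr0 add0r addr_ge0 ?h0// mulr_ge0// h0.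
    rewrite mul1r (le_trans J)// indicE.
    by rewrite lerD2l.
  have mE' := mE n.
  rewrite ge0_integralD//; last 4 first.
  - by move=> g _; rewrite lee_fin mulr_ge0.
  - exact/measurable_EFinP.
  - by move=> g _; rewrite -EFinM -EFinD lee_fin addr_ge0 ?h0// mulr_ge0// h0.
  - apply: emeasurable_funD => //; apply: measurable_funeM; apply/measurable_EFinP.
    exact: measurable_indic.
  rewrite leeD2l// ge0_integralD//; last 3 first.
  - by move=> g _; rewrite mule_ge0// lee_fin h0.
  - by apply: measurable_funeM; apply/measurable_EFinP; exact: measurable_indic.
  - by move=> g _; rewrite lee_fin h0.
  rewrite integral_cst// leeD2r// ge0_integralZl//; last 2 first.
  - by apply/measurable_EFinP; exact: measurable_indic.
  - by rewrite lee_fin h0.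
  rewrite integral_indic// lee_wpmul2l// ?lee_fin ?h0//.
  by apply: le_measure; rewrite ?inE//; exact: measurableI.
have X1fin : (\int[mu]_(g in E n) (X1 g)%:E)%E \is a fin_num.
  rewrite ge0_fin_numE; last by apply: integral_ge0 => g _; rewrite lee_fin mulr_ge0.
  apply: (@le_lt_trans _ _ (\int[mu]_(g in E n) (cst 1%E) g)%E); last first.
    by rewrite integral_cst// mul1e Eoo.
  apply: ge0_le_integral_nomeas => g _; first by rewrite lee_fin mulr_ge0.
  by rewrite lee_fin /X1 !indicE; do 2 case: (_ \in _); rewrite ?mulr1 ?mulr0.
have Ef : mu (E n) = (vol mu (E n))%:E by rewrite /vol fineK// ge0_fin_numE.
have Sf : mu S = (fine (mu S))%:E by rewrite fineK// ge0_fin_numE.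
move: le1; rewrite -[X in (_ <= X + _)%E]fineK// Ef Sf -!EFinM -!EFinD => le1.
rewrite -[X in (_ <= _ * X + _)%E]fineK// -EFinM -EFinD lee_fin /tavg.
set T := fine _ in le1 *.
set I := \int[mu]_(g in E n) (\1_U (e n g) * _).
have le2 : I <= T + (h 0 * fine (mu S) + h s * vol mu (E n)).
  rewrite -lee_fin; apply: (le_trans _ le1); rewrite fineK// ge0_fin_numE.
    by apply: (le_lt_trans le1); rewrite ltry.
  apply: integral_ge0 => g _.
  by rewrite lee_fin !mulr_ge0// ?coefJ_indic_ge0// invr_ge0 ltW// Xi_gt0.
rewrite (le_trans (ler_wpM2l v0 le2))//= !mulrDr !addrA lerD2l.
rewrite mulrCA -[leRHS]mulr1 ler_wpM2l ?h0//.
have [->|vn0] := eqVneq (vol mu (E n)) 0; first by rewrite mulr0.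
by rewrite mulVf.
Qed.

Local Notation p A := (fine (nu A)).

Let pE (A : set (borel B)) : measurable A -> nu A = (p A)%:E.
Proof. by move=> mA; rewrite fineK// fin_num_measure. Qed.

Let p_ge0 (A : set (borel B)) : 0 <= p A.
Proof. by rewrite fine_ge0. Qed.

Let p_le1 (A : set (borel B)) : measurable A -> p A <= 1.
Proof. by move=> mA; rewrite -lee_fin -pE//; exact: probability_le1. Qed.

Let pS (A A' : set (borel B)) : measurable A -> measurable A' -> A `<=` A' -> p A <= p A'.
Proof.
by move=> mA mA' AA; rewrite -lee_fin -!pE//; apply: le_measure; rewrite ?inE.
Qed.

Let pU_le (A A' : set (borel B)) : measurable A -> measurable A' -> p (A `|` A') <= p A + p A'.
Proof.
move=> mA mA'; rewrite -lee_fin EFinD -!pE//; last exact: measurableU.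
exact: measureU2.
Qed.

Let pC (A : set (borel B)) : measurable A -> p (~` A) = 1 - p A.
Proof.
move=> mA; apply: EFin_inj; rewrite -pE; last exact: measurableC.
by rewrite EFinB -pE// probability_setC.
Qed.

Let vol_near (x : R) : \forall n \near \oo, x <= vol mu (E n).
Proof.
have /cvgeyPge/(_ x) := volE_oo; apply: filterS => n.
by rewrite -lee_fin /vol fineK// ge0_fin_numE.
Qed.

Let tav_limsup U V W (eps : R) : 0 < eps ->
  continuity_set nu U -> continuity_set nu V -> continuity_set nu W ->
  \forall n \near \oo, tav n U V W <= p (U `&` W) * p V + eps.
Proof.
move=> eps0 cU cV cW.
have [mU _] := cU; have [mV _] := cV; have [mW W0] := cW.
(* Six errors [eta] occur: three from the product of the two perturbed measures, one from the
   limsup, and two from the split of [h (L g)]. The product estimate needs [eta <= 1]. *)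
pose eta := Num.min 1 (eps / 6).
have eta0 : 0 < eta by rewrite lt_min ltr01 divr_gt0.
have eta1 : eta <= 1 by rewrite ge_min lexx.
have etae : 6 * eta <= eps by rewrite mulrC -ler_pdivlMr// ge_min lexx orbT.
have [d1 d10 V1] := thick_measure_cvg nu dB V eta0.
have [d2 d20 W1] := thick_measure_cvg nu dB W eta0.
have [|r [/andP[r0 rd] cVr cWr]] := @thick_choice _ _ nu _ dB V W (Num.min d1 d2).
  by rewrite lt_min d10.
move: rd; rewrite lt_min => /andP[/V1 {}V1 /W1 {}W1].
have [h [h0 hni hoo hh]] := concentration r0.
have [s [s0 hs]] : exists s, 0 <= s /\ h s <= eta.
  have /cvgrPdist_le/(_ _ eta0)[M [_ hM]] := hoo.
  exists (`|M| + 1); split; first by rewrite addr_ge0.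
  have Mlt : M < `|M| + 1 by rewrite (le_lt_trans (ler_norm _))// ltrDl.
  by have := hM _ Mlt; rewrite sub0r normrN (@ger0_norm _ (h _))// h0.
have [mVr _] := cVr; have [mWr _] := cWr.
have cUW := continuity_setI cU cWr; have [mUW _] := cUW.
have mclV := measurable_closure V; have mclW := measurable_closure W.
have pV : p (thick d V r) <= p V + eta.
  have -> : p V = p (closure V) by rewrite (continuity_set_closure cV).
  have mD : measurable (thick d V r `\` closure V : set (borel B)) by exact: measurableD.
  apply: (@le_trans _ _ (p (closure V `|` (thick d V r `\` closure V)))).
    apply: pS => //; first exact: measurableU.
    by move=> b bV; have [?|?] := pselect (closure V b); [left|right].
  rewrite (le_trans (pU_le _ _))// lerD2l -lee_fin -pE//.
(* What thickening adds to [W] lies in the null set [boundary W] or outside the closure of [W],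
   where [thick_measure_cvg] applies. *)
have pW : p (U `&` thick d W r) <= p (U `&` W) + eta.
  have mD : measurable (thick d W r `\` closure W : set (borel B)) by exact: measurableD.
  have mb := measurable_boundary W.
  have mUW' : measurable (U `&` W : set (borel B)) by exact: (@measurableI _ (borel B)).
  have mbD : measurable (boundary W `|` (thick d W r `\` closure W) : set (borel B)).
    exact: measurableU.
  apply: (@le_trans _ _ (p ((U `&` W) `|` (boundary W `|` (thick d W r `\` closure W))))).
    apply: pS => //; first exact: measurableU.
    move=> b [Ub bW]; have [clb|nclb] := pselect (closure W b); last by right; right.
    have [Wb|nWb] := pselect (W b); [by left|right; left].
    by split => // /interior_subset.
  rewrite (le_trans (pU_le _ _))// lerD2l (le_trans (pU_le _ _))//.
  have -> : p (boundary W) = 0 by rewrite W0.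
  by rewrite add0r -lee_fin -pE.
have lim2 := independence cVr cUW.
rewrite (pE mVr) (pE mUW) -EFinM in lim2.
have near2 := limn_esup_near_lt lim2 eta0.
pose K := h 0 * fine (mu [set g | (L g <= s)%R]).
(* Volume at least 1 makes the division legitimate; volume at least [K / eta] makes the contribution
   of short elements at most [eta]. *)
have near3 := vol_near (Num.max 1 (K / eta)).
have pp : p (thick d V r) * p (U `&` thick d W r) <= p (U `&` W) * p V + 3 * eta.
  apply: ler_pM_perturb => //; rewrite ?p_ge0 ?p_le1//.
  exact: (@measurableI _ (borel B)).
apply: filterS2 near2 near3 => n n2; rewrite ge_max => /andP[v1 vK].
rewrite -lee_fin.
apply: (le_trans (tav_upper n s0 mU mV mW h0 hni hh)).
apply: (@le_trans _ _ ((p (thick d V r) * p (U `&` thick d W r) + eta)%:E + (eta + eta)%:E)%E).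
  apply: leeD; first exact: ltW.
  rewrite lee_fin lerD// -/K mulrC ler_pdivrMr; last exact: lt_le_trans v1.
  by rewrite mulrC -ler_pdivrMr.
by rewrite -EFinD lee_fin; lra.
Qed.

Let tav_indicC_1 n U V W : measurable (U : set (borel B)) ->
  measurable (V : set (borel B)) -> measurable (W : set (borel B)) ->
  tav n U V W = tav n setT V W - tav n (~` U) V W.
Proof.
move=> mU mV mW; have [w [M [mw w0 wM wE]]] := weight n.
have mCU : measurable (~` U : set (borel B)) by exact: measurableC.
have := tavgZD_1 scG scB qi (mE n) (Eoo n) (EV n) muV (@me n) mw w0 wM wE (-1)
  (bmeas_indic mCU) (bmeas_indic (@measurableT _ (borel B)))
  (bmeas_L2r nu (bmeas_indic mV)) (bmeas_L2r nu (bmeas_indic mW)).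
by rewrite indic_setC_linear mulN1r addrC.
Qed.

Let tav_indicC_2 n U V W : measurable (U : set (borel B)) ->
  measurable (V : set (borel B)) -> measurable (W : set (borel B)) ->
  tav n U V W = tav n U setT W - tav n U (~` V) W.
Proof.
move=> mU mV mW; have [w [M [mw w0 wM wE]]] := weight n.
have mCV : measurable (~` V : set (borel B)) by exact: measurableC.
have := tavgZD_2 scG scB qi (mE n) (Eoo n) (EV n) muV (@me n) mw w0 wM wE (-1)
  (bmeas_indic mU)
  (bmeas_L2r nu (bmeas_indic mCV)) (bmeas_L2r nu (bmeas_indic (@measurableT _ (borel B))))
  (bmeas_L2r nu (bmeas_indic mW)).
by rewrite indic_setC_linear mulN1r addrC.
Qed.

Let tav_indicC_3 n U V W : measurable (U : set (borel B)) ->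
  measurable (V : set (borel B)) -> measurable (W : set (borel B)) ->
  tav n U V W = tav n U V setT - tav n U V (~` W).
Proof.
move=> mU mV mW; have [w [M [mw w0 wM wE]]] := weight n.
have mCW : measurable (~` W : set (borel B)) by exact: measurableC.
have := tavgZD_3 scG scB qi (mE n) (Eoo n) (EV n) muV (@me n) mw w0 wM wE (-1)
  (bmeas_indic mU) (bmeas_L2r nu (bmeas_indic mV))
  (bmeas_L2r nu (bmeas_indic mCW)) (bmeas_L2r nu (bmeas_indic (@measurableT _ (borel B)))).
by rewrite indic_setC_linear mulN1r addrC.
Qed.

Let tavTTT n : 0 < vol mu (E n) -> tav n setT setT setT = 1.
Proof.
move=> v0; rewrite /tavg.
rewrite (@eq_Rintegral _ _ _ mu _ (cst 1)); last first.
  move=> g _ /=; rewrite indicE in_setT mul1r coefJ_indicTT divff// gt_eqF//.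
  exact: Xi_gt0.
have mEn : measurable (E n : set (borel G)) := mE n.
by rewrite Rintegral_cst// mul1r mulVf// gt_eqF.
Qed.

Lemma tavg_indic_cvg U V W :
  continuity_set nu U -> continuity_set nu V -> continuity_set nu W ->
  tav n U V W @[n --> \oo] --> p (U `&` W) * p V.
Proof.
move=> cU cV cW; apply/cvgrPdist_le => eps eps0.
have e30 : 0 < eps / 3 by rewrite divr_gt0.
have [mU _] := cU; have [mV _] := cV; have [mW _] := cW.
have cT := continuity_setT nu.
have mT : measurable ([set: B] : set (borel B)) by [].
have mCU := @measurableC _ (borel B) _ mU.
have mCV := @measurableC _ (borel B) _ mV.
have mCW := @measurableC _ (borel B) _ mW.
have n1 := tav_limsup e30 cU cV cW.
have n2 := tav_limsup e30 (continuity_setC cU) cT cT.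
have n3 := tav_limsup e30 cU (continuity_setC cV) cT.
have n4 := tav_limsup e30 cU cV (continuity_setC cW).
have n5 := vol_near 1.
have pT : p [set: B] = 1 by rewrite probability_setT.
have pUW : p (U `&` ~` W) = p U - p (U `&` W).
  rewrite -setDE.
  have mUW := @measurableI _ (borel B) _ _ mU mW.
  apply: EFin_inj; rewrite -pE; last exact: measurableD.
  by rewrite measureD// ?EFinB -?pE//; rewrite -ge0_fin_numE// fin_num_measure.
near=> n.
have vn : 0 < vol mu (E n) by apply: (@lt_le_trans _ _ 1) => //; near: n.
have := tavTTT vn.
have := tav_indicC_1 n mU mT mT.
have := tav_indicC_2 n mU mV mT.
have := tav_indicC_3 n mU mV mW.
have m1 : tav n U V W <= p (U `&` W) * p V + eps / 3 by near: n.
have m2 : tav n (~` U) setT setT <= p (~` U `&` setT) * p [set: B] + eps / 3 by near: n.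
have m3 : tav n U (~` V) setT <= p (U `&` setT) * p (~` V) + eps / 3 by near: n.
have m4 : tav n U V (~` W) <= p (U `&` ~` W) * p V + eps / 3 by near: n.
rewrite !setIT in m2 m3; rewrite pT mulr1 (pC mU) in m2; rewrite (pC mV) in m3.
rewrite pUW in m4.
move=> e1 e2 e3 e4.
rewrite e4 in e3; exact: (partition_squeeze eps0 m1 m2 m3 m4 e1 e2 e3).
Unshelve. all: by end_near. Qed.

End asymptotic_independence.

(** * Approximation by continuity sets *)

Section approximation.
Context {R : realType} {B : ptopologicalType}.
Variables (nu : probability (borel B) R) (d : B -> B -> R).
Hypothesis dB : metric_inducing_topology d.

Definition approximable (A : set (borel B)) := measurable A /\
  forall eps : R, 0 < eps -> exists2 U : set (borel B), continuity_set nu U &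
    (nu ((A `\` U) `|` (U `\` A)) <= eps%:E)%E.

Let mcont (U : set (borel B)) : continuity_set nu U -> measurable U.
Proof. by case. Qed.

Let mdiff (A U : set (borel B)) : measurable A -> measurable U ->
  measurable ((A `\` U) `|` (U `\` A)).
Proof. by move=> mA mU; apply: measurableU; exact: measurableD. Qed.

(** An open set is approximated from inside by the points that stay away from its complement. The
    error lies in a thickening of the closed complement, minus that complement. *)
Lemma approximable_open (O : set B) : open O -> approximable O.
Proof.
move=> oO; split; first exact: open_borel.
move=> eps eps0.
have [delta d0 Od] := thick_measure_cvg nu dB (~` O) eps0.
have [r [/andP[r0 rd] cr _]] := @thick_choice _ _ nu _ dB (~` O) (~` O) _ d0.
exists (~` thick d (~` O) r); first exact: continuity_setC.
have cO : closed (~` O) by exact: open_closedC.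
have := Od r rd; rewrite -(closure_id (~` O)).1//.
apply: le_trans; apply: le_measure; rewrite ?inE.
- apply: mdiff; first exact: open_borel.
  by apply: (@measurableC _ (borel B)); apply: open_borel; exact: open_thick.
- apply: (@measurableD _ (borel B)); first by apply: open_borel; exact: open_thick.
  by apply: (@measurableC _ (borel B)); exact: open_borel.
- move=> b [[Ob]|[nt nO]].
    by rewrite /= => nnt; split; [exact: contrapT|].
  exfalso; apply: nt; exists b => //.
  by have [_ d00 _ _ _] := dB; rewrite (d00 b b).2.
Qed.

Lemma approximable_setC A : approximable A -> approximable (~` A).
Proof.
move=> [mA hA]; split; first exact: measurableC.
move=> eps /hA[U cU leU]; exists (~` U); first exact: continuity_setC.
rewrite (_ : _ `|` _ = (A `\` U) `|` (U `\` A))//.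
rewrite !setDE !setCK setUC [~` U `&` A]setIC.
by congr (_ `|` _); rewrite setIC.
Qed.

Lemma approximable_bigcup (A : (set (borel B))^nat) :
  (forall n, approximable (A n)) -> approximable (\bigcup_n A n).
Proof.
move=> hA; have mA n : measurable (A n) by have [] := hA n.
have mbA : measurable (\bigcup_n A n) by exact: bigcupT_measurable.
split => // eps eps0.
have e20 : 0 < eps / 2 by rewrite divr_gt0.
pose S n := \big[setU/set0]_(i < n) A i.
have mS n : measurable (S n) by exact: bigsetU_measurable.
have [n nS] : exists n, (nu (\bigcup_n A n `\` S n) <= (eps / 2)%:E)%E.
  pose F n := \bigcup_n A n `\` S n.
  have mF n : measurable (F n) by exact: measurableD.
  have F0 : \bigcap_n F n = set0.
    rewrite -subset0 => b bF; have [[i _ Ai] _] := bF 0%N I.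
    have [_] := bF i.+1 I; apply; rewrite /S -bigcup_mkord.
    by exists i => //=.
  have : nu \o F @ \oo --> nu (\bigcap_n F n).
    apply: nonincreasing_cvg_mu => //.
    - by rewrite -ge0_fin_numE// fin_num_measure.
    - by rewrite F0.
    - move=> m k mk; apply/subsetPset; apply: setDS; exact: subset_bigsetU.
  rewrite F0 measure0 => /fine_cvgP[_ /cvgrPdist_le /(_ _ e20)[n _ /(_ n (leqnn _)) nF]].
  exists n; rewrite -/(F n) -(fineK (fin_num_measure nu _ (mF n))) lee_fin.
  by move: nF; rewrite /= sub0r normrN ger0_norm ?fine_ge0.
(* Half of [eps] pays for the tail of the union and half is shared by the [n] remaining sets.
   Dividing by [n + 1] also covers [n = 0]. *)
have en0 : 0 < eps / 2 / n.+1%:R by rewrite divr_gt0.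
have {hA} hU i : exists U : set (borel B), continuity_set nu U /\
    (nu ((A i `\` U) `|` (U `\` A i)) <= (eps / 2 / n.+1%:R)%:E)%E.
  by have [_ /(_ _ en0)[U cU leU]] := hA i; exists U.
have [U hU'] := choice hU.
exists (\big[setU/set0]_(i < n) U i).
  elim/big_ind : _ => //; [exact: continuity_set0|exact: continuity_setU|].
  by move=> i _; have [] := hU' i.
have mU i : measurable (U i) by apply: mcont; have [] := hU' i.
have mUn : measurable (\big[setU/set0]_(i < n) U i) by exact: bigsetU_measurable.
pose D i := (A i `\` U i) `|` (U i `\` A i).
have mD i : measurable (D i) by exact: mdiff.
have mDn : measurable (\big[setU/set0]_(i < n) D i) by exact: bigsetU_measurable.
have mR : measurable (\bigcup_n A n `\` S n) by exact: measurableD.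
apply: (@le_trans _ _ (nu ((\bigcup_n A n `\` S n) `|` \big[setU/set0]_(i < n) D i))).
  apply: le_measure; rewrite ?inE.
  - exact: mdiff.
  - exact: measurableU.
  - move=> b [[Ab nUb]|[Ub nAb]].
      have [Sb|nSb] := pselect (S n b); last by left.
      right; move: Sb nUb; rewrite /S -!bigcup_mkord => -[i /= ni Aib] nUb.
      by exists i => //; left; split => // Uib; apply: nUb; exists i.
    right; move: Ub; rewrite -!bigcup_mkord => -[i /= ni Uib].
    by exists i => //; right; split => // Aib; apply: nAb; exists i.
rewrite (le_trans (measureU2 nu mR mDn))//.
have -> : eps%:E = ((eps / 2)%:E + (eps / 2)%:E)%E by rewrite -EFinD -splitr.
apply: leeD => //.
apply: (@le_trans _ _ (\sum_(i < n) nu (D i))%E).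
  elim: n {nS en0 hU hU' mUn mDn mR} => [|m IH]; first by rewrite !big_ord0 measure0.
  rewrite !big_ord_recr/=; apply: (le_trans (measureU2 _ _ _)) => //.
    exact: bigsetU_measurable.
  by apply: leeD.
apply: (@le_trans _ _ (\sum_(i < n) (eps / 2 / n.+1%:R)%:E)%E).
  by apply: lee_sum => i _; have [] := hU' i.
rewrite sumEFin lee_fin sumr_const card_ord.
have -> : (eps / 2 / n.+1%:R) *+ n = eps / 2 * n%:R / n.+1%:R by rewrite -mulr_natr mulrAC.
by rewrite ler_pdivrMr// ler_wpM2l ?ler_nat// ltW.
Qed.

(** The approximable sets form a sigma-algebra that contains the open sets. *)
Lemma approximable_measurable A : measurable A -> approximable A.
Proof.
move=> mA; suff : <<s @open B >> `<=` approximable by exact.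
apply: smallest_sub; last by move=> O; exact: approximable_open.
split.
- by split => // eps eps0; exists set0; [exact: continuity_set0|]; rewrite setDv setU0 measure0 lee_fin ltW.
- by move=> D hD; rewrite setTD; exact: approximable_setC.
- by move=> D hD; exact: approximable_bigcup.
Qed.

Section induction.
Variable P : (borel B -> R) -> Prop.
Hypothesis Pind : forall U, continuity_set nu U -> P (\1_U).
Hypothesis PZD : forall (c : R) f g, L2r nu f -> L2r nu g -> P f -> P g ->
  P (fun x => c * f x + g x).
Hypothesis Pclosed : forall f, L2r nu f -> (forall eps : R, 0 < eps ->
  exists g, [/\ L2r nu g, P g & sqnorm nu (fun x => f x - g x) <= eps]) -> P f.

Lemma L2r_indic (A : set (borel B)) : measurable A -> L2r nu (\1_A : borel B -> R).
Proof.
by move=> mA; apply: bmeas_L2r; exact: bmeas_indic.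
Qed.

Let P_indic (A : set (borel B)) : measurable A -> P (\1_A).
Proof.
move=> mA; apply: Pclosed; first exact: L2r_indic.
move=> eps eps0; have [_ /(_ _ eps0)[U cU leU]] := approximable_measurable mA.
have mU := mcont cU.
exists (\1_U); split; [exact: L2r_indic|exact: Pind|].
rewrite -lee_fin; apply: le_trans leU.
have mD := mdiff mA mU.
rewrite /sqnorm /Rintegral (_ : (\int[nu]_x _ = nu ((A `\` U) `|` (U `\` A)))%E).
  by rewrite fineK// fin_num_measure.
transitivity (\int[nu]_x (\1_((A `\` U) `|` (U `\` A)) x)%:E)%E; last by rewrite integral_indic// setIT.
apply: eq_integral => b _; congr EFin.
rewrite !indicE in_setU !in_setD.
by case: (b \in A); case: (b \in U) => /=; ring.
Qed.

Let P_sum (I : Type) (r : seq I) (c : I -> R) (f : I -> borel B -> R) :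
  (forall i, L2r nu (f i)) -> (forall i, P (f i)) ->
  P (fun x => \sum_(i <- r) c i * f i x) /\ L2r nu (fun x => \sum_(i <- r) c i * f i x).
Proof.
move=> Lf Pf; elim: r => [|i r [IH1 IH2]].
  have -> : (fun x => \sum_(i <- [::]) c i * f i x) = \1_set0.
    by apply/funext => x; rewrite big_nil indic0.
  by split; [exact: P_indic|exact: L2r_indic].
have -> : (fun x => \sum_(j <- i :: r) c j * f j x) =
          (fun x => c i * f i x + \sum_(j <- r) c j * f j x).
  by apply/funext => x; rewrite big_cons.
by split; [exact: PZD|exact: L2rZD].
Qed.

Import HBNNSimple.

Let P_nnsfun (f : {nnsfun borel B >-> R}) : P f /\ L2r nu f.
Proof.
have -> : (f : borel B -> R) = (fun x => \sum_(y <- fset_set (range f)) y * \1_(f @^-1` [set y]) x).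
  by apply/funext => x; rewrite {1}(fimfunE f) fsbig_finite.
apply: P_sum => y.
- exact: L2r_indic.
- exact: P_indic.
Qed.

(** The approximating simple functions satisfy [0 <= g n <= f], so the squared errors are dominated
    by [f ^ 2] and tend to 0 in the mean. *)
Let P_ge0 f : L2r nu f -> (forall x, 0 <= f x) -> P f.
Proof.
move=> Lf f0; have [mf fi] := Lf; apply: Pclosed => // eps eps0.
have mEf : measurable_fun setT (EFin \o f) by exact/measurable_EFinP.
pose g := nnsfun_approx measurableT mEf.
have gcvg x : g n x @[n --> \oo] --> f x.
  have /fine_cvgP[_] // : ((g n x)%:E @[n --> \oo] --> (EFin \o f) x)%E.
  by apply: (cvg_nnsfun_approx measurableT mEf) => // y _; rewrite lee_fin.
have gf n x : g n x <= f x.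
  rewrite -(cvg_lim (@Rhausdorff R) (gcvg x)).
  apply: (nondecreasing_cvgn_le (u_ := fun n => g n x)) => //; last by apply/cvg_ex; exists (f x).
  by move=> m k mk; have /lefP := nd_nnsfun_approx measurableT mEf mk; exact.
have : (fun n => \int[nu]_x ((f x - g n x) ^+ 2)%:E)%E @ \oo --> (\int[nu]_x 0)%E.
  have mfg n : measurable_fun setT (fun x => ((f x - g n x) ^+ 2)%:E).
    by apply/measurable_EFinP; apply: measurable_funX; exact: measurable_funB.
  have [] := @dominated_convergence _ _ _ nu setT measurableT
    (fun n x => ((f x - g n x) ^+ 2)%:E) (cst 0%E) (fun x => (f x ^+ 2)%:E) mfg.
  - exact: measurable_cst.
  - apply: aeW => x _; apply/cvg_EFin; first exact: nearW.
    have : (f x - g n x) ^+ 2 @[n --> \oo] --> (f x - f x) ^+ 2.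
      by apply: cvgM; apply: cvgB => //; exact: cvg_cst.
    by rewrite subrr expr0n.
  - exact: fi.
  - apply: aeW => x n _ /=; rewrite lee_fin ger0_norm ?sqr_ge0//.
    rewrite ler_pXn2r ?nnegrE ?subr_ge0 ?gf//.
    by rewrite gerBl.
  - by move=> _ _.
rewrite integral0 => /fine_cvgP[_ /cvgrPdist_le /(_ _ eps0)[n _ /(_ n (leqnn _)) nF]].
exists (g n); have [Pg Lg] := P_nnsfun (g n); split => //.
by move: nF; rewrite /= sub0r normrN ger0_norm//; exact: sqnorm_ge0.
Qed.

(** Density of the span of continuity indicators in real [L^2], put as an induction principle. It is
    applied once to each of the two [L^2] arguments of the averages. *)
Lemma L2r_ind f : L2r nu f -> P f.
Proof.
move=> Lf; have [mf fi] := Lf.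
pose fp x := Num.max (f x) 0; pose fn x := Num.max (- f x) 0.
have Lp : L2r nu fp.
  have mfp : measurable_fun setT fp by exact: measurable_maxr.
  split => //; apply: le_integrable fi => //.
    by apply/measurable_EFinP; exact: measurable_funX.
  move=> x _ /=; rewrite lee_fin !ger0_norm ?sqr_ge0// /fp.
  by case: (leP (f x) 0) => // _; rewrite expr0n/= sqr_ge0.
have Ln : L2r nu fn.
  have mfn : measurable_fun setT fn by apply: measurable_maxr => //; exact: measurableT_comp.
  split => //; apply: le_integrable fi => //.
    by apply/measurable_EFinP; exact: measurable_funX.
  move=> x _ /=; rewrite lee_fin !ger0_norm ?sqr_ge0// /fn.
  by case: (leP (- f x) 0) => // _; rewrite ?sqrrN// expr0n/= sqr_ge0.
have -> : f = (fun x => -1 * fn x + fp x).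
  apply/funext => x; rewrite /fp /fn.
  have [f0|f0] := leP (f x) 0.
    by rewrite max_l ?oppr_ge0//; ring.
  by rewrite max_r; [ring|rewrite oppr_le0 ltW].
apply: PZD => //; apply: P_ge0 => // x; by rewrite le_max lexx orbT.
Qed.

End induction.
End approximation.

(** * The closed span of the indicators *)

Section normc_bounds.
Variable R : realType.
Implicit Types z : R[i].

Lemma Re_le_normc z : `|complex.Re z| <= Normc.normc z.
Proof.
case: z => x y /=; rewrite -sqrtr_sqr ler_wsqrtr//.
by rewrite lerDl sqr_ge0.
Qed.

Lemma Im_le_normc z : `|complex.Im z| <= Normc.normc z.
Proof.
case: z => x y /=; rewrite -sqrtr_sqr ler_wsqrtr//.
by rewrite lerDr sqr_ge0.
Qed.

Lemma normc_le_parts z : Normc.normc z <= `|complex.Re z| + `|complex.Im z|.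
Proof.
case: z => x y /=; have h0 : 0 <= `|x| + `|y| by rewrite addr_ge0.
rewrite -[leRHS](ger0_norm h0) -sqrtr_sqr ler_wsqrtr//.
rewrite -(real_normK (num_real x)) -(real_normK (num_real y)).
have := mulr_ge0 (normr_ge0 x) (normr_ge0 y); nra.
Qed.

Lemma cvg_complex (u : nat -> R[i]) (l : R[i]) :
  complex.Re (u n) @[n --> \oo] --> complex.Re l ->
  complex.Im (u n) @[n --> \oo] --> complex.Im l ->
  (u n : (R[i])^o) @[n --> \oo] --> (l : (R[i])^o).
Proof.
move=> /cvgrPdist_lt ur /cvgrPdist_lt ui; apply/cvgrPdist_lt => -[er ei].
(* In the order of [R[i]] a positive radius is a positive real number: its imaginary part is 0. *)
rewrite ltcE/= => /andP[/eqP -> e0].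
have e20 : 0 < er / 2 by rewrite divr_gt0.
near=> n.
have h1 : `|complex.Re l - complex.Re (u n)| < er / 2 by near: n; exact: ur.
have h2 : `|complex.Im l - complex.Im (u n)| < er / 2 by near: n; exact: ui.
rewrite [X in X < _](_ : _ = (Normc.normc (l - u n))%:C)//.
have key : Normc.normc (l - u n) < er.
  apply: (le_lt_trans (normc_le_parts _)); rewrite !partsE [ltRHS]splitr.
  exact: ltrD.
by rewrite ltcE/= eqxx.
Unshelve. all: by end_near. Qed.

(** Nested intervals: [u n - 2 C / 2^n] increases and [u n + 2 C / 2^n] decreases, so the supremum
    of the former is a limit that comes with its rate of convergence. *)
Lemma geometric_limit (u : R^nat) (C : R) : 0 <= C ->
  (forall n, `|u n.+1 - u n| <= C * 2^-1 ^+ n) ->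
  exists l, forall n, `|l - u n| <= 2 * C * 2^-1 ^+ n.
Proof.
move=> C0 hu.
pose v n := u n - 2 * C * 2^-1 ^+ n; pose w n := u n + 2 * C * 2^-1 ^+ n.
have step n : v n <= v n.+1 /\ w n.+1 <= w n.
  rewrite /v /w exprS; have := hu n; rewrite ler_norml => /andP[h1 h2].
  by split; lra.
have vw n : v n <= w n.
  by rewrite /v /w lerD2l ge0_cp// mulr_ge0 ?mulr_ge0// exprn_ge0.
have vnd n m : (n <= m)%N -> v n <= v m.
  apply: (@homo_leq _ v (fun x y => x <= y) (fun=> lexx _)); first exact: le_trans.
  by move=> k; have [] := step k.
have wni n m : (n <= m)%N -> w m <= w n.
  apply: (@homo_leq _ w (fun x y => y <= x) (fun=> lexx _)).
    by move=> y x z yx zy; exact: le_trans zy yx.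
  by move=> k; have [] := step k.
have vwm n m : v n <= w m.
  apply: (le_trans (vnd _ _ (leq_maxl n m))); apply: (le_trans (vw _)).
  exact: wni (leq_maxr n m).
exists (sup (range v)) => n; rewrite ler_norml.
have hs : has_sup (range v).
  by split; [exists (v 0%N); exists 0%N|exists (w 0%N) => _ [m _ <-]].
have h1 : v n <= sup (range v) by apply: ub_le_sup; [exact: hs.2|exists n].
have h2 : sup (range v) <= w n by apply: ge_sup; [exact: hs.1|move=> _ [m _ <-]].
move: h1 h2; rewrite /v /w => h1 h2; apply/andP; split; lra.
Qed.

End normc_bounds.

Section continuity_span_representatives.
Context {R : realType} {B : ptopologicalType}.
Variable nu : probability (borel B) R.
Implicit Types (f h : borel B -> R[i]).

(** An intrinsic description of [continuity_span], shown equivalent to it by the next lemmas. Unlike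
    the span, it is visibly stable under composition with any map, which is what truncation
    requires. *)
Definition simple_continuity h := (exists s : seq R[i], forall b, h b \in s) /\
  forall D : set R[i], continuity_set nu (h @^-1` D).

Lemma simple_continuity_span h : continuity_span nu h -> simple_continuity h.
Proof.
suff sub : continuity_span nu `<=` simple_continuity by exact: sub.
apply: smallest_sub; last first.
  move=> _ [U cU ->]; split.
    exists [:: 0; 1] => b; rewrite /cindic indicE; case: (_ \in _) => /=;
      by rewrite !inE eqxx ?orbT.
  move=> D; rewrite (_ : _ @^-1` D = (if `[< D 1 >] then U else set0) `|`
      (if `[< D 0 >] then ~` U else set0)); last first.
    apply/seteqP; split => b; rewrite /cindic /preimage/= indicE.
      case: (boolP (b \in U)) => [/set_mem|/negP] bU Db.
        by left; rewrite asboolT.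
      by right; rewrite asboolT// => /mem_set.
    by move=> []; case: asboolP => // D1 bU; [rewrite mem_set|rewrite memNset].
  apply: continuity_setU; case: asboolP => // _;
    [exact: continuity_set0|exact: continuity_setC|exact: continuity_set0].
split.
  split; first by exists [:: 0] => b; rewrite inE.
  move=> D; rewrite preimage_cst; case: ifPn => _; last exact: continuity_set0.
  by rewrite -setC0; apply: continuity_setC; exact: continuity_set0.
move=> c f {}h [[s fs] cf] [[t ht] ch]; split.
  exists [seq c * x + y | x <- s, y <- t] => b.
  exact: (allpairs_f (fun x y => c * x + y) (fs b) (ht b)).
move=> D.
rewrite (_ : _ @^-1` D = \big[setU/set0]_(x <- s) \big[setU/set0]_(y <- t)
   (if `[< D (c * x + y) >] then f @^-1` [set x] `&` h @^-1` [set y] else set0)).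
  elim/big_ind : _ => [|U V|x _]; [exact: continuity_set0|exact: continuity_setU|].
  elim/big_ind : _ => [|U V|y _]; [exact: continuity_set0|exact: continuity_setU|].
  case: asboolP => _; last exact: continuity_set0.
  by apply: continuity_setI.
apply/seteqP; split => b /=.
  move=> Db; rewrite -bigcup_seq; exists (f b); first exact: fs.
  rewrite -bigcup_seq; exists (h b); first exact: ht.
  by rewrite asboolT.
rewrite -bigcup_seq => -[x _]; rewrite -bigcup_seq => -[y _].
by case: asboolP => // Dxy [/= -> ->].
Qed.

Lemma linear_continuity_span : linear_subspace (continuity_span nu).
Proof.
split; first by move=> H [[H0 _] _].
move=> c f h sf sh H HH; have [[_ HZD] _] := HH.
by apply: HZD; [exact: sf|exact: sh].
Qed.

Lemma simple_continuity_in_span h : simple_continuity h -> continuity_span nu h.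
Proof.
move=> [[s hs] ch]; have [span0 spanZD] := linear_continuity_span.
have -> : h = (fun b => \sum_(x <- undup s) x * cindic (h @^-1` [set x]) b).
  apply/funext => b; rewrite (bigD1_seq (h b))/= ?mem_undup ?undup_uniq//.
  rewrite big1 ?addr0; last first.
    move=> x xh; rewrite /cindic indicE memNset ?mulr0//= => hx.
    by move: xh; rewrite hx eqxx.
  by rewrite /cindic indicE mem_set//= mulr1.
elim: (undup s) => [|x r IH].
  by rewrite (_ : (fun b => _) = cst 0)//; apply/funext => b; rewrite big_nil.
rewrite (_ : (fun b => _) = (fun b => x * cindic (h @^-1` [set x]) b +
    \sum_(y <- r) y * cindic (h @^-1` [set y]) b)); last first.
  by apply/funext => b; rewrite big_cons.
apply: spanZD => //; apply: sub_gen_smallest.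
by exists (h @^-1` [set x]).
Qed.

Lemma continuity_span_comp (theta : R[i] -> R[i]) h :
  continuity_span nu h -> continuity_span nu (fun b => theta (h b)).
Proof.
move=> /simple_continuity_span[[s hs] ch]; apply: simple_continuity_in_span; split.
  by exists (map theta s) => b; exact: map_f.
by move=> D; have := ch (theta @^-1` D).
Qed.

(** Approximants of [f] in the sup norm of [L^oo] are close to it only off null sets, so they need
    not converge everywhere. The repaired sequence [k n] converges uniformly at all points. *)
Lemma representative_exists f : Linfty_closure nu (continuity_span nu) f ->
  exists f0, representatives nu (continuity_span nu) f f0.
Proof.
move=> [_ _ hf]; have [span0 spanZD] := linear_continuity_span.
pose c n : R := 2^-1 ^+ n.
have c0 n : 0 < c n by rewrite exprn_gt0.
have /choice[h hP] n : exists h, continuity_span nu h /\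
    {ae nu, forall b, Normc.normc (f b - h b) <= c n}.
  have [h sh /ltW hh] := hf _ (c0 n); exists h; split => //.
  exact: ae_le_cnorm_oo hh.
(* Truncating the increments makes the sequence uniformly Cauchy, changes it
   only on a null set, and keeps it in the span. *)
pose theta n z : R[i] := if Normc.normc z <= 4 * c n then z else 0.
pose delta n b := theta n (h n.+1 b - h n b).
have sdelta n : continuity_span nu (delta n).
  apply: (continuity_span_comp (theta n)).
  have := spanZD (-1) _ _ (hP n).1 (hP n.+1).1.
  by congr (continuity_span nu _); apply/funext => b; rewrite mulN1r addrC.
pose k n b := h 0%N b + \sum_(i < n) delta i b.
have kS n b : k n.+1 b - k n b = delta n b.
  by rewrite /k big_ord_recr/=; ring.
have sk n : continuity_span nu (k n).
  elim: n => [|n IH].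
    by rewrite (_ : k 0%N = h 0%N); [exact: (hP _).1|apply/funext => b; rewrite /k big_ord0 addr0].
  have := spanZD 1 _ _ (sdelta n) IH.
  by congr (continuity_span nu _); apply/funext => b; rewrite mul1r -kS subrK.
have deltaC n b : Normc.normc (delta n b) <= 4 * c n.
  rewrite /delta /theta; case: ifPn => // _.
  by rewrite /= expr0n/= addr0 sqrtr0 mulr_ge0// ltW.
have /choice[lr lrP] b : exists l, forall n, `|l - complex.Re (k n b)| <= 2 * 4 * c n.
  apply: geometric_limit => // n; apply: le_trans (deltaC n b).
  by rewrite -kS; apply: le_trans (Re_le_normc _); rewrite !partsE.
have /choice[li liP] b : exists l, forall n, `|l - complex.Im (k n b)| <= 2 * 4 * c n.
  apply: geometric_limit => // n; apply: le_trans (deltaC n b).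
  by rewrite -kS; apply: le_trans (Im_le_normc _); rewrite !partsE.
pose f0 b := lr b +i* li b.
(* [16 = 8 + 8]: each part contributes twice the bound [4 * c n] on the increments. *)
have f0k n b : Normc.normc (f0 b - k n b) <= 16 * c n.
  apply: (le_trans (normc_le_parts _)); rewrite Re_addc Im_addc Re_oppc Im_oppc/=.
  have -> : 16 * c n = 2 * 4 * c n + 2 * 4 * c n by ring.
  by apply: lerD; [exact: lrP|exact: liP].
have cvgc (C : R) : 0 <= C -> forall eps : R, 0 < eps -> exists n, C * c n < eps.
  move=> C0 eps eps0; have : C * c n @[n --> \oo] --> C * 0.
    by apply: cvgMr; apply: cvg_expr; rewrite ger0_norm ?invr_ge0// invf_lt1 ?ltr1n.
  rewrite mulr0 => /cvgrPdist_lt/(_ _ eps0)[n _ /(_ n (leqnn _))].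
  by rewrite /= sub0r normrN ger0_norm ?(mulr_ge0 C0 (ltW (c0 n)))// => hn; exists n.
exists f0; split.
  move=> eps eps0; have [n hn] := cvgc 16 (ler0n _ 16) _ eps0.
  by exists (k n); [exact: sk|move=> b; exact: le_lt_trans (f0k n b) hn].
have ae_k : {ae nu, forall b n, Normc.normc (f b - h n b) <= c n}.
  by apply/ae_foralln => n; exact: (hP n).2.
apply: filterS ae_k => b hb.
(* At these points each part of the increment is at most [c n + c n / 2], so its modulus is at most
   [3 * c n]. This is below the threshold [4 * c n], and nothing is truncated. *)
have kh n : k n b = h n b.
  elim: n => [|n IH]; first by rewrite /k big_ord0 addr0.
  rewrite -[LHS](subrK (k n b)) kS IH /delta /theta ifT ?subrK//.
  apply: (le_trans (normc_le_parts _)).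
  have h1 := le_trans (Re_le_normc _) (hb n); have h2 := le_trans (Re_le_normc _) (hb n.+1).
  have h3 := le_trans (Im_le_normc _) (hb n); have h4 := le_trans (Im_le_normc _) (hb n.+1).
  have cS : c n.+1 = 2^-1 * c n by rewrite /c exprS.
  move: h1 h2 h3 h4; rewrite cS !partsE.
  have : 0 < c n by [].
  move: (c n) (complex.Re (f b)) (complex.Re (h n b)) (complex.Re (h n.+1 b))
    (complex.Im (f b)) (complex.Im (h n b)) (complex.Im (h n.+1 b)) => C x y z x' y' z' C0.
  rewrite !ler_norml => /andP[h1 h1'] /andP[h2 h2'] /andP[h3 h3'] /andP[h4 h4'].
  have : `|z - y| <= 3 / 2 * C by rewrite ler_norml; apply/andP; split; lra.
  have : `|z' - y'| <= 3 / 2 * C by rewrite ler_norml; apply/andP; split; lra.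
  lra.
have close0 (x y z : R) (eps : R) : `|x - y| <= eps -> `|z - y| <= eps -> `|x - z| <= 2 * eps.
  by rewrite !ler_norml => /andP[? ?] /andP[? ?]; apply/andP; split; lra.
have eq0 (x y : R) : (forall n, `|x - y| <= 32 * c n) -> x = y.
  move=> xy; apply/eqP; rewrite -subr_eq0 -normr_le0 leNgt; apply/negP => e0.
  by have [n] := cvgc 32 (ler0n _ 32) _ e0; rewrite ltNge xy.
apply/eqP; rewrite eq_complex; apply/andP; split; apply/eqP; apply: eq0 => n.
  have h1 := le_trans (Re_le_normc _) (f0k n b).
  have h2 := le_trans (Re_le_normc _) (hb n).
  move: h1 h2; rewrite kh !partsE => h1 h2.
  have := close0 _ _ _ _ h1 (le_trans h2 _); rewrite (_ : 32 = 2 * 16); last by ring.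
  by rewrite -mulrA; apply; rewrite ler_peMl ?ltW// ltr1n.
have h1 := le_trans (Im_le_normc _) (f0k n b).
have h2 := le_trans (Im_le_normc _) (hb n).
move: h1 h2; rewrite kh !partsE => h1 h2.
have := close0 _ _ _ _ h1 (le_trans h2 _); rewrite (_ : 32 = 2 * 16); last by ring.
by rewrite -mulrA; apply; rewrite ler_peMl ?ltW// ltr1n.
Qed.

Lemma bmeas_uniform (f : borel B -> R) : (forall eps : R, 0 < eps ->
  exists2 g, bmeas g & forall b, `|f b - g b| <= eps) -> bmeas f.
Proof.
move=> hf; split; last first.
  have [g [_ [S gS]] fg] := hf 1 ltr01; exists (1 + S) => b.
  rewrite -(subrK (g b) (f b)) (le_trans (ler_normD _ _))// lerD//.
have /choice[g gP] n : exists g, bmeas g /\ forall b, `|f b - g b| <= n.+1%:R^-1.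
  have n0 : 0 < n.+1%:R^-1 :> R by rewrite invr_gt0.
  by have [g bg fg] := hf _ n0; exists g.
apply: (measurable_fun_cvg (h := g)) => [n|b _]; first by have [[]] := gP n.
apply/cvgrPdist_le => eps eps0; near=> n.
apply: (le_trans ((gP n).2 b)).
apply: ltW; near: n; exact: (near_infty_natSinv_lt (PosNum eps0)).
Unshelve. all: by end_near. Qed.

End continuity_span_representatives.

(** * Extension to square-integrable functions *)

Section trilinear.
Context {R : realType} {B : ptopologicalType}.
Variable nu : probability (borel B) R.
Implicit Types f F H : borel B -> R.

Lemma L2r_integrable1 H : L2r nu H -> nu.-integrable setT (fun b => (H b)%:E).
Proof.
move=> LH; have := L2r_integrable (bmeas_cst 1) LH.
by under eq_fun do rewrite /= mul1r.
Qed.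

(** The variance of [F] is nonnegative and [nu] has total mass 1. *)
Lemma sqr_Rintegral_le F : L2r nu F -> (\int[nu]_b F b) ^+ 2 <= sqnorm nu F.
Proof.
move=> LF; have iF := L2r_integrable1 LF; have [mF iF2] := LF.
set m := \int[nu]_b F b.
have : 0 <= \int[nu]_b ((-2 * m) * F b + (1 * F b ^+ 2 + m ^+ 2)).
  apply: Rintegral_ge0 => b _; rewrite [leRHS](_ : _ = (F b - m) ^+ 2) ?sqr_ge0//.
  by move: m (F b) => x y; ring.
have im : nu.-integrable setT (fun=> (m ^+ 2)%:E) by exact: finite_measure_integrable_cst.
rewrite RintegralZD//; last first.
  by apply: integrable_EFinD => //; exact: integrable_EFinZ.
rewrite RintegralZD// Rintegral_cst//.
rewrite (_ : fine _ = 1); last exact: (congr1 fine (probability_setT nu)).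
rewrite -/m -/(sqnorm nu F); nra.
Qed.

(** The real version of the expected limit [<F, 1> <f, H>]. *)
Definition limit_form f F H := (\int[nu]_b F b) * \int[nu]_b (f b * H b).

Lemma limit_form_bound (S t : R) f F H : measurable_fun setT f ->
  (forall b, `|f b| <= S) -> L2r nu F -> L2r nu H -> 0 < t ->
  `|limit_form f F H| <= S * (t * sqnorm nu F + sqnorm nu H / t).
Proof.
move=> mf fS LF LH t0; have bf : bmeas f by split => //; exists S.
have S0 : 0 <= S := le_trans (normr_ge0 _) (fS point).
have ifH := L2r_integrable bf LH; have iH := L2r_integrable1 LH.
have [mH Hi] := LH.
have LnH : L2r nu (fun b => `|H b|).
  split; first exact: measurableT_comp.
  by under eq_fun do rewrite real_normK ?num_real//.
have inH := L2r_integrable1 LnH.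
have le1 : `|\int[nu]_b (f b * H b)| <= S * \int[nu]_b `|H b|.
  apply: (le_trans (le_normr_Rintegral _ ifH)) => //.
  rewrite -RintegralZl//; apply: le_Rintegral => //.
  - exact: (@integrable_norm _ _ _ _ _ _ ifH).
  - exact: integrable_EFinZ.
  - by move=> b _; rewrite normrM ler_wpM2r.
have -> : sqnorm nu H = sqnorm nu (fun b => `|H b|).
  by apply: eq_Rintegral => b _; rewrite real_normK ?num_real.
have nH0 : 0 <= \int[nu]_b `|H b| by exact: Rintegral_ge0.
rewrite normrM (le_trans (ler_wpM2l _ le1))// mulrCA ler_wpM2l//.
rewrite -[X in _ * X](ger0_norm nH0) -normrM.
apply: (le_trans (weighted_amgm _ _ t0)); rewrite [t^-1 * _]mulrC.
by rewrite lerD// ?ler_wpM2l ?ler_wpM2r ?invr_ge0 ?(ltW t0)// sqr_Rintegral_le.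
Qed.

Lemma cvg_approx (u : R^nat) (l : R) :
  (forall eps : R, 0 < eps -> exists v m, [/\ v @ \oo --> m,
    \forall n \near \oo, `|u n - v n| <= eps & `|l - m| <= eps]) ->
  u @ \oo --> l.
Proof.
move=> h; apply/cvgrPdist_le => eps eps0.
have e3 : 0 < eps / 3 by rewrite divr_gt0.
have [v [m [/cvgrPdist_le /(_ _ e3) vm uv lm]]] := h _ e3.
near=> n.
have h1 : `|m - v n| <= eps / 3 by near: n.
have h2 : `|u n - v n| <= eps / 3 by near: n.
have -> : l - u n = (l - m) + (m - v n) - (u n - v n) by ring.
apply: (le_trans (ler_normB _ _)); have := ler_normD (l - m) (m - v n).
lra.
Unshelve. all: by end_near. Qed.

(** The order of choices matters: [t] depends on the fixed norm [A] alone and makes the first term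
    at most [eps / 2]; then [dl] is chosen against [1 / t]. *)
Lemma perturb_bound (C A eps : R) : 0 <= C -> 0 <= A -> 0 < eps ->
  exists t dl, [/\ 0 < t, 0 < dl &
    forall x, 0 <= x -> x <= dl -> C * (t * A + x / t) <= eps].
Proof.
move=> C0 A0 e0; pose C' := C * A + 1.
have C'0 : 0 < C' by rewrite ltr_wpDl// mulr_ge0.
have C10 : 0 < C + 1 by rewrite ltr_wpDl.
(* The summands 1 in [C'] and in [C + 1] avoid division by zero when [C] or [A] vanishes. *)
exists (eps / 2 / C'), (eps / 2 / (C + 1) * (eps / 2 / C')).
have t0 : 0 < eps / 2 / C' by rewrite !divr_gt0.
split => //; first by rewrite mulr_gt0// !divr_gt0.
move=> x x0 xd; rewrite mulrDr [leRHS]splitr lerD//.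
  rewrite [leLHS](_ : _ = eps / 2 * (C * A) / C'); last by ring.
  by rewrite ler_pdivrMr// ler_wpM2l ?divr_ge0 ?(ltW e0)// lerDl.
apply: (@le_trans _ _ (C * (eps / 2 / (C + 1)))).
  by rewrite ler_wpM2l// ler_pdivrMr.
rewrite mulrA ler_pdivrMr// mulrC ler_wpM2l ?divr_ge0 ?(ltW e0)//.
by rewrite lerDl.
Qed.

Variable d : B -> B -> R.
Hypothesis dB : metric_inducing_topology d.
Variables (T : nat -> (borel B -> R) -> (borel B -> R) -> (borel B -> R) -> R) (K : R).
Hypothesis T1 : forall n c f f' F H, bmeas f -> bmeas f' -> L2r nu F -> L2r nu H ->
  T n (fun b => c * f b + f' b) F H = c * T n f F H + T n f' F H.
Hypothesis T2 : forall n c f F F' H, bmeas f -> L2r nu F -> L2r nu F' -> L2r nu H ->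
  T n f (fun b => c * F b + F' b) H = c * T n f F H + T n f F' H.
Hypothesis T3 : forall n c f F H H', bmeas f -> L2r nu F -> L2r nu H -> L2r nu H' ->
  T n f F (fun b => c * H b + H' b) = c * T n f F H + T n f F H'.
Hypothesis K0 : 0 <= K.
Hypothesis Tbound : \forall n \near \oo, forall S t f F H,
  0 < t -> measurable_fun setT f -> (forall b, `|f b| <= S) ->
  L2r nu F -> L2r nu H ->
  `|T n f F H| <= S * K * (t * sqnorm nu F + sqnorm nu H / t).
Hypothesis Tindic : forall U V W : set B,
  continuity_set nu U -> continuity_set nu V -> continuity_set nu W ->
  T n \1_U \1_V \1_W @[n --> \oo] --> fine (nu (U `&` W)) * fine (nu V).

Definition converges f F H := T n f F H @[n --> \oo] --> limit_form f F H.

Let K1 : 0 <= K + 1. Proof. by rewrite addr_ge0. Qed.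

(** The averages satisfy the bound with [K] and the limit form with 1; the constant [K + 1] serves
    both, here and in [bound_limit]. *)
Let bound_near (S t : R) f F H : 0 < t -> measurable_fun setT f ->
  (forall b, `|f b| <= S) -> L2r nu F -> L2r nu H ->
  \forall n \near \oo, `|T n f F H| <= S * (K + 1) * (t * sqnorm nu F + sqnorm nu H / t).
Proof.
move=> t0 mf fS LF LH; near=> n.
have S0 : 0 <= S := le_trans (normr_ge0 _) (fS point).
have hn : forall S t f F H,
  0 < t -> measurable_fun setT f -> (forall b, `|f b| <= S) ->
  L2r nu F -> L2r nu H ->
  `|T n f F H| <= S * K * (t * sqnorm nu F + sqnorm nu H / t) by near: n.
apply: (le_trans (hn _ _ _ _ _ t0 mf fS LF LH)).
rewrite ler_wpM2r ?ler_wpM2l ?lerDl// addr_ge0// mulr_ge0 ?invr_ge0 ?sqnorm_ge0 ?ltW//.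
Unshelve. all: by end_near. Qed.

Let bound_limit (S t : R) f F H : 0 < t -> measurable_fun setT f ->
  (forall b, `|f b| <= S) -> L2r nu F -> L2r nu H ->
  `|limit_form f F H| <= S * (K + 1) * (t * sqnorm nu F + sqnorm nu H / t).
Proof.
move=> t0 mf fS LF LH.
have S0 : 0 <= S := le_trans (normr_ge0 _) (fS point).
apply: (le_trans (limit_form_bound mf fS LF LH t0)).
rewrite ler_wpM2r ?ler_peMr ?lerDr// addr_ge0// mulr_ge0 ?invr_ge0 ?sqnorm_ge0 ?ltW//.
Qed.

Lemma convergesZD_1 (c : R) f f' F H : bmeas f -> bmeas f' -> L2r nu F -> L2r nu H ->
  converges f F H -> converges f' F H -> converges (fun b => c * f b + f' b) F H.
Proof.
move=> bf bf' LF LH cf cf'; rewrite /converges /limit_form.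
under eq_cvg do rewrite T1//.
rewrite (_ : _ * _ = c * limit_form f F H + limit_form f' F H).
  by apply: cvgD => //; exact: cvgMr.
rewrite /limit_form mulrCA -mulrDr -RintegralZD; [|exact: L2r_integrable..].
by congr (_ * _); apply: eq_Rintegral => b _; ring.
Qed.

Let convergesZD_2 (c : R) f F F' H : bmeas f -> L2r nu F -> L2r nu F' -> L2r nu H ->
  converges f F H -> converges f F' H -> converges f (fun b => c * F b + F' b) H.
Proof.
move=> bf LF LF' LH cf cf'; rewrite /converges /limit_form.
under eq_cvg do rewrite T2//.
rewrite (_ : _ * _ = c * limit_form f F H + limit_form f F' H).
  by apply: cvgD => //; exact: cvgMr.
by rewrite /limit_form mulrA -mulrDl -RintegralZD; [|exact: L2r_integrable1..].
Qed.

Let convergesZD_3 (c : R) f F H H' : bmeas f -> L2r nu F -> L2r nu H -> L2r nu H' ->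
  converges f F H -> converges f F H' -> converges f F (fun b => c * H b + H' b).
Proof.
move=> bf LF LH LH' cf cf'; rewrite /converges /limit_form.
under eq_cvg do rewrite T3//.
rewrite (_ : _ * _ = c * limit_form f F H + limit_form f F H').
  by apply: cvgD => //; exact: cvgMr.
rewrite /limit_form mulrCA -mulrDr -RintegralZD; [|exact: L2r_integrable..].
by congr (_ * _); apply: eq_Rintegral => b _; ring.
Qed.

Let L2rB f g : L2r nu f -> L2r nu g -> L2r nu (fun b => f b - g b).
Proof.
move=> Lf Lg; have := L2rZD (-1) Lg Lf.
by under eq_fun do rewrite mulN1r addrC.
Qed.

Let bmeasB f g : bmeas f -> bmeas g -> bmeas (fun b => f b - g b).
Proof.
move=> [mf [S fS]] [mg [S' gS]]; split; first exact: measurable_funB.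
by exists (S + S') => b; rewrite (le_trans (ler_normB _ _))// lerD.
Qed.

Let splitB f g : f = (fun b => 1 * (f b - g b) + g b).
Proof. by apply/funext => b; rewrite mul1r subrK. Qed.

Let T1B n f g F H : bmeas f -> bmeas g -> L2r nu F -> L2r nu H ->
  T n f F H - T n g F H = T n (fun b => f b - g b) F H.
Proof.
move=> bf bg LF LH; rewrite {1}(splitB f g) T1//; last exact: bmeasB.
by rewrite mul1r addrK.
Qed.

Let T2B n f F G H : bmeas f -> L2r nu F -> L2r nu G -> L2r nu H ->
  T n f F H - T n f G H = T n f (fun b => F b - G b) H.
Proof.
move=> bf LF LG LH; rewrite {1}(splitB F G) T2//; last exact: L2rB.
by rewrite mul1r addrK.
Qed.

Let T3B n f F H G : bmeas f -> L2r nu F -> L2r nu H -> L2r nu G ->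
  T n f F H - T n f F G = T n f F (fun b => H b - G b).
Proof.
move=> bf LF LH LG; rewrite {1}(splitB H G) T3//; last exact: L2rB.
by rewrite mul1r addrK.
Qed.

Let L1B f g F H : bmeas f -> bmeas g -> L2r nu F -> L2r nu H ->
  limit_form f F H - limit_form g F H = limit_form (fun b => f b - g b) F H.
Proof.
move=> bf bg LF LH; rewrite /limit_form -mulrBr -RintegralB//; [|exact: L2r_integrable..].
by congr (_ * _); apply: eq_Rintegral => b _; ring.
Qed.

Let L2B f F G H : bmeas f -> L2r nu F -> L2r nu G -> L2r nu H ->
  limit_form f F H - limit_form f G H = limit_form f (fun b => F b - G b) H.
Proof.
by move=> bf LF LG LH; rewrite /limit_form -mulrBl -RintegralB//; exact: L2r_integrable1.
Qed.

Let L3B f F H G : bmeas f -> L2r nu F -> L2r nu H -> L2r nu G ->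
  limit_form f F H - limit_form f F G = limit_form f F (fun b => H b - G b).
Proof.
move=> bf LF LH LG; rewrite /limit_form -mulrBr -RintegralB//; [|exact: L2r_integrable..].
by congr (_ * _); apply: eq_Rintegral => b _; ring.
Qed.

(** [F] and [H] do not move, so [t = 1] is enough and smallness comes from the sup norm of [f - g]
    alone. *)
Lemma converges_uniform f F H : bmeas f -> L2r nu F -> L2r nu H ->
  (forall eps : R, 0 < eps -> exists g, [/\ bmeas g, converges g F H &
    forall b, `|f b - g b| <= eps]) -> converges f F H.
Proof.
move=> bf LF LH h; apply: cvg_approx => eps e0.
pose C := (K + 1) * (1 * sqnorm nu F + sqnorm nu H / 1).
have C0 : 0 <= C by rewrite mulr_ge0// addr_ge0// mulr_ge0// ?invr_ge0 ?sqnorm_ge0.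
have C1 : 0 < C + 1 by rewrite ltr_wpDl.
have [g [bg cg fg]] := h (eps / (C + 1)) (divr_gt0 e0 C1).
have [mfg _] := bmeasB bf bg.
have CE : eps / (C + 1) * (K + 1) * (1 * sqnorm nu F + sqnorm nu H / 1) <= eps.
  by rewrite -[leLHS]mulrA -/C mulrAC ler_pdivrMr// ler_wpM2l ?lerDl// ltW.
exists (fun n => T n g F H), (limit_form g F H); split => //.
  have := bound_near ltr01 mfg fg LF LH; apply: filterS => n hn.
  by rewrite T1B//; exact: le_trans hn CE.
by rewrite L1B//; exact: le_trans (bound_limit ltr01 mfg fg LF LH) CE.
Qed.

(** Two successive density arguments: first [H] becomes general with [F] still an indicator, then
    [F] becomes general with that [H] fixed. *)
Lemma converges_indic (U : set B) F H : continuity_set nu U ->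
  L2r nu F -> L2r nu H -> converges \1_U F H.
Proof.
move=> cU LF LH; have mU : measurable (U : set (borel B)) by case: cU.
have U1 : forall b : borel B, `|\1_U b| <= 1 :> R.
  by move=> b; exact: indic_norm_le1.
have bU : bmeas (\1_U : borel B -> R) by exact: bmeas_indic.
have [m1 _] := bU.
have C0 : 0 <= 1 * (K + 1) by rewrite mul1r.
have step V : continuity_set nu V -> converges \1_U \1_V H.
  move=> cV; have mV : measurable (V : set (borel B)) by case: cV.
  have LV := L2r_indic nu mV.
  apply: (L2r_ind dB (P := fun H => converges \1_U \1_V H)) LH.
  - move=> W cW; have mW : measurable (W : set (borel B)) by case: cW.
    have := Tindic cU cV cW; rewrite /converges.
    rewrite (_ : limit_form _ _ _ = fine (nu (U `&` W)) * fine (nu V))//.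
    rewrite /limit_form mulrC; congr (_ * _).
      transitivity (\int[nu]_b (\1_(U `&` W) b : R)).
        by apply: eq_Rintegral => b _; rewrite indicI.
      rewrite /Rintegral integral_indic ?setIT//; exact: (@measurableI _ (borel B)).
    by rewrite /Rintegral integral_indic ?setIT.
  - by move=> c f g Lf Lg cf cg; apply: convergesZD_3 => //; exact: bU.
  - move=> h Lh happ; apply: cvg_approx => eps e0.
    have [t [dl [t0 dl0 hdl]]] := perturb_bound C0 (sqnorm_ge0 nu \1_V) e0.
    have [g [Lg cg hg]] := happ _ dl0.
    have LB := L2rB Lh Lg.
    have le := hdl _ (sqnorm_ge0 _ _) hg.
    exists (fun n => T n \1_U \1_V g), (limit_form \1_U \1_V g); split => //.
      have := bound_near t0 m1 U1 LV LB; apply: filterS => n hn.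
      by rewrite T3B//; exact: le_trans hn le.
    rewrite L3B//.
    exact: le_trans (bound_limit t0 m1 U1 LV LB) le.
apply: (L2r_ind dB (P := fun F => converges \1_U F H)) LF => //.
- by move=> c f g Lf Lg cf cg; apply: convergesZD_2 => //; exact: bU.
- move=> h Lh happ; apply: cvg_approx => eps e0.
  have [t [dl [t0 dl0 hdl]]] := perturb_bound C0 (sqnorm_ge0 nu H) e0.
  have [g [Lg cg hg]] := happ _ dl0.
  have LB := L2rB Lh Lg.
  (* The small norm now belongs to the first [L^2] argument, so the bound is used with [t^-1] in
     place of [t]. *)
  have le : 1 * (K + 1) * (t^-1 * sqnorm nu (fun b => h b - g b) + sqnorm nu H / t^-1) <= eps.
    rewrite invrK [_ + _ * t]addrC [t^-1 * _]mulrC [_ * t]mulrC.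
    by apply: (hdl _ _ hg); exact: sqnorm_ge0.
  have tV0 : 0 < t^-1 by rewrite invr_gt0.
  exists (fun n => T n \1_U g H), (limit_form \1_U g H); split => //.
    have := bound_near tV0 m1 U1 LB LH; apply: filterS => n hn.
    by rewrite T2B//; exact: le_trans hn le.
  rewrite L2B//.
  exact: le_trans (bound_limit tV0 m1 U1 LB LH) le.
Qed.

Let good f := bmeas f /\
  forall F H, L2r nu F -> L2r nu H -> converges f F H.

Let goodZD (c : R) f g : good f -> good g -> good (fun b => c * f b + g b).
Proof.
move=> [bf cf] [bg cg]; split; last first.
  by move=> F H LF LH; apply: convergesZD_1 => //; [exact: cf|exact: cg].
have [mf [S fS]] := bf; have [mg [S' gS]] := bg; split.
  by apply: measurable_funD => //; exact: measurable_funM.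
exists (`|c| * S + S') => b; rewrite (le_trans (ler_normD _ _))// lerD// normrM.
by rewrite ler_wpM2l.
Qed.

Let good_parts (h : borel B -> R[i]) :=
  good (fun b => complex.Re (h b)) /\ good (fun b => complex.Im (h b)).

Let good_cst0 : good (fun=> 0).
Proof.
split; first exact: bmeas_cst.
move=> F H LF LH; rewrite /converges.
have T0 n : T n (fun=> 0) F H = 0.
  have := T1 n (-1) (bmeas_cst 0) (bmeas_cst 0) LF LH.
  rewrite (_ : (fun b => _) = (fun=> 0)) ?mulN1r ?addNr//.
  by apply/funext => b; rewrite mulr0 addr0.
have -> : limit_form (fun=> 0) F H = 0.
  rewrite /limit_form; under [X in _ * X]eq_Rintegral do rewrite mul0r.
  by rewrite Rintegral_cst// mul0r mulr0.
by under eq_cvg do rewrite T0; exact: cvg_cst.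
Qed.

Let span_good : continuity_span nu `<=` good_parts.
Proof.
apply: smallest_sub; last first.
  move=> _ [U cU ->]; have mU : measurable (U : set (borel B)) by case: cU.
  split; last exact: good_cst0.
  split; last by move=> F H LF LH; exact: converges_indic.
  exact: bmeas_indic.
split; first by split; exact: good_cst0.
move=> c f h [gfr gfi] [ghr ghi]; split.
  rewrite (_ : (fun b => _) = (fun b => complex.Re c * complex.Re (f b) +
      (- complex.Im c * complex.Im (f b) + complex.Re (h b)))).
    by apply: goodZD => //; exact: goodZD.
  by apply/funext => b; rewrite !partsE; ring.
rewrite (_ : (fun b => _) = (fun b => complex.Re c * complex.Im (f b) +
    (complex.Im c * complex.Re (f b) + complex.Im (h b)))).
  by apply: goodZD => //; exact: goodZD.
by apply/funext => b; rewrite !partsE; ring.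
Qed.

Let good_uniform f : (forall eps : R, 0 < eps ->
  exists2 g, good g & forall b, `|f b - g b| <= eps) -> good f.
Proof.
move=> hf; have bf : bmeas f.
  by apply: bmeas_uniform => eps /hf[g [bg _] fg]; exists g.
split => // F H LF LH; apply: converges_uniform => // eps /hf[g [bg cg] fg].
by exists g; split => //; exact: cg.
Qed.

Lemma uniform_closure_converges (f : borel B -> R[i]) :
  uniform_closure (continuity_span nu) f ->
  [/\ bmeas (fun b => complex.Re (f b)), bmeas (fun b => complex.Im (f b)) &
    forall F H, L2r nu F -> L2r nu H ->
      converges (fun b => complex.Re (f b)) F H /\
      converges (fun b => complex.Im (f b)) F H].
Proof.
move=> hf; suff [[br cr] [bi ci]] : good_parts f.
  by split => // F H LF LH; split; [exact: cr|exact: ci].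
split; apply: good_uniform => eps /hf[h /span_good[gr gi] fh].
  exists (fun b => complex.Re (h b)) => // b.
  by have := le_trans (Re_le_normc _) (ltW (fh b)); rewrite !partsE.
exists (fun b => complex.Im (h b)) => // b.
by have := le_trans (Im_le_normc _) (ltW (fh b)); rewrite !partsE.
Qed.

End trilinear.

(** * Complex matrix coefficients *)

Section complex_L2.
Context d (T : measurableType d) (R : realType) (m : {measure set T -> \bar R}).
Implicit Types f h : T -> R[i].

Lemma L2_parts f : L2 m f ->
  L2r m (fun x => complex.Re (f x)) /\ L2r m (fun x => complex.Im (f x)).
Proof.
move=> [[mR mI] foo].
have sqE x : Normc.normc (f x) ^+ 2 = complex.Re (f x) ^+ 2 + complex.Im (f x) ^+ 2.
  by case: (f x) => u v /=; rewrite sqr_sqrtr// addr_ge0// sqr_ge0.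
have fin : (\int[m]_x (complex.Re (f x) ^+ 2 + complex.Im (f x) ^+ 2)%:E < +oo)%E.
  move: foo; rewrite /cnorm unlock/= => /lty_poweRy; rewrite invr_eq0 pnatr_eq0 => /(_ isT).
  apply: le_lt_trans; rewrite le_eqVlt; apply/orP; left; apply/eqP.
  apply: eq_integral => x _; rewrite -sqE powR_mulrn// real_normK ?num_real//.
have iS : m.-integrable setT (fun x => (complex.Re (f x) ^+ 2 + complex.Im (f x) ^+ 2)%:E).
  apply/integrableP; split.
    by apply/measurable_EFinP; apply: measurable_funD; exact: measurable_funX.
  apply: le_lt_trans fin; rewrite le_eqVlt; apply/orP; left; apply/eqP.
  by apply: eq_integral => x _; rewrite gee0_abs// lee_fin addr_ge0// sqr_ge0.
have part (F : T -> R) : measurable_fun setT F ->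
    (forall x, F x ^+ 2 <= complex.Re (f x) ^+ 2 + complex.Im (f x) ^+ 2) -> L2r m F.
  move=> mF le; split => //; apply: le_integrable iS => //.
    by apply/measurable_EFinP; exact: measurable_funX.
  by move=> y _ /=; rewrite lee_fin !ger0_norm ?addr_ge0 ?sqr_ge0.
by split; apply: part => // y; rewrite ?lerDl ?lerDr sqr_ge0.
Qed.

Lemma L2_realc (f : T -> R) : L2r m f -> L2 m (fun x => (f x)%:C).
Proof.
move=> [mf fi]; split; first by split => //=; exact: measurable_cst.
rewrite /cnorm unlock/= poweR_lty//.
under eq_integral do rewrite expr0n/= addr0 sqrtr_sqr normr_id powR_mulrn// real_normK ?num_real//.
by have /integrable_lty := fi; apply; exact: measurableT.
Qed.

End complex_L2.

Section matrix_coefficients.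
Context {R : realType} {G : topologicalGroupType} {B : ptopologicalType}.
Variables (a : continuous_action G B) (nu : probability (borel B) R).
Hypothesis qi : quasi_invariant a nu.
Implicit Types (F H : borel B -> R) (phi psi : borel B -> R[i]).

Local Notation J := (coefJ a nu).

(** [F (g^-1 b) ^ 2] times the density of [g] integrates to the squared norm of [F], by change of
    variables. This holds for every [g], which permits expanding the complex coefficient under the
    integral over [g]. *)
Lemma coefJ_integrable F H g : L2r nu F -> L2r nu H ->
  nu.-integrable setT (fun b => (F (a (g^-1)%g b) * H b * sdens a nu g b)%:E).
Proof.
move=> [mF iF] [mH iH].
have mFV : measurable_fun setT (fun b : borel B => F (a (g^-1)%g b)).
  exact: (measurableT_comp mF (act_measurable a (g^-1)%g)).
have mr := measurable_rnd qi g.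
have i1 : nu.-integrable setT (fun b => (F (a (g^-1)%g b) ^+ 2 * `|rnd a nu g b|)%:E).
  have mFr : measurable_fun setT (fun b : borel B => (F (a (g^-1)%g b) ^+ 2 * `|rnd a nu g b|)%:E).
    apply/measurable_EFinP; apply: measurable_funM; first exact: measurable_funX.
    exact: measurableT_comp.
  apply/integrableP; split => //.
  have := integrable_lty measurableT iF; apply: le_lt_trans.
  rewrite le_eqVlt; apply/orP; left; apply/eqP.
  transitivity (\int[nu]_b ((F (a (g^-1)%g b) ^+ 2)%:E * (rnd a nu g b)%:E))%E.
    apply: ae_eq_integral => //.
    - exact: measurableT_comp.
    - apply: emeasurable_funM; apply/measurable_EFinP => //; exact: measurable_funX.
    - apply: filterS (rnd_gt0 qi g) => b b0 _.
      have b1 : `|rnd a nu g b| = rnd a nu g b by exact: gtr0_norm.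
      by rewrite gee0_abs ?b1// lee_fin mulr_ge0 ?sqr_ge0 ?ltW.
  rewrite -(ge0_integral_act qi g (F := fun b => (F (a (g^-1)%g b) ^+ 2)%:E)).
  - by apply: eq_integral => b _; rewrite actK.
  - by apply/measurable_EFinP; exact: measurable_funX.
  - by move=> b; rewrite lee_fin sqr_ge0.
have i2 : nu.-integrable setT (fun b => (F (a (g^-1)%g b) ^+ 2 * `|rnd a nu g b| + H b ^+ 2)%:E).
  exact: integrable_EFinD.
apply: le_integrable i2 => //.
  apply/measurable_EFinP; apply: measurable_funM; last exact: measurable_sdens.
  exact: measurable_funM.
move=> b _ /=; rewrite lee_fin [leRHS]ger0_norm; last first.
  by rewrite addr_ge0 ?sqr_ge0// mulr_ge0 ?normr_ge0// sqr_ge0.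
have s2 : sdens a nu g b ^+ 2 <= `|rnd a nu g b|.
  rewrite /sdens; have [r0|r0] := leP 0 (rnd a nu g b).
    by rewrite sqr_sqrtr// ler_norm.
  by rewrite ler0_sqrtr ?(ltW r0)// expr0n/= normr_ge0.
rewrite mulrAC; have := weighted_amgm (F (a (g^-1)%g b) * sdens a nu g b) (H b) ltr01.
move=> /le_trans; apply; rewrite invr1 !mul1r lerD2r exprMn ler_wpM2l ?sqr_ge0//.
Qed.

Lemma coefJB F F' H H' g (c : R) : L2r nu F -> L2r nu F' -> L2r nu H -> L2r nu H' ->
  \int[nu]_b ((F (a (g^-1)%g b) * H b + c * (F' (a (g^-1)%g b) * H' b)) * sdens a nu g b)
  = J F H g + c * J F' H' g.
Proof.
move=> LF LF' LH LH'; rewrite addrC -RintegralZD; [|exact: coefJ_integrable..].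
by apply: eq_Rintegral => b _; ring.
Qed.

Lemma inner_qrep phi psi g : L2 nu phi -> L2 nu psi ->
  inner nu (qrep a nu g phi) psi =
  (J (fun b => complex.Re (phi b)) (fun b => complex.Re (psi b)) g +
   J (fun b => complex.Im (phi b)) (fun b => complex.Im (psi b)) g) +i*
  (J (fun b => complex.Im (phi b)) (fun b => complex.Re (psi b)) g -
   J (fun b => complex.Re (phi b)) (fun b => complex.Im (psi b)) g).
Proof.
move=> /L2_parts[Lr Li] /L2_parts[Mr Mi].
rewrite /inner /cintegral; congr (_ +i* _).
  rewrite -[X in _ + X]mul1r -coefJB//; apply: eq_Rintegral => b _.
  rewrite /qrep -/(rnd a nu g b) -/(sdens a nu g b) !partsE/=; ring.
rewrite -mulN1r -coefJB//; apply: eq_Rintegral => b _.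
rewrite /qrep -/(rnd a nu g b) -/(sdens a nu g b) !partsE/=; ring.
Qed.

Hypotheses (scG : @second_countable G) (scB : @second_countable B).
Variables (mu : {measure set (borel G) -> \bar R}) (E : set (borel G)).
Hypotheses (mE : measurable E) (Eoo : (mu E < +oo)%E).
Hypothesis EV : E = [set (g^-1)%g | g in E].
Hypothesis muV : forall A : set (borel G), measurable A ->
  mu [set (g^-1)%g | g in A] = mu A.
Variable e : borel G -> borel B.
Hypothesis me : measurable_fun E e.
Variables (w : borel G * borel B -> R) (M : R).
Hypotheses (mw : measurable_fun setT w) (w0 : forall z, 0 <= w z)
  (wM : forall z, w z <= M)
  (wE : {ae mu, forall g, E g ->
    {ae nu, forall b, w (g, b) = sdens a nu g b / Xi a nu g}}).

Local Notation T := (tavg a nu mu E e).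

(** The product of [f], [phi] and the conjugate of [psi] expands into eight real averages. Splitting
    the integral over [g] relies on [almost_integrable], because the coefficients are handled only
    up to null sets. *)
Lemma avg_coefE (f phi psi : borel B -> R[i]) :
  bmeas (fun b => complex.Re (f b)) -> bmeas (fun b => complex.Im (f b)) ->
  L2 nu phi -> L2 nu psi ->
  let fr b := complex.Re (f b) in let fi b := complex.Im (f b) in
  let Fr b := complex.Re (phi b) in let Fi b := complex.Im (phi b) in
  let Hr b := complex.Re (psi b) in let Hi b := complex.Im (psi b) in
  avg_coef a nu mu E e f phi psi =
  (T fr Fr Hr + T fr Fi Hi - T fi Fi Hr + T fi Fr Hi) +i*
  (T fr Fi Hr - T fr Fr Hi + T fi Fr Hr + T fi Fi Hi).
Proof.
move=> br bi Lphi Lpsi fr fi Fr Fi Hr Hi.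
have [LFr LFi] := L2_parts Lphi; have [LHr LHi] := L2_parts Lpsi.
pose k f F H g := f (e g) * (J F H g / Xi a nu g).
have ak (f' F H : borel B -> R) (bf : bmeas f') (LF : L2r nu F) (LH : L2r nu H) :
    almost_integrable mE Eoo (k f' F H).
  exact: (almost_integrable_coefJ scG scB qi mE Eoo EV muV me mw w0 wM wE bf LF LH).
have int4 (c1 c2 c3 : R) (k1 k2 k3 k4 : borel G -> R) :
    almost_integrable mE Eoo k1 -> almost_integrable mE Eoo k2 ->
    almost_integrable mE Eoo k3 -> almost_integrable mE Eoo k4 ->
    \int[mu]_(g in E) (c1 * k1 g + (c2 * k2 g + (c3 * k3 g + k4 g))) =
    c1 * (\int[mu]_(g in E) k1 g) + (c2 * (\int[mu]_(g in E) k2 g) +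
      (c3 * (\int[mu]_(g in E) k3 g) + \int[mu]_(g in E) k4 g)).
  move=> a1 a2 a3 a4.
  have [a34 <-] := almost_integrableZD c3 a3 a4.
  have [a234 <-] := almost_integrableZD c2 a2 a34.
  by have [_ <-] := almost_integrableZD c1 a1 a234.
have integrandE g : f (e g) * (inner nu (qrep a nu g phi) psi / harish_chandra a nu g) =
   (1 * k fr Fr Hr g + (1 * k fr Fi Hi g + (-1 * k fi Fi Hr g + k fi Fr Hi g))) +i*
   (1 * k fr Fi Hr g + (-1 * k fr Fr Hi g + (1 * k fi Fr Hr g + k fi Fi Hi g))).
  rewrite inner_qrep// harish_chandraE// -fmorphV/= /k.
  by apply/eqP; rewrite eq_complex !partsE/=; apply/andP; split; apply/eqP; rewrite /fr /fi; ring.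
pose I f F H := \int[mu]_(g in E) k f F H g.
have TE f' F H : T f' F H = (vol mu E)^-1 * I f' F H by [].
rewrite /avg_coef /cintegral.
apply/eqP; rewrite eq_complex !partsE/=; apply/andP; split; apply/eqP.
  under eq_Rintegral do rewrite integrandE/=.
  rewrite int4; [|exact: ak..].
  rewrite -!/(I _ _ _).
  rewrite mul0r subr0 !TE.
  move: (vol mu E)^-1 (I fr Fr Hr) (I fr Fi Hi) (I fi Fi Hr) (I fi Fr Hi).
  move=> *; ring.
under eq_Rintegral do rewrite integrandE/=.
rewrite int4; [|exact: ak..].
  rewrite -!/(I _ _ _).
rewrite mul0r addr0 !TE.
move: (vol mu E)^-1 (I fr Fi Hr) (I fr Fr Hi) (I fi Fr Hr) (I fi Fi Hi).
move=> *; ring.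
Qed.

Let tavg0_1 F H : T (fun=> 0) F H = 0.
Proof. by rewrite /tavg; under eq_Rintegral do rewrite mul0r; rewrite Rintegral_cst// mul0r mulr0. Qed.

Let tavg0_2 f H : T f (fun=> 0) H = 0.
Proof.
rewrite /tavg; under eq_Rintegral => g _.
  rewrite /coefJ; under eq_Rintegral do rewrite !mul0r.
  rewrite Rintegral_cst// !mul0r mulr0; over.
by rewrite Rintegral_cst// mul0r mulr0.
Qed.

Local Notation realc f := (fun b : borel B => (f b : R)%:C).
Local Notation avgfun := (avgfun a mE Eoo e w).

Section avg_op.
Variables f F : borel B -> R.
Hypotheses (bf : bmeas f) (bF : bmeas F).

Let op := avg_op a nu mu E e (realc f) (realc F).

Lemma avg_coef_real psi : L2 nu psi ->
  avg_coef a nu mu E e (realc f) (realc F) psi =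
  (T f F (fun b => complex.Re (psi b))) +i* (- T f F (fun b => complex.Im (psi b))).
Proof.
move=> Lpsi; rewrite avg_coefE//=; last 2 first.
- exact: (bmeas_cst 0).
- by apply: L2_realc; exact: bmeas_L2r.
by rewrite !tavg0_1 !tavg0_2 !(addr0, subr0, add0r).
Qed.

Lemma avgfun_inner_realc psi : L2 nu psi ->
  inner nu (realc (avgfun f F)) psi = avg_coef a nu mu E e (realc f) (realc F) psi.
Proof.
move=> Lpsi; have [LHr LHi] := L2_parts Lpsi.
have inn H (LH : L2r nu H) : \int[nu]_b (avgfun f F b * H b) = T f F H.
  exact: (avgfun_inner scG scB qi mE Eoo EV muV me mw w0 wM wE bf bF LH).
rewrite avg_coef_real// /inner /cintegral; congr (_ +i* _).
  rewrite -inn//; apply: eq_Rintegral => b _; rewrite !partsE/=; ring.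
rewrite -mulN1r -inn// -RintegralZl//.
  by apply: eq_Rintegral => b _; rewrite !partsE/=; ring.
apply: L2r_integrable => //.
exact: (avgfun_bmeas scG scB qi mE Eoo EV muV me mw w0 wM wE bf bF).
Qed.

Let avgfunL2 : L2r nu (avgfun f F).
Proof.
by apply: bmeas_L2r; exact: (avgfun_bmeas scG scB qi mE Eoo EV muV me mw w0 wM wE bf bF).
Qed.

(** [avg_op] is picked by choice, with a default when nothing qualifies. The explicit function
    [avgfun] shows that something does. *)
Lemma avg_op_spec : L2 nu op /\ forall psi, L2 nu psi ->
  inner nu op psi = avg_coef a nu mu E e (realc f) (realc F) psi.
Proof.
pose P h := L2 nu h /\ forall psi, L2 nu psi ->
  inner nu h psi = avg_coef a nu mu E e (realc f) (realc F) psi.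
have : P (realc (avgfun f F)) by split; [exact: L2_realc|exact: avgfun_inner_realc].
exact: (xgetI (cst 0)).
Qed.

Lemma avg_op_inner H : bmeas H -> inner nu op (realc H) = (T f F H)%:C.
Proof.
move=> bH; have LH : L2 nu (realc H) by apply: L2_realc; exact: bmeas_L2r.
have [_ ->//] := avg_op_spec; rewrite avg_coef_real//=.
rewrite [X in - X](_ : _ = 0) ?oppr0//.
rewrite /tavg; under eq_Rintegral => g _.
  rewrite /coefJ; under eq_Rintegral do rewrite mulr0 mul0r.
  rewrite Rintegral_cst// !mul0r mulr0; over.
by rewrite Rintegral_cst// mul0r mulr0.
Qed.

(** Equality of integrals over every measurable set [A], by pairing with indicators. It carries the
    [L^oo] bound assumed for the abstract operator over to the explicit average. *)
Lemma avg_op_ae : {ae nu, forall b, complex.Re (op b) = avgfun f F b}.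
Proof.
have [Lop opE] := avg_op_spec; have [[mr ir] _] := L2_parts Lop.
have iop := L2r_integrable1 (proj1 (L2_parts Lop)).
have iav := L2r_integrable1 avgfunL2.
suff : ae_eq nu setT (fun b => (complex.Re (op b))%:E) (fun b => (avgfun f F b)%:E).
  by apply: filterS => b /(_ I)[].
apply: integral_ae_eq => //; first by have [mav _] := avgfunL2; exact/measurable_EFinP.
move=> A _ mA.
have bA : bmeas (\1_A : borel B -> R).
  exact: bmeas_indic.
have LA : L2 nu (realc (\1_A)) by apply: L2_realc; exact: bmeas_L2r.
have toA (f1 : borel B -> R[i]) : L2r nu (fun b => complex.Re (f1 b)) ->
    (\int[nu]_b complex.Re (f1 b * ((\1_A b : R)%:C)^*))%:E = (\int[nu]_(b in A) (complex.Re (f1 b))%:E)%E.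
  move=> i1; rewrite [RHS]integral_mkcond fineK; last first.
    apply: integrable_fin_num => //.
    apply: (eq_integrable measurableT (fun b => (\1_A b * complex.Re (f1 b))%:E)).
      by move=> b _; rewrite !partsE/= oppr0 mulr0 subr0 mulrC.
    by apply: L2r_integrable; [exact: bA|].
  apply: eq_integral => b _; rewrite patchE indicE; case: ifPn => bA'.
    by rewrite !partsE/= oppr0 mulr0 subr0 mulr1.
  by rewrite !partsE/= oppr0 !mulr0 subr0.
rewrite -toA; last exact: (L2_parts Lop).1.
rewrite -(toA (realc (avgfun f F)))//; congr EFin.
have := opE _ LA; rewrite -avgfun_inner_realc// => opA.
exact: (congr1 (@complex.Re _) opA).
Qed.

End avg_op.

End matrix_coefficients.

(** * Proof of both conclusions *)

Theorem theorem2p2 (R : realType)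
  (G : topologicalGroupType) (B : ptopologicalType)
  (mu : {measure set (borel G) -> \bar R})
  (nu : probability (borel B) R)
  (a : continuous_action G B)
  (L : G -> R) (d : B -> B -> R)
  (E : nat -> set G) (e : nat -> G -> B) :
  hausdorff_space G -> locally_compact [set: G] -> @second_countable G ->
  unimodular R G -> left_haar mu ->
  @second_countable B ->
  quasi_invariant a nu ->
  (forall U : set G, open U -> precompact U ->
    (ereal_sup [set cnorm nu +oo (qrep a nu g constant1) | g in U] < +oo)%E) ->
  length_function L ->
  metric_inducing_topology d ->
  (forall n, precompact (E n)) ->
  (forall n, measurable (E n : set (borel G))) ->
  (forall n, E n = [set (g^-1)%g | g in E n]) ->
  (mu (E n) @[n --> \oo] --> +oo%E) ->
  (forall n, measurable_fun (E n : set (borel G)) (e n : borel G -> borel B)) ->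
  (forall r : R, 0 < r ->
    exists h : R -> R,
      [/\ forall s, 0 <= s -> 0 <= h s,
          forall s t, 0 <= s -> s <= t -> h t <= h s,
          h s @[s --> +oo] --> (0 : R)
        & forall n g, E n g ->
            inner nu (qrep a nu g constant1) (cindic [set b | r <= d b (e n g)])
              / harish_chandra a nu g <= (h (L g))%:C]) ->
  (forall U V : set B, continuity_set nu U -> continuity_set nu V ->
    (limn_esup (fun n => ((vol mu (E n))^-1)%:E *
       \int[mu]_(g in E n) (\1_U (e n (g^-1)%g) * \1_V (e n g))%:E)
     <= nu U * nu V)%E) ->
  (forall U V W : set B,
     continuity_set nu U -> continuity_set nu V -> continuity_set nu W ->
     (inner nu (avg_op a nu mu (E n) (e n) (cindic U) (cindic V)) (cindic W)
        : (R[i])^o) @[n --> \oo] -->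
     ((fine (nu (U `&` W)) * fine (nu V))%:C : (R[i])^o))
  /\
  ((ereal_sup [set cnorm nu +oo (avg_op a nu mu (E n) (e n) constant1 constant1)
              | n in [set n | mu (E n) != 0]] < +oo)%E ->
   forall f, Linfty_closure nu (continuity_span nu) f ->
     (exists f0, representatives nu (continuity_span nu) f f0) /\
     (forall f0, representatives nu (continuity_span nu) f f0 ->
        ergodic_relative a nu mu E e f0)).
Proof.
move=> hG lcG scG unimod lh scB qi hb lenL dB pE mE EV volE_oo me conc indep.
have Eoo n : (mu (E n) < +oo)%E by exact: haar_precompact (pE n).
have volE_gt0 : \forall n \near \oo, (0 < mu (E n))%E.
  by move/cvgeyPgt : volE_oo => /(_ 0).
have muV (A : set (borel G)) : measurable A -> mu [set (g^-1)%g | g in A] = mu A.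
  (* Some [E n] has positive finite volume and serves as the set to be cancelled. *)
  have [n _ /(_ n (leqnn n)) E0] := volE_gt0.
  by move=> mA; apply: (unimodular_invg scG (K := E n)) => //; rewrite E0 Eoo.
have weight n : exists (w : borel G * borel B -> R) (M : R),
    [/\ measurable_fun setT w, forall z, 0 <= w z, forall z, w z <= M &
      {ae mu, forall g, E n g ->
        {ae nu, forall b, w (g, b) = sdens a nu g b / Xi a nu g}}].
  have [C C0 sC] := sdens_bounded scG lcG hb (pE n).
  have [w [mw wb wE]] := weight_exists scG scB qi (mE n) (Eoo n) C0 sC.
  by exists w, (C * C); split => // z; have /andP[] := wb z.
have limit_indic := tavg_indic_cvg scG scB lh qi lenL dB Eoo mE EV muV volE_oo me
  conc indep weight.
have bindic (U : set B) : continuity_set nu U -> bmeas (\1_U : borel B -> R).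
  by move=> [mU _]; exact: bmeas_indic.
split.
  move=> U V W cU cV cW.
  have innE n : inner nu (avg_op a nu mu (E n) (e n) (cindic U) (cindic V)) (cindic W) =
      (tavg a nu mu (E n) (e n) \1_U \1_V \1_W)%:C.
    have [w [M [mw w0 wM wE]]] := weight n.
    exact: (avg_op_inner qi scG scB (mE n) (Eoo n) (EV n) muV (me n) mw w0 wM wE
      (bindic _ cU) (bindic _ cV) (bindic _ cW)).
  under eq_cvg do rewrite innE.
  by apply: cvg_complex => /=; [exact: limit_indic|exact: cvg_cst].
move=> supoo f hf; split; first exact: representative_exists.
move=> f0 [uf0 _] phi psi Lphi Lpsi {hf}; clear f.
have [K K0 opK] : exists2 K : R, 0 <= K & forall n, mu (E n) != 0%E ->
    (cnorm nu +oo (avg_op a nu mu (E n) (e n) constant1 constant1) <= K%:E)%E.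
  set S := ereal_sup _ in supoo.
  have [K K0 SK] : exists2 K : R, 0 <= K & (S <= K%:E)%E.
    move: supoo; case: S => [r _||_] //; last by exists 0 => //; rewrite leNye.
    by exists `|r| => //; rewrite lee_fin ler_norm.
  exists K => // n En0; apply: le_trans SK; apply: ereal_sup_ubound.
  by exists n.
pose T n := tavg a nu mu (E n) (e n).
have T1 n c f f' F H : bmeas f -> bmeas f' -> L2r nu F -> L2r nu H ->
    T n (fun b => c * f b + f' b) F H = c * T n f F H + T n f' F H.
  have [w [M [mw w0 wM wE]]] := weight n.
  exact: (tavgZD_1 scG scB qi (mE n) (Eoo n) (EV n) muV (me n) mw w0 wM wE).
have T2 n c f F F' H : bmeas f -> L2r nu F -> L2r nu F' -> L2r nu H ->
    T n f (fun b => c * F b + F' b) H = c * T n f F H + T n f F' H.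
  have [w [M [mw w0 wM wE]]] := weight n.
  exact: (tavgZD_2 scG scB qi (mE n) (Eoo n) (EV n) muV (me n) mw w0 wM wE).
have T3 n c f F H H' : bmeas f -> L2r nu F -> L2r nu H -> L2r nu H' ->
    T n f F (fun b => c * H b + H' b) = c * T n f F H + T n f F H'.
  have [w [M [mw w0 wM wE]]] := weight n.
  exact: (tavgZD_3 scG scB qi (mE n) (Eoo n) (EV n) muV (me n) mw w0 wM wE).
(* Once the volume is positive, [avgfun] of the constants 1 agrees almost everywhere with the real
   part of [M 1], which is at most [K]; the Schur test and the weighted inequality give the rest. *)
have Tbound : \forall n \near \oo, forall S t (f F H : borel B -> R),
    0 < t -> measurable_fun setT f -> (forall b, `|f b| <= S) ->
    L2r nu F -> L2r nu H ->
    `|T n f F H| <= S * K * (t * sqnorm nu F + sqnorm nu H / t).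
  apply: filterS volE_gt0 => n En0 S t f1 F H t0 mf fS LF LH.
  have [w [M [mw w0 wM wE]]] := weight n.
  apply: (tavg_bound scG scB qi (mE := mE n) (Eoo := Eoo n) (EV n) muV (me n) mw w0 wM wE) => //.
  apply: (avgfun_weight_bound (a := a) (e := e n) mw w0 wM); last by rewrite fine_gt0// En0 Eoo.
  have opae := avg_op_ae qi scG scB (mE n) (Eoo n) (EV n) muV (me n) mw w0 wM wE
    (bmeas_cst 1) (bmeas_cst 1).
  have En1 : mu (E n) != 0%E by rewrite gt_eqF.
  have opb := ae_le_cnorm_oo (opK n En1).
  apply: filterS2 opae opb => b <- hopb.
  by apply: (le_trans (ler_norm _)); apply: (le_trans (Re_le_normc _)).
have [br bi cvgT] := uniform_closure_converges dB T1 T2 T3 K0 Tbound limit_indic uf0.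
have [LFr LFi] := L2_parts Lphi; have [LHr LHi] := L2_parts Lpsi.
have coefE n := let: ex_intro w (ex_intro M (And4 mw w0 wM wE)) := weight n in
  avg_coefE qi scG scB (mE n) (Eoo n) (EV n) muV (me n) mw w0 wM wE br bi Lphi Lpsi.
set fr := fun b : borel B => complex.Re (f0 b).
set fi := fun b : borel B => complex.Im (f0 b).
set Fr := fun b : borel B => complex.Re (phi b).
set Fi := fun b : borel B => complex.Im (phi b).
set Hr := fun b : borel B => complex.Re (psi b).
set Hi := fun b : borel B => complex.Im (psi b).
have innphi : inner nu phi constant1 = (\int[nu]_b Fr b) +i* (\int[nu]_b Fi b).
  by rewrite /inner /cintegral; congr (_ +i* _); apply: eq_Rintegral => b _;
    rewrite !partsE/= /Fr /Fi; ring.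
have innf : inner nu f0 psi =
    (\int[nu]_b (fr b * Hr b) + \int[nu]_b (fi b * Hi b)) +i*
    (\int[nu]_b (fi b * Hr b) - \int[nu]_b (fr b * Hi b)).
  rewrite /inner /cintegral; congr (_ +i* _).
    rewrite -RintegralD//; [|exact: L2r_integrable..].
    by apply: eq_Rintegral => b _; rewrite !partsE /fr /fi /Hr /Hi; ring.
  rewrite -RintegralB//; [|exact: L2r_integrable..].
  by apply: eq_Rintegral => b _; rewrite !partsE /fr /fi /Hr /Hi; ring.
have cr F H LF LH := (cvgT F H LF LH).1; have ci F H LF LH := (cvgT F H LF LH).2.
apply: cvg_complex.
  rewrite (_ : complex.Re (_ * inner nu f0 psi) =
      limit_form nu fr Fr Hr + limit_form nu fr Fi Hi -
      limit_form nu fi Fi Hr + limit_form nu fi Fr Hi); last first.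
    by rewrite innphi innf !partsE/= /limit_form; ring.
  under eq_cvg do rewrite coefE/=.
  by apply: cvgD; [apply: cvgB; [apply: cvgD|]|]; [exact: cr|exact: cr|exact: ci|exact: ci].
rewrite (_ : complex.Im (_ * inner nu f0 psi) =
    limit_form nu fr Fi Hr - limit_form nu fr Fr Hi +
    limit_form nu fi Fr Hr + limit_form nu fi Fi Hi); last first.
  by rewrite innphi innf !partsE/= /limit_form; ring.
under eq_cvg do rewrite coefE/=.
by apply: cvgD; [apply: cvgD; [apply: cvgB|]|]; [exact: cr|exact: cr|exact: ci|exact: ci].
Qed.
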